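(* Let $n'$ and the points $\mathbf z'_1,\dots,\mathbf z'_{n'}\in\mathcal Z$ be fixed. Suppose that the kernel $K$ satisfies (A1) of the context, that $h_n\to0$ and $nh_n^p\to\infty$, that $K(\mathbf t)|\mathbf t|^p\to0$ when $|\mathbf t|\to\infty$, and that $f_{\mathbf Z}$ and $\mathbf z\mapsto\tau_{1,2|\mathbf Z=\mathbf z}$ are continuous on $\mathcal Z$. If $\lambda=\lambda_{n,n'}\to\lambda_0$, then, given $\mathbf z'_1,\dots,\mathbf z'_{n'}$ and as $n\to\infty$, $$\hat\beta_{n,n'}\ \longrightarrow\ \beta^{**}:=\arg\min_{\beta\in\mathbb R^{p'}}\mathbb G_{\infty,n'}(\beta)\quad\text{in probability},$$ where $$\mathbb G_{\infty,n'}(\beta):=\frac1{n'}\sum_{i=1}^{n'}\big(\boldsymbol\psi(\mathbf z'_i)^T(\beta^*-\beta)\big)^2+\lambda_0|\beta|_1 .$$ In particular, if $\lambda_0=0$ and the vectors $\boldsymbol\psi(\mathbf z'_1),\dots,\boldsymbol\psi(\mathbf z'_{n'})$ span $\mathbb R^{p'}$, then $\hat\beta_{n,n'}\to\beta^*$ in probability.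
   Context: Setting. $(\mathbf X,\mathbf Z)$ with $\mathbf X=(X_1,X_2)\in\mathbb R^2$ and $\mathbf Z\in\mathbb R^p$ is a random vector; $f_{\mathbf Z}$ is the density of $\mathbf Z$. $\mathcal Z\subset\mathbb R^p$ is a compact set on which $f_{\mathbf Z}$ is bounded from below by a positive constant. $(\mathbf X_i,\mathbf Z_i)$, $i=1,\dots,n$, $\mathbf X_i=(X_{i,1},X_{i,2})$, are i.i.d. copies of $(\mathbf X,\mathbf Z)$. $g^*$ is one of $g_1(\mathbf x_1,\mathbf x_2)=4\cdot\mathbf 1\{x_{1,1}<x_{2,1},x_{1,2}<x_{2,2}\}-1$; $g_2(\mathbf x_1,\mathbf x_2)=\mathbf 1\{(x_{1,1}-x_{2,1})(x_{1,2}-x_{2,2})>0\}-\mathbf 1\{(x_{1,1}-x_{2,1})(x_{1,2}-x_{2,2})<0\}$; $g_3(\mathbf x_1,\mathbf x_2)=1-4\cdot\mathbf 1\{x_{1,1}<x_{2,1},x_{1,2}>x_{2,2}\}$. The conditional Kendall's tau is $\tau_{1,2|\mathbf Z=\mathbf z}=\mathbb P((X_{1,1}-X_{2,1})(X_{1,2}-X_{2,2})>0\mid\mathbf Z_1=\mathbf Z_2=\mathbf z)-\mathbb P((X_{1,1}-X_{2,1})(X_{1,2}-X_{2,2})<0\mid\mathbf Z_1=\mathbf Z_2=\mathbf z)=\mathbb E[g^*(\mathbf X_1,\mathbf X_2)\mid\mathbf Z_1=\mathbf Z_2=\mathbf z]$. Its kernel estimator is $\hat\tau_{1,2|\mathbf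 Z=\mathbf z}=\sum_{i,j=1}^nw_{i,n}(\mathbf z)w_{j,n}(\mathbf z)g^*(\mathbf X_i,\mathbf X_j)$, $w_{i,n}(\mathbf z)=K_h(\mathbf Z_i-\mathbf z)/\sum_{j=1}^nK_h(\mathbf Z_j-\mathbf z)$, where $K:\mathbb R^p\to\mathbb R$ is a kernel, $h=h_n>0$ the bandwidth, $K_h(\mathbf u)=h^{-p}K(\mathbf u/h)$. Model. $\Lambda:[-1,1]\to\mathbb R$ is a known increasing continuously differentiable function, $\boldsymbol\psi=(\psi_1,\dots,\psi_{p'})^T:\mathbb R^p\to\mathbb R^{p'}$ is known, and for an unknown $\beta^*\in\mathbb R^{p'}$, $\Lambda(\tau_{1,2|\mathbf Z=\mathbf z})=\boldsymbol\psi(\mathbf z)^T\beta^*$ for all $\mathbf z\in\mathcal Z$. $|\cdot|_1$ is the $l_1$ norm. Estimator. $\hat\beta_{n,n'}:=\arg\min_{\beta\in\mathbb R^{p'}}\big[\frac1{n'}\sum_{i=1}^{n'}(\Lambda(\hat\tau_{1,2|\mathbf Z=\mathbf z'_i})-\boldsymbol\psi(\mathbf z'_i)^T\beta)^2+\lambda_{n,n'}|\beta|_1\big]$ with $\lambda_{n,n'}\ge0$. The notation $\arg\min$ for the limiting criterion denotes its unique minimizer (uniqueness is presupposed by the notation). (A1) $K$ is bounded, symmetrical, $\int K=1$, $\int|K|<\infty$, and of order $\alpha$ for some integer $\alpha>1$: for all $j=1,\dots,\alpha-1$ and all indices $i_1,\dots,i_j\in\{1,\dots,p\}$, $\int_{\mathbb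 R^p}K(\mathbf u)u_{i_1}\cdots u_{i_j}d\mathbf u=0$.
   Formalization: Continuity of z↦τ on 𝒵 is strengthened to joint continuity at (z,z), z∈𝒵, of Kendall's tau given Z1=z1, Z2=z2 (diagonal continuity alone fails: X=(U+1/Z,V+1/Z)); f_Z is continuous at points of 𝒵 within R^p; Λ is extended beyond [-1,1], continuously at its points. *)

(* Defs.v *)
From HB Require Import structures.
From mathcomp Require Import all_boot all_order all_algebra finmap.
From mathcomp Require Import all_classical all_reals all_analysis.
From mathcomp Require Import measurable_realfun.

Set Implicit Arguments.
Unset Strict Implicit.
Unset Printing Implicit Defensive.

Import Order.TTheory GRing.Theory Num.Theory.
Import numFieldNormedType.Exports.

Local Open Scope classical_set_scope.
Local Open Scope ring_scope.

Section borel_rV.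
Variables (R : realType) (n : nat).

Let coor (i : 'I_n) (v : 'rV[R]_n) : R := v 0 i.

Let rV_set0 : g_sigma_preimage coor set0.
Proof. exact: sigma_algebra0. Qed.

Let rV_setC A : g_sigma_preimage coor A -> g_sigma_preimage coor (~` A).
Proof. exact: sigma_algebraC. Qed.

Let rV_bigcup (F : (set 'rV[R]_n)^nat) :
  (forall i, g_sigma_preimage coor (F i)) ->
  g_sigma_preimage coor (\bigcup_i (F i)).
Proof. exact: sigma_algebra_bigcup. Qed.

(* The sigma-algebra generated by the coordinates, that is, the Borel one. *)
HB.instance Definition _ := @isMeasurable.Build default_measure_display
  'rV[R]_n (g_sigma_preimage coor) rV_set0 rV_setC rV_bigcup.

Lemma measurable_coor (i : 'I_n) :
  measurable_fun [set: 'rV[R]_n] (fun v : 'rV[R]_n => v 0 i).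
Proof.
move=> _ Y mY; rewrite setTI; apply: sub_sigma_algebra => /=.
rewrite -bigcup_seq/=; exists i => /=; first by rewrite mem_index_enum.
by exists Y => //; rewrite setTI.
Qed.

Lemma measurable_fun_rVP d (T : measurableType d) (f : T -> 'rV[R]_n) :
  measurable_fun [set: T] f <->
  forall i, measurable_fun [set: T] (fun x => f x 0 i).
Proof.
split=> [mf i|mf].
  exact: (measurableT_comp (measurable_coor i) mf).
have H : g_sigma_preimage (fun i x => coor i (f x)) `<=` measurable.
  apply: smallest_sub; first exact: sigma_algebra_measurable.
  rewrite -bigcup_seq/=; apply: bigcup_sub => i _ A [B mB <-].
  exact: mf.
move=> _ A mA; apply: H.
by rewrite (g_sigma_preimage_comp coor f); exists A.
Qed.

End borel_rV.

Section lebesgue_rV.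
Variable R : realType.
Local Open Scope ereal_scope.

Definition rV_cons n (xv : R * 'rV[R]_n) : 'rV[R]_n.+1 :=
  (\row_i oapp (fun j => xv.2 0 j) xv.1 (unlift ord0 i))%R.

Definition rV_uncons n (w : 'rV[R]_n.+1) : R * 'rV[R]_n :=
  (w 0 ord0, \row_j w 0 (lift ord0 j))%R.

Lemma rV_unconsK n : cancel (@rV_uncons n) (@rV_cons n).
Proof.
by move=> w; apply/rowP => i; rewrite mxE; case: unliftP => [j|] -> /=;
  rewrite ?mxE.
Qed.

Lemma rV_consK n : cancel (@rV_cons n) (@rV_uncons n).
Proof.
move=> [x v]; rewrite /rV_uncons mxE unlift_none/=; congr (_, _).
by apply/rowP => j; rewrite !mxE liftK.
Qed.

Lemma measurable_rV_cons n : measurable_fun setT (@rV_cons n).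
Proof.
apply/measurable_fun_rVP => i; case: (unliftP ord0 i) => [j ij|i0].
  rewrite (_ : (fun _ => _) = (fun v : 'rV[R]_n => v 0%R j) \o snd).
    by apply: measurableT_comp => //; exact: measurable_coor.
  by apply/funext => xv /=; rewrite mxE ij liftK.
rewrite (_ : (fun _ => _) = fst); first exact: measurable_fst.
by apply/funext => xv; rewrite mxE i0 unlift_none.
Qed.

Lemma measurable_rV_uncons n : measurable_fun setT (@rV_uncons n).
Proof.
apply: measurable_fun_pair; first exact: measurable_coor.
apply/measurable_fun_rVP => j.
rewrite (_ : (fun _ => _) = fun w : 'rV[R]_n.+1 => w 0%R (lift ord0 j)).
  exact: measurable_coor.
by apply/funext => w; rewrite mxE.
Qed.

Section step.
Variables (n : nat) (mu : {sigma_finite_measure set 'rV[R]_n -> \bar R}).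

Definition lebesgue_rV_step :=
  pushforward (@lebesgue_measure R \x mu) (@rV_cons n).

Let step0 : lebesgue_rV_step set0 = 0.
Proof. by rewrite /lebesgue_rV_step /pushforward preimage_set0 measure0. Qed.

Let step_ge0 A : 0 <= lebesgue_rV_step A.
Proof. by rewrite /lebesgue_rV_step /pushforward measure_ge0. Qed.

Let step_sigma_additive : semi_sigma_additive lebesgue_rV_step.
Proof.
move=> F mF tF mUF; rewrite /lebesgue_rV_step /pushforward preimage_bigcup.
have mcons A : measurable A -> measurable (@rV_cons n @^-1` A).
  by move=> mA; rewrite -[X in measurable X]setTI; exact: measurable_rV_cons.
apply: measure_semi_sigma_additive.
- by move=> k; exact: mcons.
- apply/trivIsetP => /= i j _ _ ij; rewrite -preimage_setI.
  by move/trivIsetP : tF => /(_ _ _ _ _ ij) ->//; rewrite preimage_set0.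
- by rewrite -preimage_bigcup; exact: mcons.
Qed.

HB.instance Definition _ := isMeasure.Build _ _ _ lebesgue_rV_step
  step0 step_ge0 step_sigma_additive.

Let step_sigma_finite : sigma_finite setT lebesgue_rV_step.
Proof.
have /sigma_finiteP[F [TF ndF Foo]] := sigma_finiteT (@lebesgue_measure R).
have /sigma_finiteP[G [TG ndG Goo]] := sigma_finiteT mu.
exists (fun k => @rV_uncons n @^-1` (F k `*` G k)).
  rewrite -preimage_bigcup -(preimage_setT (@rV_uncons n)); congr (_ @^-1` _).
  rewrite -setXTT TF TG predeqE => -[x y]; split.
    move=> [/= [i _ Fix] [j _ Gjy]]; exists (maxn i j) => //; split.
    - by move: x Fix; exact/subsetPset/ndF/leq_maxl.
    - by move: y Gjy; exact/subsetPset/ndG/leq_maxr.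
  by move=> [i _ []/= ? ?]; split; exists i.
move=> k; have [mFk Fk] := Foo k; have [mGk Gk] := Goo k; split.
  rewrite -[X in measurable X]setTI; apply: measurable_rV_uncons => //.
  exact: measurableX.
rewrite /lebesgue_rV_step /pushforward -comp_preimage.
rewrite (_ : @rV_uncons n \o @rV_cons n = id) ?preimage_id//.
  by rewrite product_measure1E// lte_mul_pinfty// ge0_fin_numE.
by apply/funext => xv; exact: rV_consK.
Qed.

HB.instance Definition _ := Measure_isSigmaFinite.Build _ _ _
  lebesgue_rV_step step_sigma_finite.

End step.

(* Lebesgue measure on R^n. *)
Fixpoint lebesgue_rV n : {sigma_finite_measure set 'rV[R]_n -> \bar R} :=
  if n is m.+1 then lebesgue_rV_step (lebesgue_rV m)
  else \d_(0%R : 'rV[R]_0).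

End lebesgue_rV.

Section vectors.
Variables (R : realType) (n : nat).
Implicit Types u v : 'rV[R]_n.

Definition dotv u v : R := \sum_i u 0 i * v 0 i.
Definition norm2 v : R := Num.sqrt (dotv v v).
Definition norm1 v : R := \sum_i `|v 0 i|.

Definition is_argmin (G : 'rV[R]_n -> R) v := forall u, G v <= G u.
Definition is_unique_argmin (G : 'rV[R]_n -> R) v :=
  is_argmin G v /\ forall u, is_argmin G u -> u = v.

End vectors.

Section regularity.
Variable R : realType.

(* The derivatives at the endpoints are one-sided. *)
Definition C1_on_segment (a b : R) (f : R -> R) :=
  exists2 f' : R -> R, {within `[a, b], continuous f'} &
    forall x, x \in `[a, b] ->
      (fun y => (f y - f x) / (y - x)) @ within `[a, b]%classic x^' --> f' x.

(* A link function lives on [-1, 1], but a kernel estimate of Kendall's tau may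
   leave this interval when the kernel takes negative values. Lam therefore
   stands for an arbitrary extension to R which remains continuous at the points
   of [-1, 1], such as the one that is constant on each side of [-1, 1]. *)
Record is_link_function (Lam : R -> R) : Prop := {
  link_increasing : {in `[-1, 1] &, {homo Lam : x y / x < y}} ;
  link_C1 : C1_on_segment (-1) 1 Lam ;
  link_extension : forall t, t \in `[-1, 1] -> {for t, continuous Lam} }.

End regularity.

Section kernels.
Variables (R : realType) (p : nat).
Local Notation leb := (@lebesgue_rV R p).

(* The integral of a measurable function can only be finite here if the function
   is integrable, so the last item includes the existence of the moments. *)
Record kernel_of_order (alpha : nat) (K : 'rV[R]_p -> R) : Prop := {
  kernel_measurable : measurable_fun [set: 'rV[R]_p] K ;
  kernel_bounded : exists M, forall u, `|K u| <= M ;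
  kernel_symmetric : forall u, K (- u) = K u ;
  kernel_abs_integrable : (\int[leb]_u `|K u|%:E < +oo)%E ;
  kernel_integral : (\int[leb]_u (K u)%:E = 1)%E ;
  kernel_moments : forall (j : nat) (i : 'I_j -> 'I_p), (0 < j < alpha)%N ->
    (\int[leb]_u (K u * \prod_(k < j) u 0 (i k))%:E = 0)%E }.

Definition scaled_kernel (h : R) (K : 'rV[R]_p -> R) (u : 'rV[R]_p) : R :=
  h ^- p * K (h^-1 *: u).

End kernels.

Section concordance.
Variable R : realType.
Implicit Types x : R * R.

Definition g1 x1 x2 : R :=
  4 * ((x1.1 < x2.1)%R && (x1.2 < x2.2)%R)%:R - 1.
Definition g2 x1 x2 : R :=
  (0 < (x1.1 - x2.1) * (x1.2 - x2.2))%R%:R -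
  ((x1.1 - x2.1) * (x1.2 - x2.2) < 0)%R%:R.
Definition g3 x1 x2 : R :=
  1 - 4 * ((x1.1 < x2.1)%R && (x2.2 < x1.2)%R)%:R.

Definition concordant : set ((R * R) * (R * R)) :=
  [set x | 0 < (x.1.1 - x.2.1) * (x.1.2 - x.2.2)].
Definition discordant : set ((R * R) * (R * R)) :=
  [set x | (x.1.1 - x.2.1) * (x.1.2 - x.2.2) < 0].

End concordance.

Section conditional_law.
Variables (R : realType) (p : nat).
Implicit Type kappa : 'rV[R]_p -> probability (R * R)%type R.

(* kappa is a regular conditional distribution of X given Z. *)
Record is_conditional_law d (Omega : measurableType d) (P : probability Omega R)
    (X : {RV P >-> (R * R)%type}) (Z : {RV P >-> 'rV[R]_p}) kappa : Prop := {
  conditional_law_measurable : forall A, measurable A ->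
    measurable_fun [set: 'rV[R]_p] (fun z => kappa z A) ;
  conditional_lawE : forall A B, measurable A -> measurable B ->
    (P (X @^-1` A `&` Z @^-1` B) = \int[distribution P Z]_(z in B) kappa z A)%E }.

(* For kappa as above and independent copies (X1, Z1), (X2, Z2) of (X, Z), the
   conditional law of (X1, X2) given Z1 = z1 and Z2 = z2. *)
Definition pair_law kappa (z1 z2 : 'rV[R]_p) := (kappa z1 \x kappa z2)%E.

Definition cond_tau2 kappa (z1 z2 : 'rV[R]_p) : R :=
  fine (pair_law kappa z1 z2 (@concordant R)) -
  fine (pair_law kappa z1 z2 (@discordant R)).

(* Conditional Kendall's tau: the conditioning event is Z1 = Z2 = z. *)
Definition cond_tau kappa (z : 'rV[R]_p) : R := cond_tau2 kappa z z.

(* Continuity of z |-> cond_tau kappa z at z, understood for the conditional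
   expectation as a function of the two conditioning values: the event
   Z1 = Z2 = z is null, and smoothing over (Z1, Z2) near (z, z) only involves
   pairs with Z1 != Z2. Continuity along the diagonal alone does not constrain
   these: if X = (U + 1/Z, V + 1/Z) with U, V and Z independent, then cond_tau
   vanishes everywhere, while pairs with Z1 != Z2 near 0 are mostly
   concordant. *)
Definition cond_tau_continuous_at kappa (z : 'rV[R]_p) :=
  {for (z, z), continuous (fun zz : 'rV[R]_p * 'rV[R]_p =>
     cond_tau2 kappa zz.1 zz.2)}.

(* E[g(X1, X2) | Z1 = z1, Z2 = z2]. *)
Definition cond_mean2 kappa (g : R * R -> R * R -> R) (z1 z2 : 'rV[R]_p) : R :=
  \int[pair_law kappa z1 z2]_x g x.1 x.2.

End conditional_law.

Section sampling.
Context (R : realType) (p : nat) d (Omega : measurableType d).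
Variable P : probability Omega R.

Definition is_density (Z : {RV P >-> 'rV[R]_p}) (f : 'rV[R]_p -> R) :=
  [/\ measurable_fun [set: 'rV[R]_p] f, forall z, 0 <= f z &
    forall B, measurable B ->
      (distribution P Z B = \int[@lebesgue_rV R p]_(z in B) (f z)%:E)%E].

Variables (X : {RV P >-> (R * R)%type}) (Z : {RV P >-> 'rV[R]_p}).
Variables (Xs : nat -> {RV P >-> (R * R)%type}).
Variables (Zs : nat -> {RV P >-> 'rV[R]_p}).

Definition iid_copies :=
  (forall i (A : set ((R * R) * 'rV[R]_p)), measurable A ->
     P [set w | A (Xs i w, Zs i w)] = P [set w | A (X w, Z w)]) /\
  (forall (J : {fset nat}) (A : nat -> set ((R * R) * 'rV[R]_p)),
     (forall i, measurable (A i)) ->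
     P (\bigcap_(i in [set` J]) [set w | A i (Xs i w, Zs i w)]) =
     (\prod_(i <- J) P [set w | A i (Xs i w, Zs i w)])%E).

Definition cvg_in_probability q (b_ : nat -> {RV P >-> 'rV[R]_q})
    (b : 'rV[R]_q) :=
  forall e : R, 0 < e ->
    (fun n => P [set w | e < norm2 (b_ n w - b)]) @ \oo --> 0%E.

End sampling.

Section estimators.
Context (R : realType) (p : nat).
Variables (K : 'rV[R]_p -> R) (h : R) (g : R * R -> R * R -> R).
Variables (n : nat) (x : nat -> R * R) (z : nat -> 'rV[R]_p).

(* x and z list the observations, of which the first n are used. *)
Definition kernel_mass (z0 : 'rV[R]_p) : R :=
  \sum_(j < n) scaled_kernel h K (z j - z0).

Definition kernel_weight (z0 : 'rV[R]_p) (i : nat) : R :=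
  scaled_kernel h K (z i - z0) / kernel_mass z0.

Definition tau_hat (z0 : 'rV[R]_p) : R :=
  \sum_(i < n) \sum_(j < n)
    kernel_weight z0 i * kernel_weight z0 j * g (x i) (x j).

End estimators.

Definition lasso_criterion (R : realType) (q m : nat) (y : 'I_m -> R)
    (a : 'I_m -> 'rV[R]_q) (lambda : R) (b : 'rV[R]_q) : R :=
  m%:R^-1 * (\sum_(i < m) (y i - dotv (a i) b) ^+ 2) + lambda * norm1 b.

Definition limit_criterion (R : realType) (q m : nat) (a : 'I_m -> 'rV[R]_q)
    (bstar : 'rV[R]_q) (lambda0 : R) (b : 'rV[R]_q) : R :=
  m%:R^-1 * (\sum_(i < m) dotv (a i) (bstar - b) ^+ 2) + lambda0 * norm1 b.

(* Main.v *)
Require Import Defs.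
From HB Require Import structures.
From mathcomp Require Import all_boot all_order all_algebra finmap.
From mathcomp Require Import all_classical all_reals all_analysis.
From mathcomp Require Import measurable_realfun.
From mathcomp Require Import ring lra.

(** For fixed design points the data enter the criterion only through the
finitely many numbers Lam (tau_hat (z' i)), so the theorem splits into a
deterministic and a probabilistic half.

Deterministic half, [lasso_argmin_stable]. The criterion is convex. On a small
sphere around its unique minimizer the limiting criterion exceeds its minimum
by a margin, by compactness. When the responses and the penalty are close to
their limits the criterion moves by less than half of that margin on the ball,
so it is still larger on the sphere than at the centre; by convexity it is then
larger than at the centre everywhere outside the ball, and all its minimizers
lie in the ball. Continuity of Lam on [-1, 1] turns closeness of the estimates
of Kendall's tau into closeness of the responses.

Probabilistic half, [tau_hat_consistent]. Write k_i for the kernel h^-p K((Z_i -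
z0) / h). By [tau_hat_error],
  tau_hat - tau = (sum_i k_i)^-2 * sum_ij k_i k_j (g(X_i, X_j) - tau).
- The sum of the k_i divided by n tends to f(z0) > 0: its mean does by Parzen's
  lemma ([parzen_cvg]), and its variance is of order 1 / (n h^p).
- The double sum divided by n^2 tends to 0. Pairs of disjoint pairs of indices
  are independent ([expectationM_pairs]) and contribute the square of the mean
  of a single term; all other quadruples of indices together contribute
  O(1 / (n h^p)), because a repeated index can be paid with the bound h^-p M on
  the kernel ([pair_sum_second_moment]).
- The mean of a single term is, after conditioning on (Z_i, Z_j), the mean of
  k_i k_j (tau(Z_i, Z_j) - tau), where tau(u, v) is the two-point version of
  Kendall's tau ([symm_conditional]). It tends to 0 since tau(u, v) is
  continuous at (z0, z0) and the kernel puts no mass away from z0 in the limit.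

The three choices of g are treated at once. Only the symmetrization of g matters
in the double sum, and it equals concordance minus discordance plus a multiple c
of the indicator of ties. If c <> 0, the two expressions of Kendall's tau at
Z_1 = Z_2 = z can agree only if two independent draws from the conditional law
given Z = z almost never tie, that is, if the margins of this law have no atoms;
and then draws given two different values do not tie either ([no_tie]).

A union bound over the design points and Chebyshev's inequality conclude. When
the penalty vanishes in the limit and the psi (z' i) span the space, the limiting
criterion is a definite quadratic form centred at the true parameter, which is
therefore its unique minimizer. *)

Set Implicit Arguments.
Unset Strict Implicit.
Unset Printing Implicit Defensive.

Import Order.TTheory GRing.Theory Num.Theory.
Import numFieldNormedType.Exports.

Local Open Scope classical_set_scope.
Local Open Scope ring_scope.

(** * Norms on row vectors and stability of lasso minimizers *)

Lemma continuous_sum (R : realType) (T : topologicalType) (I : finType)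
    (f : I -> T -> R) :
  (forall i, continuous (f i)) -> continuous (fun x => \sum_i f i x).
Proof.
move=> cf x; elim: (index_enum I) => [|i s IHs].
  by under eq_fun do rewrite big_nil; exact: cvg_cst.
under eq_fun do rewrite big_cons.
by apply: cvgD => //; exact: cf.
Qed.

Section vector_norms.
Variables (R : realType) (q : nat).
Implicit Types u v : 'rV[R]_q.

Lemma norm2_ge0 v : 0 <= norm2 v. Proof. exact: sqrtr_ge0. Qed.

Lemma normr_coord_le_norm2 v (i : 'I_q) : `|v 0 i| <= norm2 v.
Proof.
rewrite -sqrtr_sqr ler_wsqrtr// /dotv (bigD1 i)//= -expr2 lerDl.
by apply: sumr_ge0 => j _; rewrite -expr2 sqr_ge0.
Qed.

Lemma normr_coord_le v (i : 'I_q) : `|v 0 i| <= `|v|.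
Proof.
rewrite [leRHS]mx_normrE.
by apply: (le_trans _ (le_bigmax _ (fun i => `|v i.1 i.2|) (0, i))).
Qed.

Lemma mx_norm_le_norm2 v : `|v| <= norm2 v.
Proof.
rewrite [leLHS]mx_normrE; apply/bigmax_leP; split; first exact: norm2_ge0.
by move=> [i j] _ /=; rewrite ord1 normr_coord_le_norm2.
Qed.

Lemma norm2Z (c : R) v : norm2 (c *: v) = `|c| * norm2 v.
Proof.
rewrite /norm2 -sqrtr_sqr -sqrtrM ?sqr_ge0//; congr Num.sqrt.
by rewrite /dotv mulr_sumr; apply: eq_bigr => i _; rewrite !mxE; ring.
Qed.

Lemma norm2_ball u v (r : R) : norm2 (v - u) < r -> ball u r v.
Proof.
move=> uv; rewrite -ball_normE /= -normrN opprB.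
exact: le_lt_trans (mx_norm_le_norm2 _) uv.
Qed.

Lemma norm1_le_mx_norm v : norm1 v <= q%:R * `|v|.
Proof.
have -> : q%:R * `|v| = \sum_(i < q) `|v| by rewrite sumr_const card_ord mulr_natl.
by apply: ler_sum => i _; exact: normr_coord_le.
Qed.

Lemma norm2_le_mx_norm v : norm2 v <= q%:R * `|v|.
Proof.
have n1 : 0 <= norm1 v by apply: sumr_ge0.
apply: le_trans (norm1_le_mx_norm v); rewrite -[leRHS]ger0_norm// -sqrtr_sqr.
rewrite ler_wsqrtr// /dotv expr2 {1}/norm1 mulr_suml ler_sum// => i _.
rewrite (le_trans (ler_norm _))// normrM ler_wpM2l//.
by rewrite /norm1 (bigD1 i)//= lerDl sumr_ge0.
Qed.

Lemma normr_dotv_le u v : `|dotv u v| <= norm1 u * `|v|.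
Proof.
rewrite (le_trans (ler_norm_sum _ _ _))// mulr_suml ler_sum// => i _.
by rewrite normrM ler_wpM2l// normr_coord_le.
Qed.

Lemma norm1D u v : norm1 (u + v) <= norm1 u + norm1 v.
Proof.
rewrite /norm1 -big_split ler_sum// => i _.
by rewrite mxE ler_normD.
Qed.

Lemma norm1Z (t : R) v : norm1 (t *: v) = `|t| * norm1 v.
Proof. by rewrite /norm1 mulr_sumr; apply: eq_bigr => i _; rewrite mxE normrM. Qed.

Lemma dotvDr u v w : dotv u (v + w) = dotv u v + dotv u w.
Proof.
by rewrite /dotv -big_split; apply: eq_bigr => i _; rewrite mxE mulrDr.
Qed.

Lemma dotvZr (t : R) u v : dotv u (t *: v) = t * dotv u v.
Proof.
by rewrite /dotv mulr_sumr; apply: eq_bigr => i _; rewrite mxE mulrCA.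
Qed.

Lemma dotvBr u v w : dotv u (v - w) = dotv u v - dotv u w.
Proof. by rewrite dotvDr -scaleN1r dotvZr mulN1r. Qed.

Lemma dotv_continuous u : continuous (dotv u : 'rV[R]_q -> R).
Proof.
apply: continuous_sum => i v.
apply: continuousM; [exact: cst_continuous|exact: coord_continuous].
Qed.

Lemma norm1_continuous : continuous (@norm1 R q : 'rV[R]_q -> R).
Proof.
apply: continuous_sum => i v.
by apply: continuous_comp; [exact: coord_continuous|exact: norm_continuous].
Qed.

End vector_norms.

Section lasso.
Variables (R : realType) (q m : nat) (a : 'I_m -> 'rV[R]_q).
Implicit Types (y : 'I_m -> R) (b : 'rV[R]_q) (l t : R).
Local Notation L := (fun y l b => lasso_criterion y a l b).

Lemma lasso_criterion_continuous y l : continuous (L y l : 'rV[R]_q -> R).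
Proof.
have cr i : continuous (fun b => (y i - dotv (a i) b) ^+ 2 : R).
  pose f b := y i - dotv (a i) b.
  rewrite (_ : (fun b => _) = f \* f); last first.
    by apply/funext => b; rewrite expr2.
  move=> b.
  have cd : {for b, continuous f}.
    by apply: continuousB; [exact: cst_continuous|exact: dotv_continuous].
  exact: continuousM.
pose F b := \sum_i (y i - dotv (a i) b) ^+ 2.
rewrite (_ : (fun b => _) = (cst m%:R^-1 \* F) + (cst l \* @norm1 R q))//.
move=> b; apply: continuousD.
  apply: continuousM; [exact: cst_continuous|exact: continuous_sum].
apply: continuousM; [exact: cst_continuous|exact: norm1_continuous].
Qed.

Lemma lasso_criterion_convex y l b c t : 0 <= l -> 0 <= t <= 1 ->
  L y l ((1 - t) *: b + t *: c) <= (1 - t) * L y l b + t * L y l c.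
Proof.
move=> l0 /andP[t0 t1]; rewrite /lasso_criterion.
have -> (u v w z s : R) : (1 - s) * (u + v) + s * (w + z) =
  ((1 - s) * u + s * w) + ((1 - s) * v + s * z) by ring.
apply: lerD.
  rewrite [(1 - t) * (_ * _)]mulrCA [t * (m%:R^-1 * _)]mulrCA -mulrDr.
  rewrite ler_wpM2l ?invr_ge0//.
  rewrite !mulr_sumr -big_split ler_sum// => i _ /=.
  rewrite dotvDr !dotvZr; set u := dotv _ b; set v := dotv _ c.
  rewrite -subr_ge0 [X in 0 <= X](_ : _ = t * (1 - t) * (u - v) ^+ 2); last by ring.
  by rewrite mulr_ge0 ?sqr_ge0// mulr_ge0// subr_ge0.
rewrite [(1 - t) * (_ * _)]mulrCA [t * (l * _)]mulrCA -mulrDr ler_wpM2l//.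
by rewrite (le_trans (norm1D _ _))// !norm1Z !ger0_norm// subr_ge0.
Qed.

(** The values at b are polynomial in y and affine in l, with coefficients that
stay bounded while b ranges over a ball. *)
Lemma lasso_criterion_near y0 l0 b0 (e r : R) : 0 < e -> 0 < r ->
  exists2 d, 0 < d & forall y l b,
    (forall i, `|y i - y0 i| <= d) -> `|l - l0| <= d -> `|b - b0| <= r ->
    `|L y l b - L y0 l0 b| <= e.
Proof.
move=> e0 r0.
pose N := norm1 b0 + q%:R * r.
(* |(y - w)^2 - (y0 - w)^2| <= |y - y0| (|y - y0| + 2 |y0| + 2 |w|), and
   |y - y0| <= 1 by the choice of d. *)
pose B i := 1 + 2 * `|y0 i| + 2 * (norm1 (a i) * (`|b0| + r)).
have N0 : 0 <= N by rewrite addr_ge0 ?sumr_ge0// mulr_ge0// ltW.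
have B0 i : 0 <= B i.
  rewrite /B !addr_ge0// !mulr_ge0// ?addr_ge0// ?(ltW r0)//.
  exact: sumr_ge0.
have S0 : 0 <= \sum_i B i by apply: sumr_ge0.
have D0 : 0 < \sum_i B i + N + 1 by rewrite ltr_wpDl// addr_ge0.
exists (Num.min 1 (e / (\sum_i B i + N + 1))).
  by rewrite lt_min ltr01 divr_gt0.
move=> y l b yd ld br.
set d := Num.min _ _ in yd ld.
have d0 : 0 <= d by rewrite le_min ler01 divr_ge0// ltW.
have d1 : d <= 1 by rewrite ge_min lexx.
have de : d * (\sum_i B i + N) <= e.
  apply: (@le_trans _ _ (d * (\sum_i B i + N + 1))).
    by rewrite ler_wpM2l// lerDl.
  by rewrite -ler_pdivlMr// ge_min lexx orbT.
apply: le_trans de; rewrite mulrDr /lasso_criterion.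
have -> (u v w z : R) : u + v - (w + z) = (u - w) + (v - z) by ring.
rewrite (le_trans (ler_normD _ _))// lerD//.
  rewrite -mulrBr -sumrB normrM normfV normr_nat.
  have m1 : (m%:R : R)^-1 <= 1.
    case: (m) => [|k]; first by rewrite invr0.
    by rewrite invf_le1// ?ler1n// ltr0n.
  apply: (@le_trans _ _ (`|\sum_i ((y i - dotv (a i) b) ^+ 2
     - (y0 i - dotv (a i) b) ^+ 2)|)); first by rewrite ler_piMl.
  rewrite (le_trans (ler_norm_sum _ _ _))// mulr_sumr ler_sum// => i _.
  set w := dotv _ _; have wB : `|w| <= norm1 (a i) * (`|b0| + r).
    rewrite (le_trans (normr_dotv_le _ _))// ler_wpM2l ?sumr_ge0//.
    by rewrite -[b](subrKC b0) (le_trans (ler_normD _ _))// lerD2l.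
  rewrite [X in `|X|](_ : _ =
    (y i - y0 i) * ((y i - y0 i) + 2 * y0 i - 2 * w)); last by ring.
  rewrite normrM ler_pM//.
  rewrite (le_trans (ler_normB _ _))// lerD//.
    rewrite (le_trans (ler_normD _ _))// lerD//.
      exact: le_trans d1.
    by rewrite normrM ger0_norm.
  by rewrite normrM ger0_norm// ler_wpM2l.
rewrite -mulrBl normrM (ger0_norm (sumr_ge0 _ _))// ler_pM ?sumr_ge0//.
rewrite -[b](subrKC b0) (le_trans (norm1D _ _))// lerD2l.
by rewrite (le_trans (norm1_le_mx_norm _))// ler_wpM2l.
Qed.

(** Convexity confines the comparison to a sphere around b0, where the limiting
criterion is bounded away from its minimum: a point b outside the ball is joined
to b0 by a segment that meets the sphere, and the criterion there is at most the
larger of its values at b0 and at b. *)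
Lemma lasso_argmin_stable y0 l0 b0 (r : R) :
  is_unique_argmin (L y0 l0) b0 -> 0 < r ->
  exists2 d, 0 < d & forall y l b, 0 <= l ->
    (forall i, `|y i - y0 i| <= d) -> `|l - l0| <= d ->
    is_argmin (L y l) b -> `|b - b0| <= r.
Proof.
move=> [b0min b0uniq] r0.
pose S := [set b : 'rV[R]_q | `|b - b0| = r].
have [S0|/set0P/negP/negPn/eqP S0] := pselect (S !=set0); last first.
  exists 1 => // y l b _ _ _ _; rewrite leNgt; apply/negP => rb.
  suff : S (b0 + (r / `|b - b0|) *: (b - b0)) by rewrite S0.
  have nb : 0 < `|b - b0| by apply: lt_trans rb.
  rewrite /S /= [X in `|X|]addrC addKr normrZ ger0_norm; last by rewrite divr_ge0// ltW.
  by rewrite divfK// gt_eqF.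
have cS : compact S.
  apply: bounded_closed_compact.
    exists (r + `|b0|); split; first exact: num_real.
    move=> M rM b Sb; apply: (le_trans _ (ltW rM)).
    by rewrite -[b](subrK b0) (le_trans (ler_normD _ _))// lerD2r Sb.
  rewrite (_ : S = (fun b => `|b - b0|) @^-1` [set r])//.
  apply: closed_comp; last exact: closed_eq.
  move=> b _; apply: (@continuous_comp _ _ _ (fun b => b - b0) (fun b => `|b|)).
    by apply: continuousB; [exact: cvg_id|exact: cst_continuous].
  exact: norm_continuous.
have [c Sc cmin] : exists2 c, S c & forall s, S s -> L y0 l0 c <= L y0 l0 s.
  have cL : {within S, continuous (L y0 l0 : 'rV[R]_q -> R)}.
    exact/continuous_subspaceT/lasso_criterion_continuous.
  have [c /set_mem Sc cmin] := EVT_min_rV S0 cS cL.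
  by exists c => // s /mem_set; exact: cmin.
have eta0 : 0 < L y0 l0 c - L y0 l0 b0.
  rewrite subr_gt0 lt_neqAle b0min andbT; apply/eqP => E.
  have /b0uniq cb : is_argmin (L y0 l0) c by move=> u; rewrite -E; exact: b0min.
  by move: Sc; rewrite /S /= cb subrr normr0 => E'; rewrite -E' ltxx in r0.
set eta := _ - _ in eta0.
have [d d0 dP] := @lasso_criterion_near y0 l0 b0 (eta / 3) r
  (divr_gt0 eta0 (ltr0n _ 3)) r0.
exists d => // y l b l_ge0 yd ld bmin; rewrite leNgt; apply/negP => rb.
have nb : 0 < `|b - b0| by apply: lt_trans rb.
pose t := r / `|b - b0|.
have t01 : 0 <= t <= 1.
  by rewrite divr_ge0 ?(ltW r0)//= ler_pdivrMr// mul1r ltW.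
(* The point of the segment from b0 to b on the sphere. *)
pose b' := (1 - t) *: b0 + t *: b.
have Eb' : b' - b0 = t *: (b - b0).
  by rewrite /b' scalerBr scalerBl scale1r; apply/rowP => i; rewrite !mxE; ring.
have Sb' : S b'.
  rewrite /S /= Eb' normrZ ger0_norm; last by case/andP: t01.
  by rewrite /t divfK// gt_eqF.
have := lasso_criterion_convex y b0 b l_ge0 t01; rewrite -/b'.
have := bmin b0; have := cmin _ Sb'.
have : `|b' - b0| <= r by rewrite Sb'.
move/(dP y l b' yd ld); rewrite ler_norml => /andP[].
have : `|b0 - b0| <= r by rewrite subrr normr0 ltW.
move/(dP y l b0 yd ld); rewrite ler_norml => /andP[].
move: t01 => /andP[]; move: eta0; rewrite /eta.
move: (L y l b') (L y0 l0 b') (L y l b) (L y l b0) (L y0 l0 b0) (L y0 l0 c).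
move=> u v w x z s.
move=> *; nra.
Qed.

End lasso.

(** * Lebesgue measure on vectors under affine maps *)

Section lebesgue_affine.
Variable R : realType.
Local Open Scope ereal_scope.
Local Notation leb := (@lebesgue_measure R).

(** Both sides are measures, and they agree on half-open intervals. *)
Lemma lebesgue_measure_affine (c a : R) (c0 : (0 < c)%R) A : measurable A ->
  leb A = c%:E * leb ((fun x : R => (c * (x - a))%R) @^-1` A).
Proof.
move=> mA; pose T := (fun x : R => (c * (x - a))%R) : R -> measurableTypeR R.
have mT : measurable_fun setT T.
  by apply: measurable_funM => //; exact: measurable_funB.
pose mu : {measure set (measurableTypeR R) -> \bar R} :=
  mscale (NngNum (ltW c0))
    (measure_function_pushforward__canonical__measure_function_Measure leb mT).
rewrite (lebesgue_measure_unique (mu := mu))// => _ [[x y] _ <-].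
rewrite /mu /= /mscale /= /pushforward.
rewrite (_ : T @^-1` _ = `](x / c + a)%R, (y / c + a)%R]%classic); last first.
  by apply/seteqP; split=> z /=; rewrite !in_itv/= /T
    -ltrBrDr -lerBlDr ltr_pdivrMr// ler_pdivlMr// [(c * _)%R]mulrC.
rewrite !lebesgue_measure_itv/= !lte_fin ltrD2r ltr_pM2r ?invr_gt0//.
case: ifPn => xy; last by rewrite mule0.
by rewrite -!EFinB -EFinM; congr _%:E; field; rewrite gt_eqF.
Qed.

Lemma ge0_integral_lebesgue_affine (c a : R) (c0 : (0 < c)%R) (F : R -> \bar R) :
  measurable_fun setT F -> (forall x, 0 <= F x) ->
  \int[leb]_x F (c * (x - a))%R = c^-1%:E * \int[leb]_x F x.
Proof.
move=> mF F0; pose T := (fun x : R => (c * (x - a))%R) : R -> measurableTypeR R.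
have mT : measurable_fun setT T.
  by apply: measurable_funM => //; exact: measurable_funB.
pose nu : {measure set (measurableTypeR R) -> \bar R} :=
  (measure_function_pushforward__canonical__measure_function_Measure leb mT).
rewrite [in RHS](eq_measure_integral (mscale (NngNum (ltW c0)) nu)); last first.
  by move=> A mA _; exact: lebesgue_measure_affine.
rewrite ge0_integral_mscale//= muleA -EFinM mulVf ?gt_eqF// mul1e.
by rewrite /nu/= ge0_integral_pushforward.
Qed.

Lemma ge0_integral_lebesgue_rVS p (F : 'rV[R]_p.+1 -> \bar R) :
  measurable_fun setT F -> (forall u, 0 <= F u) ->
  \int[@lebesgue_rV R p.+1]_u F u =
  \int[leb]_x \int[@lebesgue_rV R p]_v F (rV_cons (x, v)).
Proof.
move=> mF F0.
transitivity (\int[leb \x @lebesgue_rV R p]_xv (F \o @rV_cons R p) xv).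
  pose c : measurableTypeR R * 'rV[R]_p -> 'rV[R]_p.+1 := @rV_cons R p.
  have mc : measurable_fun setT c by exact: measurable_rV_cons.
  pose m : {measure set (measurableTypeR R * 'rV[R]_p) -> \bar R} :=
    (leb \x @lebesgue_rV R p).
  exact: (@ge0_integral_pushforward _ _ _ _ R c mc m setT F measurableT mF).
rewrite fubini_tonelli1//=.
by apply: measurableT_comp => //; exact: measurable_rV_cons.
Qed.

Lemma measurable_affine_rV p (c : R) (a : 'rV[R]_p) :
  measurable_fun setT (fun u : 'rV[R]_p => (c *: (u - a))%R).
Proof.
apply/measurable_fun_rVP => i.
rewrite (_ : (fun _ => _) = fun u : 'rV[R]_p => (c * (u 0 i - a 0 i))%R).
  by apply: measurable_funM => //; apply: measurable_funB => //; exact: measurable_coor.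
by apply/funext => u; rewrite !mxE.
Qed.

Lemma measurable_norm2 p : measurable_fun setT (@norm2 R p).
Proof.
apply: (measurableT_comp (f := @Num.sqrt R)).
  exact: (continuous_measurable_fun (@sqrt_continuous R)).
by apply: measurable_sum => i; apply: measurable_funM; exact: measurable_coor.
Qed.

Lemma measurable_norm2B p (a : 'rV[R]_p) :
  measurable_fun setT (fun u : 'rV[R]_p => norm2 (u - a)%R).
Proof.
rewrite (_ : (fun u => _) = (fun u : 'rV[R]_p => norm2 (1 *: (u - a))%R)).
  exact: (measurableT_comp (@measurable_norm2 p) (measurable_affine_rV 1 a)).
by apply/funext => u; rewrite scale1r.
Qed.

(** By induction on the dimension, one coordinate at a time: each coordinate
contributes a factor c^-1 through Tonelli's theorem. *)
Lemma ge0_integral_lebesgue_rV_affine p (c : R) (a : 'rV[R]_p)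
    (c0 : (0 < c)%R) (F : 'rV[R]_p -> \bar R) :
  measurable_fun setT F -> (forall u, 0 <= F u) ->
  \int[@lebesgue_rV R p]_u F (c *: (u - a))%R =
  (c ^- p)%:E * \int[@lebesgue_rV R p]_u F u.
Proof.
elim: p a F => [|p IHp] a F mF F0.
  rewrite expr0 invr1 mul1e; apply: eq_integral => u _; congr F.
  by apply/rowP => -[].
have mFc := measurableT_comp mF (@measurable_rV_cons R p).
rewrite !ge0_integral_lebesgue_rVS//; last first.
  exact: (measurableT_comp mF (measurable_affine_rV c a)).
pose G x := \int[@lebesgue_rV R p]_v F (rV_cons (x, v)).
have G0 x : 0 <= G x by apply: integral_ge0.
have mG : measurable_fun setT G.
  apply: (@measurable_fun_fubini_tonelli_F _ _ (measurableTypeR R) 'rV[R]_p R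
    (@lebesgue_rV R p) (F \o @rV_cons R p)) => //= z; exact: F0.
pose a' : 'rV[R]_p := (\row_j a 0 (lift ord0 j))%R.
transitivity (\int[leb]_x ((c ^- p)%:E * G (c * (x - a 0 ord0))%R)).
  apply: eq_integral => x _; rewrite /G.
  rewrite -(IHp a' (fun v => F (rV_cons ((c * (x - a 0 ord0))%R, v))))//; last first.
    exact: (measurableT_comp mFc (measurable_pair1 _)).
  apply: eq_integral => v _; congr F; apply/rowP => i; rewrite !mxE.
  by case: unliftP => [j|] -> /=; rewrite ?mxE.
have mT : measurable_fun setT (fun x : R => (c * (x - a 0 ord0))%R).
  by apply: measurable_funM => //; exact: measurable_funB.
have mGT := measurableT_comp mG mT.
have cp0 : (0 <= c ^- p)%R by rewrite invr_ge0 exprn_ge0// ltW.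
have -> : \int[leb]_x ((c ^- p)%:E * G (c * (x - a 0 ord0))%R) =
    (c ^- p)%:E * \int[leb]_x G (c * (x - a 0 ord0))%R.
  exact: (ge0_integralZl_EFin leb measurableT (fun x _ => G0 _) mGT cp0).
by rewrite ge0_integral_lebesgue_affine// muleA -EFinM exprSr invfM.
Qed.

End lebesgue_affine.

(** * Densities and rescaled kernels *)

Section density.
Context d (T : measurableType d) (R : realType).
Variables (mu nu : {measure set T -> \bar R}) (f : T -> R).
Hypotheses (mf : measurable_fun setT f) (f0 : forall x, 0 <= f x).
Hypothesis nuE : forall B, measurable B -> nu B = (\int[mu]_(x in B) (f x)%:E)%E.
Local Open Scope ereal_scope.
Import HBNNSimple.

(** The hypothesis is the case of indicator functions; simple functions and
monotone limits give the rest. *)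
Lemma ge0_integral_density (phi : T -> \bar R) :
  measurable_fun setT phi -> (forall x, 0 <= phi x) ->
  \int[nu]_x phi x = \int[mu]_x (phi x * (f x)%:E).
Proof.
move=> mphi phi0; pose s := nnsfun_approx measurableT mphi.
have scvg x : (s ^~ x n)%:E @[n --> \oo] --> phi x.
  exact: (cvg_nnsfun_approx measurableT mphi).
have snd x m n : (m <= n)%N -> (s m x <= s n x)%R.
  by move=> mn; exact/lefP/nd_nnsfun_approx.
have ms n : measurable_fun setT (EFin \o s n) by exact/measurable_EFinP/measurable_funP.
transitivity (limn (fun n => \int[nu]_x (s n x)%:E)).
  rewrite -monotone_convergence//.
  - by apply: eq_integral => x _; apply/esym/cvg_lim.
  - by move=> n x _; rewrite lee_fin.
  - by move=> x _ m n mn; rewrite lee_fin snd.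
transitivity (limn (fun n => \int[mu]_x ((s n x)%:E * (f x)%:E))); last first.
  rewrite -monotone_convergence//.
  - apply: eq_integral => x _; apply/cvg_lim => //.
    by apply: cvgeZr => //; exact: scvg.
  - move=> n; apply: emeasurable_funM; first exact: ms.
    exact/measurable_EFinP.
  - by move=> n x _; rewrite mule_ge0// lee_fin.
  - by move=> x _ m n mn; rewrite lee_pmul// lee_fin// snd.
congr (limn _); apply/funext => n.
under eq_integral do rewrite fimfunE -fsumEFin//.
rewrite ge0_integral_fsum//; last 2 first.
- by move=> y; exact/measurable_EFinP/measurable_funM.
- by move=> y x _; rewrite nnfun_muleindic_ge0.
transitivity (\sum_(r \in range (s n)) \int[mu]_x
    ((r * \1_(s n @^-1` [set r]) x)%:E * (f x)%:E)).
  apply: eq_fsbigr => r _; rewrite integralZl_indic_nnsfun// integral_indic//=.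
  rewrite setIT nuE//.
  have [r0|r0] := leP 0%R r; last first.
    rewrite preimage_nnfun0// integral_set0 mule0 integral0_eq// => x _.
    by rewrite indicE in_set0 mulr0 mul0e.
  rewrite integral_mkcond -ge0_integralZl_EFin//.
  - apply: eq_integral => x _; rewrite EFinM -muleA; congr (_ * _).
    by rewrite patchE indicE; case: ifPn; rewrite ?mul1e ?mul0e.
  - by move=> x _; rewrite patchE; case: ifPn => // _; rewrite lee_fin.
  - apply/(measurable_restrictT _ _).1 => //.
    exact/measurable_EFinP/measurable_funTS.
rewrite -ge0_integral_fsum//.
- apply: eq_integral => x _; rewrite fimfunE -fsumEFin// ge0_mule_fsuml//.
  by move=> r; rewrite nnfun_muleindic_ge0.
- move=> r; apply: emeasurable_funM; last exact/measurable_EFinP.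
  exact/measurable_EFinP/measurable_funM.
- by move=> r x _; rewrite mule_ge0 ?nnfun_muleindic_ge0// lee_fin.
Qed.

(** The integral of a signed function is by definition the difference of the
integrals of its positive and negative parts, and multiplication by f >= 0
commutes with taking these parts. *)
Lemma integral_density (phi : T -> R) : measurable_fun setT phi ->
  \int[nu]_x (phi x)%:E = \int[mu]_x (phi x * f x)%:E.
Proof.
move=> mphi; have me : measurable_fun setT (EFin \o phi) by exact/measurable_EFinP.
rewrite integralE [RHS]integralE !ge0_integral_density//;
  [|exact: measurable_funeneg|exact: measurable_funepos].
congr (_ - _); apply: eq_integral => x _; rewrite !(funeposE, funenegE).
  by rewrite muleC maxe_pMr ?lee_fin// mule0 -EFinM mulrC.
by rewrite muleC maxe_pMr ?lee_fin// mule0 muleN -EFinM mulrC.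
Qed.

End density.

Section parzen.
Variables (R : realType) (p : nat) (K : 'rV[R]_p -> R).
Local Notation leb := (@lebesgue_rV R p).
Hypothesis mK : measurable_fun setT K.
Hypothesis Kabs : (\int[leb]_u `|K u|%:E < +oo)%E.
Hypothesis K1 : (\int[leb]_u (K u)%:E = 1)%E.
Hypothesis Ktail : forall e : R, 0 < e ->
  exists M : R, forall t, M < norm2 t -> `|K t| * norm2 t ^+ p < e.
Variables (h : nat -> R) (z0 : 'rV[R]_p).
Hypotheses (h_gt0 : forall n, 0 < h n) (h_cvg0 : h @ \oo --> (0 : R)).
Local Notation Kh n := (fun u : 'rV[R]_p => scaled_kernel (h n) K (u - z0)).

Let h_lt (c : R) : 0 < c -> \forall n \near \oo, h n < c.
Proof.
move=> c0; have /cvgrPdist_lt/(_ _ c0) := h_cvg0.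
by apply: filterS => n; rewrite sub0r normrN gtr0_norm.
Qed.

Lemma measurable_scaled_kernel (c : R) :
  measurable_fun setT (fun u : 'rV[R]_p => scaled_kernel c K (u - z0)).
Proof.
apply: measurable_funM => //.
exact: (measurableT_comp mK (measurable_affine_rV c^-1 z0)).
Qed.

(** With t = (u - z0) / h one has h^-p = |t|^p / |u - z0|^p, so that the decay of
|K t| |t|^p at infinity controls the rescaled kernel uniformly away from z0. *)
Lemma scaled_kernel_far (e r : R) : 0 < e -> 0 < r ->
  \forall n \near \oo, forall u, r < norm2 (u - z0) -> `|Kh n u| <= e.
Proof.
move=> e0 r0; have [M KM] := Ktail (mulr_gt0 e0 (exprn_gt0 p r0)).
have M1 : 0 < `|M| + 1 by rewrite ltr_wpDl.
have : \forall n \near \oo, h n < r / (`|M| + 1).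
  by apply: h_lt; rewrite divr_gt0.
apply: filterS => n hn u ru; rewrite /scaled_kernel.
have nE : norm2 ((h n)^-1 *: (u - z0)) = norm2 (u - z0) / h n.
  by rewrite norm2Z ger0_norm ?invr_ge0 ?ltW// mulrC.
have /KM : M < norm2 ((h n)^-1 *: (u - z0)).
  rewrite nE ltr_pdivlMr// (le_lt_trans _ ru)//.
  rewrite ltr_pdivlMr// in hn; apply: le_trans (ltW hn).
  by rewrite mulrC ler_wpM2l ?(ltW (h_gt0 _))// (le_trans (ler_norm _))// lerDl.
have hp : 0 <= h n ^- p by rewrite invr_ge0 exprn_ge0// ltW.
rewrite nE exprMn exprVn normrM (ger0_norm hp) => Ke.
have rp : 0 < r ^+ p by rewrite exprn_gt0.
rewrite -(ler_pM2r rp); apply: le_trans (ltW Ke).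
rewrite [leLHS](_ : _ = `|K ((h n)^-1 *: (u - z0))| * (r ^+ p * h n ^- p)); last by ring.
rewrite ler_wpM2l// ler_wpM2r//.
by apply: lerXn2r; rewrite ?nnegrE ?norm2_ge0 ?ltW.
Qed.

(** The factor c^-p in the rescaled kernel is the Jacobian. *)
Lemma ge0_integral_rescale (G : 'rV[R]_p -> \bar R) (c : R) : 0 < c ->
  measurable_fun setT G -> (forall u, 0 <= G u)%E ->
  (\int[leb]_u ((c ^- p)%:E * G (c^-1 *: (u - z0))) = \int[leb]_u G u)%E.
Proof.
move=> c0 mG G0; have cV0 : 0 < c^-1 by rewrite invr_gt0.
rewrite ge0_integralZl_EFin//; last first.
- by rewrite invr_ge0 exprn_ge0// ltW.
- exact: (measurableT_comp mG (measurable_affine_rV _ _)).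
rewrite ge0_integral_lebesgue_rV_affine// muleA -EFinM exprVn invrK mulVf ?mul1e//.
by rewrite expf_neq0// gt_eqF.
Qed.

Lemma integral_abs_scaled_kernel n :
  (\int[leb]_u `|Kh n u|%:E = \int[leb]_u `|K u|%:E)%E.
Proof.
rewrite -[RHS](ge0_integral_rescale (h_gt0 n))//; last first.
  by apply/measurable_EFinP; exact: measurableT_comp.
apply: eq_integral => u _; rewrite -EFinM normrM ger0_norm//.
by rewrite invr_ge0 exprn_ge0// ltW.
Qed.

Lemma integral_scaled_kernel n : (\int[leb]_u (Kh n u)%:E = 1)%E.
Proof.
have mE : measurable_fun setT (EFin \o K) by exact/measurable_EFinP.
rewrite -K1 integralE [RHS]integralE.
rewrite -[in RHS](ge0_integral_rescale (h_gt0 n))//; last exact: measurable_funepos.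
rewrite -[X in _ = (_ - X)%E](ge0_integral_rescale (h_gt0 n))//; last first.
  exact: measurable_funeneg.
have c0 : (0 <= (h n ^- p)%:E)%E by rewrite lee_fin invr_ge0 exprn_ge0// ltW.
congr (_ - _)%E; apply: eq_integral => u _; rewrite !(funeposE, funenegE).
  by rewrite maxe_pMr// mule0 -EFinM.
by rewrite maxe_pMr// mule0 muleN -EFinM.
Qed.

(** After the change of variables the integral runs over |t| > r / h, and the
tails of the integrable function |K| vanish. *)
Lemma integral_far_scaled_kernel (r : R) : 0 < r ->
  (\int[leb]_u (`|Kh n u| * \1_[set v | r < norm2 (v - z0)] u)%:E)%E
    @[n --> \oo] --> 0%E.
Proof.
move=> r0.
pose F n u : \bar R := (`|K u| * \1_[set v | r / h n < norm2 v] u)%:E.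
have mset n : measurable [set v : 'rV[R]_p | r / h n < norm2 v].
  rewrite -[X in measurable X]setTI; apply: measurable_fun_ltr => //.
  exact: measurable_norm2.
have mF n : measurable_fun setT (F n).
  apply/measurable_EFinP; apply: measurable_funM; first exact: measurableT_comp.
  exact: measurable_indic.
have FE n : (\int[leb]_u (`|Kh n u| * \1_[set v | r < norm2 (v - z0)] u)%:E =
    \int[leb]_u F n u)%E.
  rewrite -[RHS](ge0_integral_rescale (h_gt0 n))//; last first.
    by move=> u; rewrite lee_fin mulr_ge0.
  apply: eq_integral => u _; rewrite /F -EFinM /scaled_kernel normrM.
  have hp : 0 <= h n ^- p by rewrite invr_ge0 exprn_ge0// ltW.
  rewrite (ger0_norm hp) -mulrA.
  congr (_ * (_ * _))%:E; rewrite !indicE; congr (_%:R).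
  have hV : 0 <= (h n)^-1 by rewrite invr_ge0 ltW.
  congr nat_of_bool; apply/idP/idP; rewrite !inE/= norm2Z (ger0_norm hV);
    by rewrite [_^-1 * _]mulrC ltr_pM2r// invr_gt0.
under eq_fun do rewrite FE.
have mfar0 : measurable_fun setT (cst (0 : \bar R) : 'rV[R]_p -> \bar R) by [].
have iK : leb.-integrable setT (fun u => `|K u|%:E).
  apply/integrableP; split; first by apply/measurable_EFinP; exact: measurableT_comp.
  by under eq_integral do rewrite /= normr_id.
have [| |_ _] := dominated_convergence measurableT mF mfar0 _ iK _.
- apply: aeW => u _; apply: cvg_near_cst.
  have : \forall n \near \oo, h n < r / (norm2 u + 1).
    by apply: h_lt; rewrite divr_gt0// ltr_wpDl// norm2_ge0.
  apply: filterS => n; rewrite ltr_pdivlMr ?ltr_wpDl ?norm2_ge0// => hn.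
  rewrite /F indicE memNset ?mulr0//= => /ltW; rewrite ler_pdivrMr//.
  move=> rh; have := lt_le_trans hn rh; rewrite mulrC ltr_pM2r//.
  by rewrite ltNge lerDl ler01.
- apply: aeW => u n _; rewrite /F abse_EFin ger0_norm ?mulr_ge0// lee_fin.
  by rewrite ler_piMr// indicE; case: (_ \in _).
by rewrite integral0.
Qed.

End parzen.

(** * Parzen's lemma *)

Section parzen_density.
Variables (R : realType) (p : nat) (K : 'rV[R]_p -> R).
Local Notation leb := (@lebesgue_rV R p).
Hypothesis mK : measurable_fun setT K.
Hypothesis Kabs : (\int[leb]_u `|K u|%:E < +oo)%E.
Hypothesis K1 : (\int[leb]_u (K u)%:E = 1)%E.
Hypothesis Ktail : forall e : R, 0 < e ->
  exists M : R, forall t, M < norm2 t -> `|K t| * norm2 t ^+ p < e.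
Variables (h : nat -> R) (z0 : 'rV[R]_p).
Hypotheses (h_gt0 : forall n, 0 < h n) (h_cvg0 : h @ \oo --> (0 : R)).
Local Notation Kh n := (fun u : 'rV[R]_p => scaled_kernel (h n) K (u - z0)).
Variable f : 'rV[R]_p -> R.
Hypotheses (mf : measurable_fun setT f) (f0 : forall u, 0 <= f u).
Hypotheses (f1 : (\int[leb]_u (f u)%:E = 1)%E) (cf : {for z0, continuous f}).

Let mKh n : measurable_fun setT (Kh n).
Proof. exact: measurable_scaled_kernel. Qed.

Let maKh n : measurable_fun setT (fun u : 'rV[R]_p => `|Kh n u|).
Proof. exact: measurableT_comp (mKh n). Qed.

Let far (r : R) : set 'rV[R]_p := [set v | r < norm2 (v - z0)].

Let mfar r : measurable_fun setT (\1_(far r) : _ -> R).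
Proof.
apply: measurable_indic; rewrite -[X in measurable X]setTI.
by apply: measurable_fun_ltr => //; exact: measurable_norm2B.
Qed.

Let J := fine (\int[leb]_u `|K u|%:E).
Let J0 : 0 <= J. Proof. by rewrite fine_ge0// integral_ge0. Qed.
Let JE : (\int[leb]_u `|K u|%:E)%E = J%:E.
Proof. by rewrite fineK// ge0_fin_numE// integral_ge0. Qed.

Let near_f (e : R) : 0 < e -> exists2 r, 0 < r &
  forall u, norm2 (u - z0) <= r -> `|f u - f z0| <= e.
Proof.
move=> e0; have /cvgrPdist_le/(_ _ e0) := cf.
move=> /nbhs_ballP[r /= r0 rP]; exists (r / 2); first by rewrite divr_gt0.
move=> u ur; rewrite distrC; apply/rP/norm2_ball/(le_lt_trans ur).
by rewrite ltr_pdivrMr// ltr_pMr// ltr1n.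
Qed.

(** Near z0 the density is within a small distance of f z0 and the kernel has a
fixed L1 norm. Away from z0, |f u - f z0| <= f u + f z0: the kernel is uniformly
small against the first term, which integrates to 1, and its integral vanishes
against the second, which is constant. *)
Lemma parzen_L1 (e : R) : 0 < e -> \forall n \near \oo,
  (\int[leb]_u (`|Kh n u| * `|f u - f z0|)%:E <= e%:E)%E.
Proof.
move=> e0; have e3 : 0 < e / 3 by rewrite divr_gt0.
(* Three contributions of at most e / 3 each: the neighbourhood of z0, the far
   kernel against f, and the far kernel against f z0. *)
have eta0 : 0 < e / 3 / (J + 1) by rewrite divr_gt0// ltr_wpDl.
have [r r0 rf] := near_f eta0.
have kfar := scaled_kernel_far Ktail z0 h_gt0 h_cvg0 e3 r0.
have c0 : 0 < e / 3 / (f z0 + 1) by rewrite divr_gt0// ltr_wpDl.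
have tail : \forall n \near \oo, (\int[leb]_u
    (`|Kh n u| * \1_(far r) u)%:E <= (e / 3 / (f z0 + 1))%:E)%E.
  have /fine_cvgP[+ /cvgrPdist_le/(_ _ c0)] :=
    integral_far_scaled_kernel mK Kabs z0 h_gt0 h_cvg0 r0.
  apply: filterS2 => n fn /=; rewrite sub0r normrN => cn.
  by rewrite -(fineK fn) lee_fin (le_trans (ler_norm _)).
move: kfar tail; apply: filterS2 => n Kfar t.
pose I1 u : \bar R := ((e / 3 / (J + 1))%:E * `|Kh n u|%:E)%E.
pose I2 u : \bar R := ((e / 3)%:E * (f u)%:E)%E.
pose I3 u : \bar R := ((f z0)%:E * (`|Kh n u| * \1_(far r) u)%:E)%E.
have mI1 : measurable_fun setT I1.
  by apply/measurable_EFinP; exact: measurable_funM.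
have mI2 : measurable_fun setT I2.
  by apply/measurable_EFinP; exact: measurable_funM.
have mG : measurable_fun setT (fun u : 'rV[R]_p => `|Kh n u| * \1_(far r) u).
  by apply: measurable_funM => //; exact: mfar.
have mI3 : measurable_fun setT I3.
  by apply/measurable_EFinP; exact: measurable_funM.
have I10 u : (0 <= I1 u)%E by rewrite lee_fin mulr_ge0// ltW.
have I20 u : (0 <= I2 u)%E by rewrite lee_fin mulr_ge0// ltW.
have I30 u : (0 <= I3 u)%E by rewrite lee_fin mulr_ge0// mulr_ge0.
apply: (@le_trans _ _ (\int[leb]_u (I1 u + I2 u + I3 u))%E).
  apply: ge0_le_integral => //.
  - apply/measurable_EFinP/measurable_funM => //.
    by apply: measurableT_comp => //; exact: measurable_funB.
  - by apply: emeasurable_funD => //; exact: emeasurable_funD.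
  - move=> u _; rewrite /I1 /I2 /I3 -!EFinM -!EFinD lee_fin indicE.
    have [ru|ru] := ltP r (norm2 (u - z0)).
      rewrite mem_set// mulr1.
      have fu : `|f u - f z0| <= f u + f z0.
        by rewrite (le_trans (ler_normB _ _))// !ger0_norm.
      rewrite -addrA ler_wpDl//; first by rewrite mulr_ge0// ltW.
      apply: (@le_trans _ _ (`|Kh n u| * (f u + f z0))); first by rewrite ler_wpM2l.
      rewrite mulrDr lerD//; last by rewrite mulrC.
      by rewrite ler_wpM2r// Kfar.
    rewrite memNset; last by rewrite /far /= ltNge ru.
    rewrite mulr0 mulr0 addr0 ler_wpDr//; first by rewrite mulr_ge0// ltW.
    by rewrite mulrC ler_wpM2r// rf.
rewrite ge0_integralD//; last 2 first.
- by move=> u _; exact: adde_ge0.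
- exact: emeasurable_funD.
rewrite ge0_integralD//.
rewrite /I1 /I2 /I3 !ge0_integralZl_EFin ?(ltW eta0) ?(ltW e3)//; last first.
- exact/measurable_EFinP.
- exact/measurable_EFinP.
- by move=> u _; rewrite lee_fin.
- exact/measurable_EFinP.
rewrite f1 mule1 integral_abs_scaled_kernel// JE.
apply: le_trans (leeD (le_refl _) (lee_wpmul2l _ t)) _; first by rewrite lee_fin.
rewrite -!EFinM -!EFinD lee_fin.
have aux (y : R) : 0 <= y -> e / 3 / (y + 1) * y <= e / 3.
  by move=> y0; rewrite mulrAC ler_pdivrMr ?ltr_wpDl// ler_wpM2l ?(ltW e3)// lerDl.
have := aux _ J0; have := aux _ (f0 z0); rewrite [f z0 * _]mulrC; lra.
Qed.

Lemma parzen_abs_bounded : \forall n \near \oo,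
  (\int[leb]_u (`|Kh n u| * f u)%:E <= (1 + f z0 * J)%:E)%E.
Proof.
have := parzen_L1 (@ltr01 R); apply: filterS => n L1.
have mB : measurable_fun setT (fun u : 'rV[R]_p => `|Kh n u| * `|f u - f z0|).
  apply: measurable_funM => //.
  by apply: measurableT_comp => //; exact: measurable_funB.
apply: (@le_trans _ _ (\int[leb]_u ((`|Kh n u| * `|f u - f z0|)%:E +
    (f z0)%:E * `|Kh n u|%:E))%E).
  apply: ge0_le_integral => //.
  - by move=> u _; rewrite lee_fin mulr_ge0.
  - by apply/measurable_EFinP/measurable_funM.
  - by apply/measurable_EFinP; apply: measurable_funD => //; exact: measurable_funM.
  - move=> u _; rewrite -EFinM -EFinD lee_fin [f z0 * _]mulrC -mulrDr ler_wpM2l//.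
    by have := ler_norm (f u - f z0); lra.
rewrite ge0_integralD//.
- rewrite ge0_integralZl_EFin//; last exact/measurable_EFinP.
  by rewrite integral_abs_scaled_kernel// JE -EFinM EFinD leeD2r.
- exact/measurable_EFinP.
- by move=> u _; rewrite lee_fin mulr_ge0.
- by apply/measurable_EFinP; exact: measurable_funM.
Qed.

(** Parzen's lemma: a rescaled kernel is an approximate identity. *)
Lemma parzen_cvg : (\int[leb]_u (Kh n u * f u)) @[n --> \oo] --> f z0.
Proof.
apply/cvgrPdist_le => e e0; have := parzen_abs_bounded.
have := parzen_L1 e0; apply: filterS2 => n L1 bd.
have iK1 : leb.-integrable setT (EFin \o Kh n).
  apply/integrableP; split; first exact/measurable_EFinP.
  have := integral_abs_scaled_kernel mK z0 h_gt0 n; rewrite /= => ->.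
  by rewrite JE ltry.
have iKf : leb.-integrable setT (EFin \o (fun u : 'rV[R]_p => Kh n u * f u)).
  apply/integrableP; split; first by apply/measurable_EFinP/measurable_funM.
  apply: le_lt_trans (ltry (1 + f z0 * J)); apply: le_trans bd.
  rewrite le_eqVlt; apply/orP; left; apply/eqP; apply: eq_integral => u _ /=.
  by rewrite normrM (ger0_norm (f0 u)).
have iK : leb.-integrable setT (EFin \o (fun u : 'rV[R]_p => Kh n u * f z0)).
  rewrite (_ : _ \o _ = (fun u => (f z0)%:E * (Kh n u)%:E)%E); last first.
    by apply/funext => u; rewrite /= mulrC.
  exact: integrableZl.
have E1 : f z0 = \int[leb]_u (Kh n u * f z0).
  by rewrite RintegralZr// /Rintegral integral_scaled_kernel// mul1r.
rewrite {1}E1 distrC -RintegralB//.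
rewrite (le_trans (le_normr_Rintegral _ _))//; first exact: (integrableB _ iKf iK).
rewrite /Rintegral -lee_fin; under eq_integral do rewrite -mulrBr normrM.
rewrite fineK// ge0_fin_numE; first exact: le_lt_trans L1 (ltry _).
by apply: integral_ge0 => u _; rewrite lee_fin mulr_ge0.
Qed.

Lemma parzen_far (r : R) : 0 < r ->
  (\int[leb]_u (`|Kh n u| * \1_(far r) u * f u)) @[n --> \oo] --> (0 : R).
Proof.
move=> r0; apply/cvgrPdist_le => e e0.
have := scaled_kernel_far Ktail z0 h_gt0 h_cvg0 e0 r0.
apply: filterS => n Kfar; rewrite sub0r normrN.
have le : (\int[leb]_u (`|Kh n u| * \1_(far r) u * f u)%:E <= e%:E)%E.
  apply: (@le_trans _ _ (\int[leb]_u (e%:E * (f u)%:E))%E).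
    apply: ge0_le_integral => //.
    - by move=> u _; rewrite lee_fin !mulr_ge0.
    - apply/measurable_EFinP; apply: measurable_funM => //.
      by apply: measurable_funM => //; exact: mfar.
    - by apply/measurable_EFinP; exact: measurable_funM.
    - move=> u _; rewrite -EFinM lee_fin ler_wpM2r// indicE.
      have [ru|ru] := ltP r (norm2 (u - z0)).
        by rewrite mem_set// mulr1 Kfar.
      by rewrite memNset ?mulr0 ?ltW// /far /= ltNge ru.
  rewrite ge0_integralZl_EFin ?(ltW e0)//; first by rewrite f1 mule1.
  - by move=> u _; rewrite lee_fin.
  - exact/measurable_EFinP.
rewrite ger0_norm.
  rewrite /Rintegral -lee_fin fineK// ge0_fin_numE; first exact: le_lt_trans le (ltry _).
  by apply: integral_ge0 => u _; rewrite lee_fin !mulr_ge0.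
by apply: Rintegral_ge0 => u _; rewrite !mulr_ge0.
Qed.

End parzen_density.

(** * Independence *)

Section rectangles.
Context d1 d2 (T1 : measurableType d1) (T2 : measurableType d2) (R : realType).
Local Open Scope ereal_scope.

(** Rectangles are stable under intersection and generate the product
sigma-algebra. *)
Lemma eq_measure_rectangles (m1 m2 : {measure set (T1 * T2) -> \bar R}) :
  m1 setT < +oo ->
  (forall A B, measurable A -> measurable B -> m1 (A `*` B) = m2 (A `*` B)) ->
  forall C, measurable C -> m1 C = m2 C.
Proof.
move=> m1oo m12 C mC.
pose G : set (set (T1 * T2)) :=
  [set D | exists A, measurable A /\ exists B, measurable B /\ D = A `*` B].
apply: (measure_unique G (fun=> setT)) => //.
- rewrite measurable_prod_measurableType //; congr (<<s _ >>).
  rewrite predeqE; split => [[A mA [B mB <-]]|[A [mA [B [mB ->]]]]].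
    by exists A; split => //; exists B.
  by exists A => //; exists B.
- move=> _ _ [A [mA [B [mB ->]]]] [A' [mA' [B' [mB' ->]]]].
  rewrite -setXI; exists (A `&` A'); split; first exact: measurableI.
  by exists (B `&` B'); split => //; exact: measurableI.
- by move=> _; exists setT; split => //; exists setT; rewrite setXTT.
- by rewrite bigcup_const//; exists 0%N.
- by move=> _ [A [mA [B [mB ->]]]]; exact: m12.
Qed.

End rectangles.

Lemma bounded_integrable d (T : measurableType d) (R : realType)
    (m : probability T R) (f : T -> R) (a : R) :
  measurable_fun setT f -> (forall x, `|f x| <= a) ->
  m.-integrable setT (EFin \o f).
Proof.
move=> mf fa; apply: measurable_bounded_integrable => //.
  exact: le_lt_trans (probability_le1 m measurableT) (ltry _).
exists a; split; first exact: num_real.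
by move=> M aM x _ /=; rewrite (le_trans (fa x))// ltW.
Qed.

Section independence.
Context d (Omega : measurableType d) (R : realType) (P : probability Omega R).
Local Open Scope ereal_scope.

Lemma measurable_preimage d1 (T1 : measurableType d1) (U : Omega -> T1) A :
  measurable_fun setT U -> measurable A -> measurable (U @^-1` A).
Proof. by move=> mU mA; rewrite -[X in measurable X]setTI; exact: mU. Qed.

(** Passes from rectangles to arbitrary sets of pairs while the event E is kept
fixed: both sides are finite measures in C. *)
Lemma event_indep_pair d1 d2 (T1 : measurableType d1) (T2 : measurableType d2)
    (E : set Omega) (U : Omega -> T1) (V : Omega -> T2) :
  measurable E -> measurable_fun setT U -> measurable_fun setT V ->
  (forall A B, measurable A -> measurable B ->
     P (E `&` (U @^-1` A `&` V @^-1` B)) = P E * P (U @^-1` A `&` V @^-1` B)) ->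
  forall C, measurable C ->
    P (E `&` (fun w => (U w, V w)) @^-1` C) =
    P E * P ((fun w => (U w, V w)) @^-1` C).
Proof.
move=> mE mU mV EUV C mC; pose UV w := (U w, V w).
have mUV : measurable_fun setT UV by exact: measurable_fun_pair.
pose m1 : {measure set (T1 * T2) -> \bar R} :=
  measure_function_pushforward__canonical__measure_function_Measure
    (measure_function_mrestr__canonical__measure_function_Measure P mE) mUV.
have PE0 : (0 <= fine (P E))%R by rewrite fine_ge0.
pose m2 : {measure set (T1 * T2) -> \bar R} :=
  mscale (NngNum PE0)
   (measure_function_pushforward__canonical__measure_function_Measure P mUV).
have PE : (fine (P E))%:E = P E by rewrite fineK// fin_num_measure.
have H : m1 C = m2 C.
  apply: eq_measure_rectangles => //.
    rewrite /m1 /= /pushforward /mrestr preimage_setT setTI.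
    exact: le_lt_trans (probability_le1 _ _) (ltry _).
  move=> A B mA mB; rewrite /m1 /m2 /= /mscale /pushforward /mrestr /= PE.
  by rewrite setIC; exact: EUV.
by move: H; rewrite /m1 /m2 /= /mscale /pushforward /mrestr /= PE setIC.
Qed.

(** The joint law is the product of the marginal laws, so this is Fubini's
theorem for a product of functions of one variable each. *)
Lemma expectationM_indep d1 d2 (T1 : measurableType d1) (T2 : measurableType d2)
    (U : Omega -> T1) (V : Omega -> T2) (f : T1 -> R) (g : T2 -> R) (a b : R) :
  measurable_fun setT U -> measurable_fun setT V ->
  (forall A B, measurable A -> measurable B ->
     P (U @^-1` A `&` V @^-1` B) = P (U @^-1` A) * P (V @^-1` B)) ->
  measurable_fun setT f -> measurable_fun setT g ->
  (forall x, `|f x| <= a)%R -> (forall y, `|g y| <= b)%R ->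
  (\int[P]_w (f (U w) * g (V w)) = \int[P]_w f (U w) * \int[P]_w g (V w))%R.
Proof.
move=> mU mV UV mf mg fa gb; pose W w := (U w, V w).
have mW : measurable_fun setT W by exact: measurable_fun_pair.
pose PU := distribution P (mfun_Sub (mem_set mU)).
pose PV := distribution P (mfun_Sub (mem_set mV)).
pose PW := distribution P (mfun_Sub (mem_set mW)).
pose F (z : T1 * T2) := (f z.1 * g z.2)%R.
have mF : measurable_fun setT F.
  apply: measurable_funM; first exact: measurableT_comp mf measurable_fst.
  exact: measurableT_comp mg measurable_snd.
have mgV : measurable_fun setT (g \o V) by exact: measurableT_comp.
have mfU : measurable_fun setT (f \o U) by exact: measurableT_comp.
have mFW : measurable_fun setT (F \o W) by exact: measurableT_comp.
have igV : P.-integrable setT (EFin \o (g \o V)).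
  exact: (bounded_integrable P mgV (fun w => gb (V w))).
have iU : P.-integrable setT (EFin \o (f \o U)).
  exact: (bounded_integrable P mfU (fun w => fa (U w))).
have a0 : (0 <= a)%R by rewrite (le_trans _ (fa (U point))).
have Fab z : (`|F z| <= a * b)%R by rewrite normrM ler_pM.
have iF : PW.-integrable setT (EFin \o F) by exact: bounded_integrable mF Fab.
have PWE D : measurable D -> (PU \x PV)%E D = PW D.
  apply: product_measure_unique => A B mA mB.
  exact: UV.
have EV : \int[PV]_y (g y)%:E = (\int[P]_w g (V w))%R%:E.
  rewrite integral_distribution//; last exact/measurable_EFinP.
  by rewrite /Rintegral fineK//; exact: (integrable_fin_num _ igV).
have EU : \int[PU]_y (f y)%:E = (\int[P]_w f (U w))%R%:E.
  rewrite integral_distribution//; last exact/measurable_EFinP.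
  by rewrite /Rintegral fineK//; exact: (integrable_fin_num _ iU).
have iFW : P.-integrable setT (EFin \o (F \o W)).
  exact: (bounded_integrable P mFW (fun w => Fab (W w))).
have E2 : \int[PW]_z (F z)%:E = (\int[P]_w (f (U w) * g (V w)))%R%:E.
  rewrite integral_distribution//; last exact/measurable_EFinP.
  by rewrite /Rintegral fineK//; exact: (integrable_fin_num _ iFW).
apply: EFin_inj; rewrite EFinM -E2 -EU -EV.
have iFP : (PU \x PV).-integrable setT (EFin \o F).
  move/integrableP : iF => [mEF iF]; apply/integrableP; split => //.
  by rewrite (eq_measure_integral PW)// => A mA _; exact: PWE.
rewrite (eq_measure_integral (PU \x PV)); last first.
  by move=> A mA _; rewrite [RHS]PWE.
rewrite -[LHS](integral12_prod_meas1 iFP).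
rewrite EV -integralZr//; last exact: bounded_integrable mf fa.
apply: eq_integral => x _ /=; rewrite -EV -integralZl//.
exact: bounded_integrable mg gb.
Qed.

End independence.

Section iid.
Context d (Omega : measurableType d) (R : realType) (P : probability Omega R).
Context d' (S : measurableType d') (W : nat -> Omega -> S).
Hypothesis mW : forall i, measurable_fun setT (W i).
Hypothesis W_indep : forall (J : {fset nat}) (A : nat -> set S),
  (forall i, measurable (A i)) ->
  P (\bigcap_(i in [set` J]) [set w | A i (W i w)]) =
  (\prod_(i <- J) P [set w | A i (W i w)])%E.
Implicit Types i j k l : nat.

Let WW i j w := (W i w, W j w).
Let mWW i j : measurable_fun setT (WW i j).
Proof. exact: measurable_fun_pair. Qed.

(** The indices i and j may coincide, and so may k and l. The family F asks at
each index t for all the conditions that concern t, and the set of indices is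
then split into those that are i or j and the others. *)
Let indep_rect i j k l (A B C D : set S) :
  i != k -> i != l -> j != k -> j != l ->
  measurable A -> measurable B -> measurable C -> measurable D ->
  P ((W i @^-1` A `&` W j @^-1` B) `&` (W k @^-1` C `&` W l @^-1` D)) =
  (P (W i @^-1` A `&` W j @^-1` B) * P (W k @^-1` C `&` W l @^-1` D))%E.
Proof.
move=> ik il jk jl mA mB mC mD.
pose sel (t u : nat) (X : set S) := if t == u then X else setT.
pose F t := sel t i A `&` sel t j B `&` (sel t k C `&` sel t l D).
have msel t u X : measurable X -> measurable (sel t u X).
  by move=> mX; rewrite /sel; case: ifP.
have mF t : measurable (F t).
  by apply: measurableI; apply: measurableI; exact: msel.
pose J : {fset nat} := [fset i; j; k; l]%fset.
pose b t := (t == i) || (t == j).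
have := W_indep J mF.
rewrite (big_fsetID _ b) /= -!W_indep//.
have in1 w t X u : sel t u X (W t w) <-> (t == u -> X (W t w)).
  by rewrite /sel; case: eqP => // _; split=> // /(_ isT).
have -> : \bigcap_(t in [set` J]) [set w | F t (W t w)] =
    (W i @^-1` A `&` W j @^-1` B) `&` (W k @^-1` C `&` W l @^-1` D).
  apply/seteqP; split=> [w JF|w [[wA wB] [wC wD]] t _ /=].
    have h (u : nat) : u \in J -> F u (W u w) by move=> uJ; exact: (JF u uJ).
    have [[/in1 hA _] _] := h i ltac:(by rewrite !inE eqxx).
    have [[_ /in1 hB] _] := h j ltac:(by rewrite !inE eqxx ?orbT).
    have [_ [/in1 hC _]] := h k ltac:(by rewrite !inE eqxx ?orbT).
    have [_ [_ /in1 hD]] := h l ltac:(by rewrite !inE eqxx ?orbT).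
    by split; split; [exact: hA|exact: hB|exact: hC|exact: hD].
  by split; split; apply/in1 => /eqP ->.
have -> : \bigcap_(t in [set` [fset x | x in J & b x]%fset]) [set w | F t (W t w)] =
    (W i @^-1` A `&` W j @^-1` B).
  apply/seteqP; split=> [w JF|w [wA wB] t /=].
    have h (u : nat) : u \in J -> b u -> F u (W u w).
      by move=> uJ bu; apply: (JF u); move: uJ; rewrite /= !inE bu andbT.
    have [[/in1 hA _] _] := h i ltac:(by rewrite !inE eqxx) ltac:(by rewrite /b eqxx).
    have [[_ /in1 hB] _] := h j ltac:(by rewrite !inE eqxx ?orbT)
      ltac:(by rewrite /b eqxx orbT).
    by split; [exact: hA|exact: hB].
  rewrite !inE => /andP[_ bt]; split; split; apply/in1 => /eqP E //; subst t => //.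
  - by move: bt; rewrite /b (eq_sym k) (negbTE ik) (eq_sym k) (negbTE jk).
  - by move: bt; rewrite /b (eq_sym l) (negbTE il) (eq_sym l) (negbTE jl).
have -> : \bigcap_(t in [set` [fset x | x in J & ~~ b x]%fset]) [set w | F t (W t w)] =
    (W k @^-1` C `&` W l @^-1` D).
  apply/seteqP; split=> [w JF|w [wC wD] t /=].
    have h (u : nat) : u \in J -> ~~ b u -> F u (W u w).
      by move=> uJ bu; apply: (JF u); move: uJ; rewrite /= !inE bu andbT.
    have [_ [/in1 hC _]] := h k ltac:(by rewrite !inE eqxx ?orbT)
      ltac:(by rewrite /b negb_or !(eq_sym k) ik jk).
    have [_ [_ /in1 hD]] := h l ltac:(by rewrite !inE eqxx ?orbT)
      ltac:(by rewrite /b negb_or !(eq_sym l) il jl).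
    by split; [exact: hC|exact: hD].
  rewrite !inE negb_or => /andP[_ /andP[ti tj]].
  by split; split; apply/in1 => /eqP E; subst t => //; rewrite eqxx in ti tj.
by [].
Qed.

(** Rectangles are replaced by arbitrary sets in one pair after the other. *)
Lemma iid_pairs_indep i j k l (C D : set (S * S)) :
  i != k -> i != l -> j != k -> j != l -> measurable C -> measurable D ->
  P (WW i j @^-1` C `&` WW k l @^-1` D) =
  (P (WW i j @^-1` C) * P (WW k l @^-1` D))%E.
Proof.
move=> ik il jk jl mC mD.
rewrite setIC muleC; apply: event_indep_pair => //.
  exact: measurable_preimage.
move=> A B mA mB; rewrite setIC muleC.
apply: event_indep_pair => //.
  by apply: measurableI; exact: measurable_preimage.
by move=> A' B' mA' mB'; exact: indep_rect.
Qed.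

Lemma expectationM_pairs i j k l (f g : S * S -> R) (a b : R) :
  i != k -> i != l -> j != k -> j != l ->
  measurable_fun setT f -> measurable_fun setT g ->
  (forall x, `|f x| <= a) -> (forall y, `|g y| <= b) ->
  \int[P]_w (f (W i w, W j w) * g (W k w, W l w)) =
  \int[P]_w f (W i w, W j w) * \int[P]_w g (W k w, W l w).
Proof.
move=> ik il jk jl mf mg fa gb.
apply: (expectationM_indep (mWW i j) (mWW k l) _ mf mg fa gb) => A B mA mB.
exact: iid_pairs_indep.
Qed.

End iid.

(** * Bounded random variables and second moments *)

Section bounded_mfun.
Context d (T : measurableType d) (R : realType).
Implicit Types f g : T -> R.

(** For a given sample size every random variable that occurs is bounded, since
the kernel is; this class is stable under all the operations used and makes
expectations linear without integrability conditions. *)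
Definition bounded_mfun f :=
  measurable_fun setT f /\ exists a, forall x, `|f x| <= a.

Lemma bounded_mfun_cst c : bounded_mfun (fun=> c).
Proof. by split => //; exists `|c|. Qed.

Lemma bounded_mfunD f g : bounded_mfun f -> bounded_mfun g ->
  bounded_mfun (fun x => f x + g x).
Proof.
move=> [mf [a fa]] [mg [b gb]]; split; first exact: measurable_funD.
by exists (a + b) => x; rewrite (le_trans (ler_normD _ _))// lerD.
Qed.

Lemma bounded_mfunM f g : bounded_mfun f -> bounded_mfun g ->
  bounded_mfun (fun x => f x * g x).
Proof.
move=> [mf [a fa]] [mg [b gb]]; split; first exact: measurable_funM.
by exists (a * b) => x; rewrite normrM ler_pM.
Qed.

Lemma bounded_mfunZ c f : bounded_mfun f -> bounded_mfun (fun x => c * f x).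
Proof. exact/bounded_mfunM/bounded_mfun_cst. Qed.

Lemma bounded_mfunB f g : bounded_mfun f -> bounded_mfun g ->
  bounded_mfun (fun x => f x - g x).
Proof.
move=> bf /(bounded_mfunZ (-1)) bg.
under eq_fun do rewrite -mulN1r.
exact: bounded_mfunD.
Qed.

Lemma bounded_mfun_norm f : bounded_mfun f -> bounded_mfun (fun x => `|f x|).
Proof.
move=> [mf [a fa]]; split; first exact: measurableT_comp.
by exists a => x; rewrite normr_id.
Qed.

Lemma bounded_mfunX f n : bounded_mfun f -> bounded_mfun (fun x => f x ^+ n).
Proof.
move=> bf; elim: n => [|n IHn]; first exact: bounded_mfun_cst.
by under eq_fun do rewrite exprS; exact: bounded_mfunM.
Qed.

Lemma bounded_mfun_sum I (s : seq I) (f : I -> T -> R) :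
  (forall i, bounded_mfun (f i)) -> bounded_mfun (fun x => \sum_(i <- s) f i x).
Proof.
move=> bf; elim: s => [|i s IHs].
  by under eq_fun do rewrite big_nil; exact: bounded_mfun_cst.
by under eq_fun do rewrite big_cons; exact: bounded_mfunD.
Qed.

Variable P : probability T R.

Lemma bounded_mfun_integrable f : bounded_mfun f ->
  P.-integrable setT (EFin \o f).
Proof. by move=> [mf [a fa]]; exact: bounded_integrable mf fa. Qed.

Lemma expectD f g : bounded_mfun f -> bounded_mfun g ->
  \int[P]_x (f x + g x) = \int[P]_x f x + \int[P]_x g x.
Proof. by move=> bf bg; rewrite RintegralD//; exact: bounded_mfun_integrable. Qed.

Lemma expectB f g : bounded_mfun f -> bounded_mfun g ->
  \int[P]_x (f x - g x) = \int[P]_x f x - \int[P]_x g x.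
Proof. by move=> bf bg; rewrite RintegralB//; exact: bounded_mfun_integrable. Qed.

Lemma expectZ c f : bounded_mfun f -> \int[P]_x (c * f x) = c * \int[P]_x f x.
Proof. by move=> bf; rewrite RintegralZl//; exact: bounded_mfun_integrable. Qed.

Lemma expect_cst c : \int[P]_x c = c :> R.
Proof.
rewrite Rintegral_cst// (_ : fine _ = 1) ?mulr1//.
by have /(congr1 fine) := @probability_setT _ _ _ P.
Qed.

Lemma expect_sum I (s : seq I) (f : I -> T -> R) :
  (forall i, bounded_mfun (f i)) ->
  \int[P]_x (\sum_(i <- s) f i x) = \sum_(i <- s) \int[P]_x f i x.
Proof.
move=> bf; elim: s => [|i s IHs].
  by under eq_Rintegral do rewrite big_nil; rewrite big_nil expect_cst.
under eq_Rintegral do rewrite big_cons.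
by rewrite expectD// ?IHs ?big_cons//; exact: bounded_mfun_sum.
Qed.

Lemma expect_le f g : bounded_mfun f -> bounded_mfun g ->
  (forall x, f x <= g x) -> \int[P]_x f x <= \int[P]_x g x.
Proof. by move=> bf bg fg; apply: le_Rintegral => //; exact: bounded_mfun_integrable. Qed.

Lemma expect_norm_le f : bounded_mfun f ->
  `|\int[P]_x f x| <= \int[P]_x `|f x|.
Proof. by move=> bf; apply: le_normr_Rintegral => //; exact: bounded_mfun_integrable. Qed.

Lemma markov_bound f (a : R) : bounded_mfun f -> (forall x, 0 <= f x) -> 0 < a ->
  (P [set x | (a < f x)%R] <= (a^-1 * \int[P]_x f x)%:E)%E.
Proof.
move=> bf f0 a0.
have mA : measurable [set x | (a < f x)%R].
  rewrite -[X in measurable X]setTI; apply: measurable_fun_ltr => //.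
  by case: bf.
rewrite -(fineK (fin_num_measure P _ mA)) lee_fin -expectZ//.
have -> : fine (P [set x | (a < f x)%R]) = \int[P]_x \1_[set x | (a < f x)%R] x.
  by rewrite /Rintegral integral_indic// setIT.
have b1 : bounded_mfun (\1_[set x | (a < f x)%R]).
  split; first exact: measurable_indic.
  by exists 1 => x; rewrite indicE; case: (_ \in _); rewrite ?normr1 ?normr0.
apply: expect_le => //; first exact: bounded_mfunZ.
move=> x; rewrite indicE; case: (boolP (x \in _)); last first.
  by rewrite mulr_ge0 ?invr_ge0// ltW.
by rewrite inE/= => /ltW afx; rewrite mulrC ler_pdivlMr// mul1r.
Qed.

End bounded_mfun.

Lemma bounded_mfun_comp d d' (T : measurableType d) (T' : measurableType d')
    (R : realType) (U : T' -> T) (f : T -> R) :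
  measurable_fun setT U -> bounded_mfun f -> bounded_mfun (f \o U).
Proof.
move=> mU [mf [a fa]]; split; first exact: measurableT_comp mf mU.
by exists a => x; exact: fa.
Qed.

Lemma chebyshev_bound d (T : measurableType d) (R : realType)
    (P : probability T R) (f : T -> R) (a : R) : bounded_mfun f -> 0 < a ->
  (P [set x | (a < `|f x|)%R] <= (a ^- 2 * \int[P]_x (f x ^+ 2))%:E)%E.
Proof.
move=> bf a0; have a20 : 0 < a ^+ 2 by rewrite exprn_gt0.
have -> : [set x | a < `|f x|] = [set x | a ^+ 2 < f x ^+ 2].
  apply/seteqP; split=> x /=; rewrite -(real_normK (num_real (f x)));
    by rewrite ltr_sqr ?nnegrE// ltW.
exact: (markov_bound P (bounded_mfunX 2 bf) (fun _ => sqr_ge0 _) a20).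
Qed.

Lemma sum_delta (R : pzRingType) n (i : 'I_n) (F : 'I_n -> R) :
  \sum_(j < n) (i == j)%:R * F j = F i.
Proof.
rewrite (bigD1 i)//= eqxx mul1r big1 ?addr0// => j ji.
by rewrite eq_sym (negbTE ji) mul0r.
Qed.

Section moments.
Context d (Omega : measurableType d) (R : realType) (P : probability Omega R).
Context d' (S : measurableType d') (W : nat -> Omega -> S).
Hypothesis mW : forall i, measurable_fun setT (W i).
Hypothesis W_indep : forall (J : {fset nat}) (A : nat -> set S),
  (forall i, measurable (A i)) ->
  P (\bigcap_(i in [set` J]) [set w | A i (W i w)]) =
  (\prod_(i <- J) P [set w | A i (W i w)])%E.

Let bW (f : S -> R) i : bounded_mfun f -> bounded_mfun (fun w => f (W i w)).
Proof. by move=> bf; exact: (bounded_mfun_comp (mW i) bf). Qed.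

Let bWW (f : S * S -> R) i j : bounded_mfun f ->
  bounded_mfun (fun w => f (W i w, W j w)).
Proof.
move=> bf; apply: (bounded_mfun_comp (U := fun w => (W i w, W j w)) _ bf).
exact: measurable_fun_pair.
Qed.

(** Off-diagonal terms factorize by independence, and the n diagonal terms are
bounded by s. *)
Lemma sum_second_moment (u : S -> R) (e s : R) n : bounded_mfun u -> 0 <= s ->
  (forall i, \int[P]_w u (W i w) = e) ->
  (forall i, \int[P]_w (u (W i w) ^+ 2) <= s) ->
  \int[P]_w ((\sum_(i < n) u (W i w)) ^+ 2) <= n%:R ^+ 2 * e ^+ 2 + n%:R * s.
Proof.
move=> bu s0 ue us.
have b2 i j : bounded_mfun (fun w => u (W i w) * u (W j w)).
  by apply: bounded_mfunM; exact: bW.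
under eq_Rintegral do rewrite expr2 mulr_suml.
rewrite expect_sum; last first.
  by move=> i; under eq_fun do rewrite mulr_sumr; exact: bounded_mfun_sum.
apply: (@le_trans _ _ (\sum_(i < n) \sum_(j < n) (e ^+ 2 + (i == j)%:R * s))).
  apply: ler_sum => i _; under eq_Rintegral do rewrite mulr_sumr.
  rewrite expect_sum//; apply: ler_sum => j _.
  have [->|ij] := eqVneq i j.
    rewrite mul1r; under eq_Rintegral do rewrite -expr2.
    by apply: le_trans (us j) _; rewrite lerDr sqr_ge0.
  have [mu [a ua]] := bu.
  rewrite mul0r addr0 (@expectationM_pairs _ _ _ P _ _ W mW W_indep i i j j
    (u \o fst) (u \o fst) a a)//=.
  - by rewrite !ue expr2.
  - exact: measurableT_comp mu measurable_fst.
  - exact: measurableT_comp mu measurable_fst.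
rewrite le_eqVlt; apply/orP; left; apply/eqP.
under eq_bigr do rewrite big_split /= sumr_const card_ord sum_delta.
by rewrite big_split/= !sumr_const !card_ord; ring.
Qed.

Section pair_sums.
Variables (phi : S -> R) (A b : R) (psi : S * S -> R) (c m : R).
Hypotheses (mphi : measurable_fun setT phi) (mpsi : measurable_fun setT psi).
Hypotheses (phi_ge0 : forall x, 0 <= phi x) (phi_le : forall x, phi x <= b).
Hypothesis phiA : forall i, \int[P]_w phi (W i w) = A.
Hypothesis c0 : 0 <= c.
Hypothesis psi_le : forall x y, `|psi (x, y)| <= c * (phi x * phi y).
Hypothesis psi_m : forall i j, i != j -> `|\int[P]_w psi (W i w, W j w)| <= m.

Let v i w := phi (W i w).
Let a i j w := psi (W i w, W j w).

Let v0 i w : 0 <= v i w. Proof. exact: phi_ge0. Qed.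
Let vb i w : v i w <= b. Proof. exact: phi_le. Qed.
Let b0 : 0 <= b.
Proof. exact: le_trans (v0 0 point) (vb 0 point). Qed.
Let A0 : 0 <= A.
Proof. by rewrite -(phiA 0); apply: Rintegral_ge0. Qed.
Let nphi x : `|phi x| <= b. Proof. by rewrite ger0_norm. Qed.
Let bphi : bounded_mfun phi. Proof. by split => //; exists b. Qed.
Let bv i : bounded_mfun (v i). Proof. exact: bW. Qed.
Let bvv i j : bounded_mfun (fun w => v i w * v j w).
Proof. exact: bounded_mfunM. Qed.
Let npsi xy : `|psi xy| <= c * (b * b).
Proof.
by case: xy => x y; rewrite (le_trans (psi_le _ _))// ler_wpM2l// ler_pM.
Qed.
Let ba i j : bounded_mfun (a i j).
Proof. by apply: bWW; split => //; exists (c * (b * b)). Qed.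
Let baa i j k l : bounded_mfun (fun w => a i j w * a k l w).
Proof. exact: bounded_mfunM. Qed.

Let t i j k := \int[P]_w (v i w * (v j w * v k w)).
Let t0 i j k : 0 <= t i j k.
Proof. by apply: Rintegral_ge0 => w _; rewrite !mulr_ge0. Qed.

Let E2 i j : \int[P]_w (v i w * v j w) <= A ^+ 2 + (i == j)%:R * (b * A).
Proof.
have [<-|ij] := eqVneq i j.
  rewrite mul1r (@le_trans _ _ (b * A)) ?lerDr ?sqr_ge0//.
  have -> : b * A = \int[P]_w (b * v i w).
    by rewrite expectZ; [rewrite phiA|exact: bv].
  apply: expect_le; [exact: bvv|exact: bounded_mfunZ|].
  by move=> w; rewrite ler_wpM2r.
rewrite mul0r addr0 (@expectationM_pairs _ _ _ P _ _ W mW W_indep i i j j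
  (phi \o fst) (phi \o fst) b b)//=.
- by rewrite !phiA expr2.
- exact: measurableT_comp mphi measurable_fst.
- exact: measurableT_comp mphi measurable_fst.
Qed.

Let T2 n : \sum_(i < n) \sum_(j < n) \int[P]_w (v i w * v j w) <=
  n%:R * A * (n%:R * A + b).
Proof.
apply: (@le_trans _ _ (\sum_(i < n) \sum_(j < n) (A ^+ 2 + (i == j)%:R * (b * A)))).
  by apply: ler_sum => i _; apply: ler_sum => j _; exact: E2.
rewrite le_eqVlt; apply/orP; left; apply/eqP.
under eq_bigr do rewrite big_split /= sumr_const card_ord sum_delta.
by rewrite big_split/= !sumr_const !card_ord; ring.
Qed.

(** Unless i meets {j, k}, the factor phi (W i) is independent of the other two;
if it does, it is bounded by b. *)
Let E3 i j k : t i j k <=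
  (A + (i == j)%:R * b + (i == k)%:R * b) * \int[P]_w (v j w * v k w).
Proof.
have E0 : 0 <= \int[P]_w (v j w * v k w).
  by apply: Rintegral_ge0 => w _; rewrite mulr_ge0.
have [/andP[ij ik]|] := boolP ((i != j) && (i != k)).
  rewrite (negbTE ij) (negbTE ik) !mul0r !addr0 /t.
  rewrite (@expectationM_pairs _ _ _ P _ _ W mW W_indep i i j k
    (phi \o fst) (fun z => phi z.1 * phi z.2) b (b * b))//=.
  - by rewrite phiA.
  - exact: measurableT_comp mphi measurable_fst.
  - apply: measurable_funM; first exact: measurableT_comp mphi measurable_fst.
    exact: measurableT_comp mphi measurable_snd.
  - by move=> z; rewrite normrM ler_pM.
rewrite negb_and !negbK => ijk.
apply: (@le_trans _ _ (b * \int[P]_w (v j w * v k w))).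
  rewrite -expectZ//; apply: expect_le.
  - exact: bounded_mfunM.
  - exact: bounded_mfunZ.
  - by move=> w; rewrite ler_wpM2r// mulr_ge0.
rewrite ler_wpM2r//.
have bi (x : bool) : 0 <= x%:R * b by rewrite mulr_ge0.
case/orP: ijk => ->; rewrite mul1r.
  by rewrite -addrA addrCA lerDl addr_ge0.
by rewrite lerDr addr_ge0.
Qed.

Let T3 n := \sum_(i < n) \sum_(j < n) \sum_(k < n) t i j k.

Let T3_le n : T3 n <=
  (n%:R * A + 2 * b) * (n%:R * A * (n%:R * A + b)).
Proof.
apply: (@le_trans _ _ (\sum_(j < n) \sum_(k < n) (n%:R * A + 2 * b) *
    \int[P]_w (v j w * v k w))); last first.
  under eq_bigr do rewrite -mulr_sumr; rewrite -mulr_sumr ler_wpM2l//.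
  by rewrite addr_ge0 ?mulr_ge0.
rewrite /T3 exchange_big ler_sum// => j _; rewrite exchange_big ler_sum// => k _.
apply: (@le_trans _ _ (\sum_(i < n)
    (A + (i == j)%:R * b + (i == k)%:R * b) * \int[P]_w (v j w * v k w))).
  by apply: ler_sum => i _; exact: E3.
rewrite -mulr_suml le_eqVlt; apply/orP; left; apply/eqP; congr (_ * _).
rewrite !big_split/= sumr_const card_ord.
under [X in _ + X + _]eq_bigr do rewrite eq_sym.
under [X in _ + _ + X]eq_bigr do rewrite eq_sym.
by rewrite !sum_delta; ring.
Qed.

(** In each of the six cases one index of a coinciding pair is dropped, at the
price of a factor b. *)
Let E4 i j k l : \int[P]_w (a i j w * a k l w) <=
  m ^+ 2 + c ^+ 2 * b * ((i == j)%:R * t i k l + (k == l)%:R * t i j k +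
    (i == k)%:R * t i j l + (i == l)%:R * t i j k +
    (j == k)%:R * t i j l + (j == l)%:R * t i j k).
Proof.
have le4 x y z (q : Omega -> R) :
    (forall w, v i w * v j w * (v k w * v l w) =
       q w * (v x w * (v y w * v z w))) -> (forall w, 0 <= q w <= b) ->
    \int[P]_w (a i j w * a k l w) <= c ^+ 2 * b * t x y z.
  move=> qE qb; rewrite /t -expectZ; last exact: bounded_mfunM.
  apply: expect_le => //.
    by apply: bounded_mfunZ; exact: bounded_mfunM.
  move=> w; rewrite (le_trans (ler_norm _))// normrM.
  apply: (@le_trans _ _ (c * (v i w * v j w) * (c * (v k w * v l w)))).
    by apply: ler_pM => //; exact: psi_le.
  rewrite mulrACA -expr2 qE -mulrA ler_wpM2l ?sqr_ge0// ler_wpM2r ?mulr_ge0//.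
  by case/andP: (qb w).
have vb' x w : 0 <= v x w <= b by rewrite v0 vb.
have m2 : 0 <= m ^+ 2 by exact: sqr_ge0.
have bt (x : bool) x1 x2 x3 : 0 <= x%:R * t x1 x2 x3 by rewrite mulr_ge0.
have cb : 0 <= c ^+ 2 * b by rewrite mulr_ge0 ?sqr_ge0.
(* Reduces each case to picking the right triple out of the sum. *)
have fin x y z S' : \int[P]_w (a i j w * a k l w) <= c ^+ 2 * b * t x y z ->
    t x y z <= S' -> \int[P]_w (a i j w * a k l w) <= m ^+ 2 + c ^+ 2 * b * S'.
  move=> h1 h2; apply: (le_trans h1); rewrite ler_wpDl// ler_wpM2l//.
have [ij|ij] := eqVneq i j.
  apply: (fin i k l); first by apply: (le4 _ _ _ (v j)) => // w; rewrite ij; ring.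
  by rewrite mul1r -!addrA lerDl !addr_ge0.
have [kl|kl] := eqVneq k l.
  apply: (fin i j k); first by apply: (le4 _ _ _ (v l)) => // w; rewrite kl; ring.
  by rewrite mul1r mul0r add0r -!addrA lerDl !addr_ge0.
have [ik|ik] := eqVneq i k.
  apply: (fin i j l); first by apply: (le4 _ _ _ (v k)) => // w; rewrite ik; ring.
  by rewrite mul1r !mul0r !add0r -!addrA lerDl !addr_ge0.
have [il|il] := eqVneq i l.
  apply: (fin i j k); first by apply: (le4 _ _ _ (v l)) => // w; rewrite il; ring.
  by rewrite mul1r !mul0r !add0r -!addrA lerDl !addr_ge0.
have [jk|jk] := eqVneq j k.
  apply: (fin i j l); first by apply: (le4 _ _ _ (v k)) => // w; rewrite jk; ring.
  by rewrite mul1r !mul0r !add0r lerDl.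
have [jl|jl] := eqVneq j l.
  apply: (fin i j k); first by apply: (le4 _ _ _ (v l)) => // w; rewrite jl; ring.
  by rewrite mul1r !mul0r !add0r.
rewrite !mul0r !addr0 mulr0 addr0.
rewrite (@expectationM_pairs _ _ _ P _ _ W mW W_indep i j k l
  psi psi (c * (b * b)) (c * (b * b)))//.
rewrite (le_trans (ler_norm _))// normrM expr2.
by rewrite ler_pM// psi_m.
Qed.

(** The right-hand side has the following origin. Expand the square into a sum
over quadruples (i, j, k, l). If the pairs (i, j) and (k, l) are off-diagonal and
disjoint, then they are independent and contribute at most m^2. Otherwise one of
six pairs of indices coincides; bounding one of the two equal factors phi by b
leaves a sum of phi phi phi over triples. In the same way a sum over triples is
at most (nA + 2b) times a sum over pairs, and the latter is at most
nA (nA + b). After division by n^4 everything but m^2 is of order b / n. *)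
Lemma pair_sum_second_moment n :
  \int[P]_w ((\sum_(i < n) \sum_(j < n) psi (W i w, W j w)) ^+ 2) <=
  n%:R ^+ 4 * m ^+ 2 +
  6 * c ^+ 2 * b * ((n%:R * A + 2 * b) * (n%:R * A * (n%:R * A + b))).
Proof.
under eq_Rintegral do rewrite expr2 mulr_suml.
have bs (f : 'I_n -> Omega -> R) : (forall i, bounded_mfun (f i)) ->
    bounded_mfun (fun w => \sum_(i < n) f i w).
  by move=> bf; exact: bounded_mfun_sum.
have bS : bounded_mfun (fun w => \sum_(i < n) \sum_(j < n) psi (W i w, W j w)).
  by apply: (bs) => i; apply: (bs) => j; exact: ba.
rewrite expect_sum; last first.
  by move=> i; apply: bounded_mfunM => //; apply: (bs) => j; exact: ba.
apply: (@le_trans _ _ (\sum_(i < n) \sum_(j < n) \sum_(k < n) \sum_(l < n)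
    \int[P]_w (a i j w * a k l w))).
  apply: ler_sum => i _; under eq_Rintegral do rewrite mulr_suml.
  rewrite expect_sum; last by move=> j; apply: bounded_mfunM => //; exact: ba.
  apply: ler_sum => j _; under eq_Rintegral do rewrite mulr_sumr.
  rewrite expect_sum; last first.
    by move=> k; apply: bounded_mfunM; [exact: ba|apply: (bs) => l; exact: ba].
  apply: ler_sum => k _; under eq_Rintegral do rewrite mulr_sumr.
  by rewrite expect_sum => [|l]; [exact: lexx|exact: baa].
pose d4 (G : 'I_n -> 'I_n -> 'I_n -> 'I_n -> R) :=
  \sum_(i < n) \sum_(j < n) \sum_(k < n) \sum_(l < n) G i j k l.
have d4D G H : d4 (fun i j k l => G i j k l + H i j k l) = d4 G + d4 H.
  rewrite /d4 -big_split; apply: eq_bigr => i _; rewrite -big_split.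
  apply: eq_bigr => j _; rewrite -big_split; apply: eq_bigr => k _.
  by rewrite -big_split.
have d4Z x G : d4 (fun i j k l => x * G i j k l) = x * d4 G.
  rewrite /d4 mulr_sumr; apply: eq_bigr => i _; rewrite mulr_sumr.
  apply: eq_bigr => j _; rewrite mulr_sumr; apply: eq_bigr => k _.
  by rewrite mulr_sumr.
apply: (@le_trans _ _ (d4 (fun i j k l => m ^+ 2 + c ^+ 2 * b *
   ((i == j)%:R * t i k l + (k == l)%:R * t i j k +
    (i == k)%:R * t i j l + (i == l)%:R * t i j k +
    (j == k)%:R * t i j l + (j == l)%:R * t i j k)))).
  apply: ler_sum => i _; apply: ler_sum => j _; apply: ler_sum => k _.
  by apply: ler_sum => l _; exact: E4.
rewrite d4D d4Z !d4D.
have -> : d4 (fun _ _ _ _ => m ^+ 2) = n%:R ^+ 4 * m ^+ 2.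
  by rewrite /d4 !sumr_const !card_ord; ring.
have -> : d4 (fun i j k l => (i == j)%:R * t i k l) = T3 n.
  apply: eq_bigr => i _; rewrite -[RHS](sum_delta i (fun j =>
    \sum_(k < n) \sum_(l < n) t i k l)).
  apply: eq_bigr => j _; rewrite mulr_sumr; apply: eq_bigr => k _.
  by rewrite mulr_sumr.
have -> : d4 (fun i j k l => (k == l)%:R * t i j k) = T3 n.
  apply: eq_bigr => i _; apply: eq_bigr => j _; apply: eq_bigr => k _.
  exact: (sum_delta k (fun=> t i j k)).
have -> : d4 (fun i j k l => (i == k)%:R * t i j l) = T3 n.
  apply: eq_bigr => i _; apply: eq_bigr => j _.
  rewrite -[RHS](sum_delta i (fun k => \sum_(l < n) t i j l)).
  by apply: eq_bigr => k _; rewrite mulr_sumr.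
have -> : d4 (fun i j k l => (i == l)%:R * t i j k) = T3 n.
  apply: eq_bigr => i _; apply: eq_bigr => j _; apply: eq_bigr => k _.
  exact: (sum_delta i (fun=> t i j k)).
have -> : d4 (fun i j k l => (j == k)%:R * t i j l) = T3 n.
  apply: eq_bigr => i _; apply: eq_bigr => j _.
  rewrite -[RHS](sum_delta j (fun k => \sum_(l < n) t i j l)).
  by apply: eq_bigr => k _; rewrite mulr_sumr.
have -> : d4 (fun i j k l => (j == l)%:R * t i j k) = T3 n.
  apply: eq_bigr => i _; apply: eq_bigr => j _; apply: eq_bigr => k _.
  exact: (sum_delta j (fun=> t i j k)).
rewrite lerD2l [leLHS](_ : _ = 6 * c ^+ 2 * b * T3 n); last by ring.
by rewrite ler_wpM2l// !mulr_ge0 ?sqr_ge0.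
Qed.

End pair_sums.

End moments.

(** * Conditional law of a pair of observations *)

Section mixture.
Context d1 d2 (T : measurableType d1) (Y : measurableType d2) (R : realType).
Variables (mu : {measure set T -> \bar R}) (k : T -> probability Y R).
Hypothesis mk : forall A, measurable A -> measurable_fun setT (k ^~ A).
Local Open Scope ereal_scope.

Let kmeasure (t : T) : {measure set Y -> \bar R} := k t.

Let kmeasure_measurable A : measurable A -> measurable_fun setT (kmeasure ^~ A).
Proof. exact: mk. Qed.

HB.instance Definition _ :=
  isKernel.Build _ _ _ _ _ kmeasure kmeasure_measurable.

Let kmeasure_setT t : kmeasure t setT = 1.
Proof. exact: probability_setT. Qed.

HB.instance Definition _ :=
  Kernel_isProbability.Build _ _ _ _ _ kmeasure kmeasure_setT.

Lemma measurable_integral_kernel (f : T * Y -> \bar R) :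
  (forall z, 0 <= f z) -> measurable_fun setT f ->
  measurable_fun setT (fun t => \int[k t]_y f (t, y)).
Proof. exact: (measurable_fun_integral_finite_kernel f kmeasure). Qed.

Lemma measurable_kernel_xsection (G : set (T * Y)) : measurable G ->
  measurable_fun setT (fun t => k t (xsection G t)).
Proof.
by move=> mG; apply: (measurable_fun_xsection_finite_kernel kmeasure); rewrite inE.
Qed.

(** The joint law of (t, y) when t has law mu and y has conditional law k t. *)
Definition mixture (G : set (T * Y)) := \int[mu]_t k t (xsection G t).

Let mixture0 : mixture set0 = 0.
Proof. by rewrite /mixture integral0_eq// => t _; rewrite xsection0 measure0. Qed.

Let mixture_ge0 G : 0 <= mixture G.
Proof. exact: integral_ge0. Qed.

Let mixture_sigma_additive : semi_sigma_additive mixture.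
Proof.
move=> G mG tG mUG; rewrite [X in _ --> X](_ : _ =
  \int[mu]_t (\sum_(n <oo) k t (xsection (G n) t))); last first.
  apply: eq_integral => t _; rewrite xsection_bigcup.
  apply/esym/cvg_lim => //; apply: measure_semi_sigma_additive.
  - by move=> n; exact: measurable_xsection.
  - exact: trivIset_xsection.
  - by apply: bigcupT_measurable => n; exact: measurable_xsection.
apply/cvg_closeP; split.
  by apply: is_cvg_nneseries => n _ _; exact: integral_ge0.
rewrite closeE// integral_nneseries// => n.
exact: measurable_kernel_xsection.
Qed.

HB.instance Definition _ := isMeasure.Build _ _ _ mixture
  mixture0 mixture_ge0 mixture_sigma_additive.

Definition mixture_measure : {measure set (T * Y) -> \bar R} := mixture.

Lemma mixtureX (A : set T) (B : set Y) : measurable A -> measurable B ->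
  mixture (A `*` B) = \int[mu]_(t in A) k t B.
Proof.
move=> mA mB; rewrite [RHS]integral_mkcond; apply: eq_integral => t _.
rewrite patchE; case: ifPn => At; first by rewrite in_xsectionX.
by rewrite notin_xsectionX// measure0.
Qed.

End mixture.

Section nested_rectangles.
Context d1 d2 d3 d4 (T1 : measurableType d1) (T2 : measurableType d2)
  (T3 : measurableType d3) (T4 : measurableType d4) (R : realType).
Local Open Scope ereal_scope.

(** Uniqueness on rectangles is used three times: for the second component over
a fixed rectangle, for the first component over a fixed set, and for the pair. *)
Lemma eq_measure_nested_rectangles
    (m1 m2 : {measure set ((T1 * T2) * (T3 * T4)) -> \bar R}) :
  m1 setT < +oo ->
  (forall A B C D, measurable A -> measurable B -> measurable C ->
     measurable D -> m1 ((A `*` B) `*` (C `*` D)) = m2 ((A `*` B) `*` (C `*` D))) ->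
  forall G, measurable G -> m1 G = m2 G.
Proof.
move=> m1oo m12.
have fst_m : measurable_fun setT (@fst (T1 * T2)%type (T3 * T4)%type) by [].
have snd_m : measurable_fun setT (@snd (T1 * T2)%type (T3 * T4)%type) by [].
have fin E : measurable E -> m1 E < +oo.
  move=> mE; apply: le_lt_trans m1oo; apply: le_measure; rewrite ?inE//.
have m12' A B H : measurable A -> measurable B -> measurable H ->
    m1 ((A `*` B) `*` H) = m2 ((A `*` B) `*` H).
  move=> mA mB mH.
  have mE : measurable ((A `*` B) `*` [set: T3 * T4]).
    by apply: measurableX => //; exact: measurableX.
  pose r (m : {measure set ((T1 * T2) * (T3 * T4)) -> \bar R}) :
      {measure set (T3 * T4) -> \bar R} :=
    measure_function_pushforward__canonical__measure_function_Measure
      (measure_function_mrestr__canonical__measure_function_Measure m mE) snd_m.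
  have rE m X : r m X = m ((A `*` B) `*` X).
    rewrite /r /= /pushforward /mrestr; congr (m _).
    by apply/seteqP; split=> [[[a b] [c e]] /= [? [[]]]|[[a b] [c e]] /= [[]]].
  rewrite -!rE; apply: eq_measure_rectangles => //.
    by rewrite rE fin.
  by move=> C D mC mD; rewrite !rE; exact: m12.
apply: eq_measure_rectangles => // H C mH mC.
have mE : measurable ([set: T1 * T2] `*` C) by exact: measurableX.
pose r (m : {measure set ((T1 * T2) * (T3 * T4)) -> \bar R}) :
    {measure set (T1 * T2) -> \bar R} :=
  measure_function_pushforward__canonical__measure_function_Measure
    (measure_function_mrestr__canonical__measure_function_Measure m mE) fst_m.
have rE m X : r m X = m (X `*` C).
  rewrite /r /= /pushforward /mrestr; congr (m _).
  by apply/seteqP; split=> [[[a b] [c e]] /= [? []]|[[a b] [c e]] /= []].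
rewrite -!rE; apply: eq_measure_rectangles => //.
  by rewrite rE fin.
by move=> A B mA mB; rewrite !rE; exact: m12'.
Qed.

End nested_rectangles.

Section pair_kernel.
Context d1 d2 (TX : measurableType d1) (TZ : measurableType d2) (R : realType).
Variable kappa : TZ -> probability TX R.
Hypothesis mkappa : forall A, measurable A -> measurable_fun setT (kappa ^~ A).
Local Open Scope ereal_scope.

(** The product measure of C is the integral of a section of C against the
kernel, hence measurable in both conditioning values by two applications of the
measurability of kernel integrals. *)
Lemma measurable_product_kernel (C : set (TX * TX)) : measurable C ->
  measurable_fun setT (fun zz : TZ * TZ => (kappa zz.1 \x kappa zz.2) C).
Proof.
move=> mC.
pose A : set (((TZ * TZ) * TX) * TX) := [set u | C (u.1.2, u.2)].
have mA : measurable A.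
  rewrite /A -[X in measurable X]setTI.
  have mu : measurable_fun setT (fun u : ((TZ * TZ) * TX) * TX => (u.1.2, u.2)).
    apply: measurable_fun_pair => //.
    exact: (measurableT_comp measurable_snd measurable_fst).
  exact: mu.
pose k2 (t : (TZ * TZ) * TX) := kappa t.1.2.
have mk2 B : measurable B -> measurable_fun setT (k2 ^~ B).
  move=> mB; apply: (measurableT_comp (mkappa mB)).
  exact: (measurableT_comp measurable_snd measurable_fst).
have mf := measurable_kernel_xsection mk2 mA.
pose k0 (zz : TZ * TZ) := kappa zz.1.
have mk0 B : measurable B -> measurable_fun setT (k0 ^~ B).
  by move=> mB; exact: (measurableT_comp (mkappa mB) measurable_fst).
have := measurable_integral_kernel mk0 (fun t => measure_ge0 _ _) mf.
apply: eq_measurable_fun => zz _.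
rewrite /product_measure1; apply: eq_integral => x _ /=.
congr (kappa _ _); apply/funext => y; rewrite /xsection /= /A.
Qed.

End pair_kernel.

Section product_probability.
Context d1 d2 (T1 : measurableType d1) (T2 : measurableType d2) (R : realType).
Variables (m1 : probability T1 R) (m2 : probability T2 R).
Local Open Scope ereal_scope.

Definition product_probability := m1 \x m2.

HB.instance Definition _ := Measure.on product_probability.

Let product_probability_setT : product_probability setT = 1.
Proof.
rewrite /product_probability -setXTT product_measure1E//.
by rewrite [X in X * _]probability_setT [X in _ * X]probability_setT mule1.
Qed.

HB.instance Definition _ := Measure_isProbability.Build _ _ _
  product_probability product_probability_setT.

End product_probability.

Section pair_conditional.
Context d (Omega : measurableType d) (R : realType) (P : probability Omega R).
Context d1 d2 (TX : measurableType d1) (TZ : measurableType d2).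
Variables (nu : probability TZ R) (kappa : TZ -> probability TX R).
Hypothesis mkappa : forall A, measurable A -> measurable_fun setT (kappa ^~ A).
Variables (U V : Omega -> TX) (Z1 Z2 : Omega -> TZ).
Hypotheses (mU : measurable_fun setT U) (mV : measurable_fun setT V).
Hypotheses (mZ1 : measurable_fun setT Z1) (mZ2 : measurable_fun setT Z2).
Local Open Scope ereal_scope.
Hypothesis UVZ : forall A1 A2 B1 B2,
  measurable A1 -> measurable A2 -> measurable B1 -> measurable B2 ->
  P ((U @^-1` A1 `&` Z1 @^-1` B1) `&` (V @^-1` A2 `&` Z2 @^-1` B2)) =
  (\int[nu]_(z in B1) kappa z A1) * (\int[nu]_(z in B2) kappa z A2).

Let UV w := (U w, V w).
Let ZZ w := (Z1 w, Z2 w).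
Let mUV : measurable_fun setT UV. Proof. exact: measurable_fun_pair. Qed.
Let mZZ : measurable_fun setT ZZ. Proof. exact: measurable_fun_pair. Qed.
Let k2 (zz : TZ * TZ) : probability (TX * TX)%type R :=
  product_probability (kappa zz.1) (kappa zz.2).

Let mk2 C : measurable C -> measurable_fun setT (k2 ^~ C).
Proof. by move=> mC; exact: measurable_product_kernel. Qed.

Let k2_setT B1 B2 A1 A2 :
  measurable A1 -> measurable A2 -> measurable B1 -> measurable B2 ->
  \int[nu \x nu]_(zz in B1 `*` B2) k2 zz (A1 `*` A2) =
  (\int[nu]_(z in B1) kappa z A1) * (\int[nu]_(z in B2) kappa z A2).
Proof.
move=> mA1 mA2 mB1 mB2.
pose f := (fun z => kappa z A1) \_ B1; pose g := (fun z => kappa z A2) \_ B2.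
have mf : measurable_fun setT f.
  by apply/(measurable_restrictT _ _).1 => //; apply: measurable_funTS; exact: mkappa.
have mg : measurable_fun setT g.
  by apply/(measurable_restrictT _ _).1 => //; apply: measurable_funTS; exact: mkappa.
have f0 z : 0 <= f z by rewrite /f patchE; case: ifP.
have g0 z : 0 <= g z by rewrite /g patchE; case: ifP.
rewrite [X in _ = X * _]integral_mkcond [X in _ = _ * X]integral_mkcond -/f -/g
  [LHS]integral_mkcond.
transitivity (\int[nu \x nu]_zz (f zz.1 * g zz.2)).
  apply: eq_integral => -[z1 z2] _; rewrite /f /g !patchE in_setX/=.
  case: (z1 \in B1); last by rewrite mul0e.
  case: (z2 \in B2); last by rewrite mule0.
  by rewrite /k2 /product_probability product_measure1E.
rewrite fubini_tonelli1//=; last 2 first.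
- apply: emeasurable_funM; first exact: measurableT_comp mf measurable_fst.
  exact: measurableT_comp mg measurable_snd.
- by move=> z; exact: mule_ge0.
rewrite -ge0_integralZr//; last exact: integral_ge0.
apply: eq_integral => z _; rewrite /fubini_F /= ge0_integralZl//.
Qed.

(** Over products of rectangles this is the product of the two conditional laws,
by Tonelli's theorem; both sides extend to measures on the product space, the
right-hand one being a mixture. *)
Lemma pair_mixture C D : measurable C -> measurable D ->
  P (ZZ @^-1` D `&` UV @^-1` C) = \int[nu \x nu]_(zz in D) k2 zz C.
Proof.
move=> mC mD; rewrite -(mixtureX (nu \x nu) k2)//.
have mW : measurable_fun setT (fun w => (ZZ w, UV w)) by exact: measurable_fun_pair.
pose m1 : {measure set ((TZ * TZ) * (TX * TX)) -> \bar R} :=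
  measure_function_pushforward__canonical__measure_function_Measure P mW.
pose m2 : {measure set ((TZ * TZ) * (TX * TX)) -> \bar R} :=
  mixture_measure (nu \x nu) mk2.
rewrite -[LHS]/(m1 (D `*` C)) -[RHS]/(m2 (D `*` C)).
apply: eq_measure_nested_rectangles => //; last exact: measurableX.
  rewrite /m1 /= /pushforward preimage_setT.
  exact: le_lt_trans (probability_le1 P measurableT) (ltry _).
move=> B1 B2 A1 A2 mB1 mB2 mA1 mA2.
rewrite /m2 /= mixtureX//; [|exact: measurableX..].
rewrite k2_setT// -UVZ// /m1 /= /pushforward; congr (P _).
by apply/seteqP; split=> w /= [] [] ? ? [] ? ?.
Qed.

(** The previous lemma says that, on the event that (U, V) is in C, the law of
(Z1, Z2) has as density the conditional probability of C with respect to the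
unrestricted law of (Z1, Z2). *)
Lemma expectation_pair_conditional (C : set (TX * TX)) (phi : TZ * TZ -> R) :
  measurable C -> bounded_mfun phi ->
  (\int[P]_w (phi (Z1 w, Z2 w) * \1_C (U w, V w)) =
   \int[P]_w (phi (Z1 w, Z2 w) *
      fine ((kappa (Z1 w) \x kappa (Z2 w)) C)))%R.
Proof.
move=> mC [mphi [a phia]]; pose E := UV @^-1` C.
have mE : measurable E by exact: measurable_preimage.
pose q zz := fine (k2 zz C).
have qE zz : (q zz)%:E = k2 zz C by rewrite /q fineK// fin_num_measure.
have mq : measurable_fun setT q.
  apply/measurable_EFinP; rewrite (_ : EFin \o q = k2 ^~ C); first exact: mk2.
  by apply/funext => zz; rewrite /= qE.
have q0 zz : (0 <= q zz)%R by rewrite fine_ge0.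
pose PE : {measure set Omega -> \bar R} :=
  measure_function_mrestr__canonical__measure_function_Measure P mE.
pose rho : {measure set (TZ * TZ) -> \bar R} :=
  measure_function_pushforward__canonical__measure_function_Measure PE mZZ.
pose law : {measure set (TZ * TZ) -> \bar R} :=
  measure_function_pushforward__canonical__measure_function_Measure P mZZ.
have lawE D : measurable D -> (nu \x nu) D = law D.
  move=> mD; have := @pair_mixture setT D measurableT mD.
  rewrite preimage_setT setIT /law /= /pushforward => ->.
  rewrite (eq_integral (cst 1)); last by move=> zz _; rewrite [LHS]probability_setT.
  by rewrite integral_cst// mul1e.
have rhoE D : measurable D -> rho D = \int[law]_(zz in D) (q zz)%:E.
  move=> mD; rewrite /rho /= /pushforward /PE /= /mrestr pair_mixture//.
  rewrite (eq_measure_integral law) => [|A mA _]; last exact: lawE.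
  by apply: eq_integral => zz _; rewrite qE.
have PEE D : measurable D -> PE D = \int[P]_(w in D) (\1_E w)%:E.
  by move=> mD; rewrite integral_indic// setIC.
have mZ : measurable_fun setT (phi \o ZZ) by exact: measurableT_comp.
have mpq : measurable_fun setT (fun zz => phi zz * q zz)%R by exact: measurable_funM.
have a0 : (0 <= a)%R by rewrite (le_trans _ (phia (Z1 point, Z2 point))).
have q1 zz : (`|q zz| <= 1)%R.
  by rewrite ger0_norm// -lee_fin qE probability_le1.
have i1 : P.-integrable setT (EFin \o (phi \o ZZ)).
  exact: (bounded_integrable P mZ (fun w => phia (ZZ w))).
have ipq : P.-integrable setT ((fun zz => (phi zz * q zz)%:E) \o ZZ).
  have mpqZ : measurable_fun setT ((fun zz => phi zz * q zz)%R \o ZZ).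
    exact: measurableT_comp.
  apply: (bounded_integrable P mpqZ (a := a)) => w /=.
  by rewrite normrM -[leRHS]mulr1 ler_pM.
have irho : PE.-integrable setT ((fun zz => (phi zz)%:E) \o ZZ).
  apply: (@measurable_bounded_integrable _ _ _ _ (phi \o ZZ)) => //.
    rewrite /PE /= /mrestr.
    exact: le_lt_trans (probability_le1 P (measurableI _ _ measurableT mE)) (ltry _).
  exists a; split; first exact: num_real.
  by move=> M aM x _ /=; rewrite (le_trans (phia _))// ltW.
have E1 : \int[rho]_zz (phi zz)%:E = \int[P]_w (phi (ZZ w) * \1_E w)%:E.
  rewrite integral_pushforward//; last exact/measurable_EFinP.
  rewrite preimage_setT (integral_density (f := \1_E) _ _ PEE mZ)//.
have E2 : \int[rho]_zz (phi zz)%:E = \int[P]_w (phi (ZZ w) * q (ZZ w))%:E.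
  rewrite (integral_density mq q0 rhoE)//.
  by rewrite integral_pushforward//; exact/measurable_EFinP.
rewrite /Rintegral; congr fine.
transitivity (\int[P]_w (phi (ZZ w) * \1_E w)%:E).
  by apply: eq_integral => w _; rewrite !indicE.
by rewrite -E1 E2.
Qed.

End pair_conditional.

(** * Symmetrization and absence of ties *)

Section symmetrization.
Variable R : realType.
Local Notation XX := ((R * R) * (R * R))%type.
Implicit Types (g : R * R -> R * R -> R) (x y : R * R) (xy : XX).

Definition symm g xy : R := (g xy.1 xy.2 + g xy.2 xy.1) / 2.

(** The constant c is -1, 0 and 1 for g1, g2 and g3; its coefficient is the
indicator of a tie in at least one coordinate. *)
Lemma symmE g : [\/ g = @g1 R, g = @g2 R | g = @g3 R] ->
  exists2 c : R, `|c| <= 1 & forall xy, symm g xy =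
    \1_(@concordant R) xy - \1_(@discordant R) xy +
    c * (1 - \1_(@concordant R) xy - \1_(@discordant R) xy).
Proof.
have cE xy : (\1_(@concordant R) xy : R) =
    (0 < (xy.1.1 - xy.2.1) * (xy.1.2 - xy.2.2))%R%:R.
  by rewrite indicE; congr (nat_of_bool _)%:R; apply/idP/idP; rewrite inE.
have dE xy : (\1_(@discordant R) xy : R) =
    ((xy.1.1 - xy.2.1) * (xy.1.2 - xy.2.2) < 0)%R%:R.
  by rewrite indicE; congr (nat_of_bool _)%:R; apply/idP/idP; rewrite inE.
have posE (s t : R) : (0 < s * t) = (0 < s) && (0 < t) || (s < 0) && (t < 0).
  case: (ltgtP 0 s) => [s0|s0|<-] /=; last by rewrite mul0r ltxx.
    by rewrite pmulr_rgt0// orbF.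
  by rewrite nmulr_rgt0.
have negE (s t : R) : (s * t < 0) = (0 < s) && (t < 0) || (s < 0) && (0 < t).
  by rewrite -oppr_gt0 -mulrN posE oppr_gt0 oppr_lt0.
case=> ->; [exists (-1)|exists 0|exists 1];
  rewrite ?normrN ?normr1 ?normr0 ?ler01// => -[[a b] [a' b']];
  rewrite cE dE /symm /g1 /g2 /g3 /=;
  [|by rewrite -(opprB a) -(opprB b) mulrNN; field|];
  rewrite posE negE -[a < a']subr_lt0 -[a' < a]subr_gt0
    -[b < b']subr_lt0 -[b' < b]subr_gt0;
  by case: (ltgtP 0 (a - a')) => _; case: (ltgtP 0 (b - b')) => _ /=; field.
Qed.

Lemma measurable_concordant : measurable (@concordant R).
Proof.
rewrite -[X in measurable X]setTI; apply: measurable_fun_ltr => //.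
apply: measurable_funM; apply: measurable_funB.
- exact: (measurableT_comp measurable_fst measurable_fst).
- exact: (measurableT_comp measurable_fst measurable_snd).
- exact: (measurableT_comp measurable_snd measurable_fst).
- exact: (measurableT_comp measurable_snd measurable_snd).
Qed.

Lemma measurable_discordant : measurable (@discordant R).
Proof.
rewrite -[X in measurable X]setTI; apply: measurable_fun_ltr => //.
apply: measurable_funM; apply: measurable_funB.
- exact: (measurableT_comp measurable_fst measurable_fst).
- exact: (measurableT_comp measurable_fst measurable_snd).
- exact: (measurableT_comp measurable_snd measurable_fst).
- exact: (measurableT_comp measurable_snd measurable_snd).
Qed.

Lemma bounded_mfun_indic d (T : measurableType d) (A : set T) :
  measurable A -> bounded_mfun (\1_A : T -> R).
Proof.
move=> mA; split; first exact: measurable_indic.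
by exists 1 => x; rewrite indicE; case: (_ \in _); rewrite ?normr1 ?normr0.
Qed.

Lemma symm_bounded_mfun g : [\/ g = @g1 R, g = @g2 R | g = @g3 R] ->
  bounded_mfun (symm g).
Proof.
move=> /symmE[c _ gE]; rewrite (funext gE).
have b1 := bounded_mfun_indic measurable_concordant.
have b2 := bounded_mfun_indic measurable_discordant.
apply: bounded_mfunD; first exact: bounded_mfunB.
apply: bounded_mfunZ; apply: bounded_mfunB => //.
by apply: bounded_mfunB => //; exact: bounded_mfun_cst.
Qed.

Lemma symm_norm_le1 g xy : [\/ g = @g1 R, g = @g2 R | g = @g3 R] ->
  `|symm g xy| <= 1.
Proof.
move=> /symmE[c c1 ->]; rewrite !indicE.
case: (boolP (xy \in @concordant R)); case: (boolP (xy \in @discordant R)) => /=.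
- rewrite !inE /concordant /discordant/= => d0 c0.
  by have := lt_trans d0 c0; rewrite ltxx.
- by rewrite !subr0 subrr mulr0 addr0 normr1.
- by rewrite sub0r subr0 subrr mulr0 addr0 normrN normr1.
- by rewrite !subr0 add0r mulr1.
Qed.

Lemma g_bounded_mfun g : [\/ g = @g1 R, g = @g2 R | g = @g3 R] ->
  bounded_mfun (fun xy : XX => g xy.1 xy.2).
Proof.
have m11 : measurable_fun setT (fun xy : XX => xy.1.1).
  exact: (measurableT_comp measurable_fst measurable_fst).
have m12 : measurable_fun setT (fun xy : XX => xy.1.2).
  exact: (measurableT_comp measurable_snd measurable_fst).
have m21 : measurable_fun setT (fun xy : XX => xy.2.1).
  exact: (measurableT_comp measurable_fst measurable_snd).
have m22 : measurable_fun setT (fun xy : XX => xy.2.2).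
  exact: (measurableT_comp measurable_snd measurable_snd).
have bb (b : XX -> bool) : measurable_fun setT b ->
    bounded_mfun (fun xy => (b xy)%:R : R).
  move=> mb; rewrite (_ : (fun _ => _) = \1_[set xy | b xy]).
    apply: bounded_mfun_indic; rewrite -[X in measurable X]setTI.
    exact: (mb measurableT [set true]).
  apply/funext => xy; rewrite indicE; congr (nat_of_bool _)%:R.
  by apply/idP/idP; rewrite inE.
case=> ->.
- apply: bounded_mfunB; last exact: bounded_mfun_cst.
  apply: bounded_mfunZ; apply: bb; apply: measurable_and;
    exact: measurable_fun_ltr.
- have mM : measurable_fun setT
      (fun xy : XX => (xy.1.1 - xy.2.1) * (xy.1.2 - xy.2.2)).
    by apply: measurable_funM; exact: measurable_funB.
  by apply: bounded_mfunB; apply: bb; exact: measurable_fun_ltr.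
- apply: bounded_mfunB; first exact: bounded_mfun_cst.
  apply: bounded_mfunZ; apply: bb; apply: measurable_and;
    exact: measurable_fun_ltr.
Qed.

End symmetrization.

Section product_swap.
Context d (T : measurableType d) (R : realType) (m : probability T R).

Lemma product_swap (f : T * T -> R) : bounded_mfun f ->
  \int[(m \x m)%E]_x f (x.2, x.1) = \int[(m \x m)%E]_x f x.
Proof.
move=> bf; have [mf [a fa]] := bf.
pose sw (x : T * T) := (x.2, x.1).
have msw : measurable_fun setT sw by exact: measurable_fun_pair.
pose mm : probability (T * T)%type R := product_probability m m.
pose ms : {measure set (T * T) -> \bar R} :=
  measure_function_pushforward__canonical__measure_function_Measure mm msw.
have mfs : measurable_fun setT (f \o sw) by exact: measurableT_comp.
rewrite -[LHS]/(\int[mm]_x (f \o sw) x) /Rintegral; congr fine.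
rewrite (eq_measure_integral ms) => [|A mA _]; last first.
  apply: product_measure_unique => // B C mB mC.
  rewrite /ms /= /pushforward (_ : sw @^-1` _ = C `*` B); last first.
    by apply/seteqP; split=> -[x y] [].
  by rewrite /mm /product_probability/= product_measure1E// muleC.
rewrite integral_pushforward//; first exact/measurable_EFinP.
exact: (bounded_integrable mm mfs (fun x => fa (sw x))).
Qed.

End product_swap.

Lemma expect_indic d (T : measurableType d) (R : realType) (P : probability T R)
  (A : set T) : measurable A -> \int[P]_x \1_A x = fine (P A).
Proof. by move=> mA; rewrite /Rintegral integral_indic// setIT. Qed.

Section atoms.
Context d (T : measurableType d) (R : realType) (pi : T -> R).
Hypothesis mpi : measurable_fun setT pi.
Implicit Types m : probability T R.

Definition tie : set (T * T) := [set x | pi x.1 = pi x.2].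

Lemma measurable_tie : measurable tie.
Proof.
rewrite (_ : tie = [set x | pi x.1 == pi x.2]); last first.
  by apply/seteqP; split=> x /eqP.
rewrite -[X in measurable X]setTI; apply: measurable_fun_eqr => //.
  exact: (measurableT_comp mpi measurable_fst).
exact: (measurableT_comp mpi measurable_snd).
Qed.

(** Two draws that hit the same atom tie, so the probability of a tie is at least
the square of the mass of an atom. *)
Lemma tie_null_atom m (a : R) :
  (m \x m)%E tie = 0%E -> m [set x | pi x = a] = 0%E.
Proof.
move=> t0; have mA : measurable [set x | pi x = a].
  exact: (measurable_preimage mpi (measurable_set1 a)).
have : (m [set x | pi x = a] * m [set x | pi x = a] <= 0)%E.
  rewrite -product_measure1E// -t0 le_measure ?inE//.
  - exact: measurableX.
  - exact: measurable_tie.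
  - by move=> [x y] [/= xa ya]; rewrite /tie /= xa ya.
rewrite -(fineK (fin_num_measure m _ mA)) -EFinM lee_fin => le0.
have: fine (m [set x | pi x = a]) ^+ 2 = 0.
  by apply/eqP; rewrite eq_le sqr_ge0 andbT expr2.
by move/eqP; rewrite sqrf_eq0 => /eqP ->.
Qed.

(** Given the first draw, a tie is a hit of one fixed value by the second. *)
Lemma atom_null_tie m m' :
  (forall a, m' [set x | pi x = a] = 0%E) -> (m \x m')%E tie = 0%E.
Proof.
move=> m0; rewrite /product_measure1 integral0_eq// => x _ /=.
rewrite (_ : xsection tie x = [set y | pi y = pi x])//.
by apply/seteqP; split=> y; rewrite /xsection /= inE.
Qed.

End atoms.

Section ties.
Variables (R : realType) (p : nat) (kappa : 'rV[R]_p -> probability (R * R)%type R).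
Implicit Types u v z : 'rV[R]_p.
Local Notation C := (@concordant R).
Local Notation D := (@discordant R).
Local Notation tie1 := (tie (@fst R R)).
Local Notation tie2 := (tie (@snd R R)).
Let mC := @measurable_concordant R.
Let mD := @measurable_discordant R.

Let mt1 : measurable tie1. Proof. exact: measurable_tie measurable_fst. Qed.
Let mt2 : measurable tie2. Proof. exact: measurable_tie measurable_snd. Qed.
Let mt : measurable (tie1 `|` tie2). Proof. exact: measurableU. Qed.

Lemma concordant_discordant_tie (m : probability ((R * R) * (R * R))%type R) :
  fine (m C) + fine (m D) + fine (m (tie1 `|` tie2)) = 1.
Proof.
have b1 := bounded_mfun_indic R mC.
have b2 := bounded_mfun_indic R mD.
have b3 := bounded_mfun_indic R mt.
rewrite -!expect_indic// -expectD// -expectD//; last exact: bounded_mfunD.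
rewrite -[RHS](expect_cst m); apply: eq_Rintegral => -[[a b] [a' b']] _.
rewrite !indicE.
have tE : (((a, b), (a', b')) \in tie1 `|` tie2) = (a == a') || (b == b').
  apply/idP/idP; rewrite inE.
    by case; rewrite /tie /= => ->; rewrite eqxx ?orbT.
  by case/orP => /eqP ->; [left|right].
have cE : (((a, b), (a', b')) \in C) = (0 < (a - a') * (b - b')).
  by apply/idP/idP; rewrite inE.
have dE : (((a, b), (a', b')) \in D) = ((a - a') * (b - b') < 0).
  by apply/idP/idP; rewrite inE.
rewrite tE cE dE -(subr_eq0 a) -(subr_eq0 b) -mulf_eq0.
by case: (ltgtP 0 ((a - a') * (b - b'))) => _ /=; rewrite ?addr0 ?add0r.
Qed.

(** Two independent draws from the same law are exchangeable. *)
Lemma symm_expect g (m : probability (R * R)%type R) :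
  [\/ g = @g1 R, g = @g2 R | g = @g3 R] ->
  \int[(m \x m)%E]_x g x.1 x.2 =
  \int[product_probability m m]_x symm g x.
Proof.
move=> gc; have bg := g_bounded_mfun gc.
have bg' : bounded_mfun (fun x : (R * R) * (R * R) => g x.2 x.1).
  have msw : measurable_fun setT (fun x : (R * R) * (R * R) => (x.2, x.1)).
    exact: measurable_fun_pair.
  exact: (bounded_mfun_comp msw bg).
transitivity (\int[product_probability m m]_x (2^-1 * (g x.1 x.2 + g x.2 x.1))).
  rewrite expectZ; last exact: bounded_mfunD.
  rewrite expectD//.
  rewrite -[in X in _ + X]/(\int[(m \x m)%E]_x g x.2 x.1).
  rewrite (product_swap m bg) -[X in X + _]/(\int[(m \x m)%E]_x g x.1 x.2).
  by field.
by apply: eq_Rintegral => x _; rewrite mulrC.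
Qed.

(** On the diagonal the assumption on g reads c * P(tie) = 0, so c = 0 or the
conditional laws have atomless margins. The latter property concerns one
conditional law at a time, hence excludes ties between draws from two different
ones. *)
Lemma no_tie g : [\/ g = @g1 R, g = @g2 R | g = @g3 R] ->
  (forall z, cond_tau kappa z = cond_mean2 kappa g z z) ->
  exists2 c : R, (forall x, symm g x = \1_C x - \1_D x + c * (1 - \1_C x - \1_D x)) &
  forall u v, c * (1 - fine (pair_law kappa u v C) - fine (pair_law kappa u v D)) = 0.
Proof.
move=> gc taug; have [c _ gE] := symmE gc; exists c => // u v.
have [->|c0] := eqVneq c 0; first by rewrite mul0r.
have tie0 z : (kappa z \x kappa z)%E (tie1 `|` tie2) = 0%E.
  pose m : probability ((R * R) * (R * R))%type R :=
    product_probability (kappa z) (kappa z).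
  have := taug z; rewrite /cond_mean2 /pair_law symm_expect//.
  under eq_Rintegral do rewrite gE.
  have b1 := bounded_mfun_indic R mC.
  have b2 := bounded_mfun_indic R mD.
  have b3 : bounded_mfun (fun x => 1 - \1_C x - \1_D x : R).
    by apply: bounded_mfunB => //; apply: bounded_mfunB => //; exact: bounded_mfun_cst.
  rewrite expectD; [|exact: bounded_mfunB|exact: bounded_mfunZ].
  rewrite expectB// expectZ// expectB//; last first.
    by apply: bounded_mfunB => //; exact: bounded_mfun_cst.
  rewrite expectB//; last exact: bounded_mfun_cst.
  rewrite expect_cst !expect_indic// /cond_tau /cond_tau2 /pair_law.
  rewrite -[(kappa z \x kappa z)%E C]/(m C) -[(kappa z \x kappa z)%E D]/(m D).
  rewrite -[LHS]addr0 => /addrI/esym/eqP.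
  rewrite mulf_eq0 (negbTE c0)/= => /eqP h.
  have := concordant_discordant_tie m => h'.
  have h0 : fine (m (tie1 `|` tie2)) = 0 by lra.
  rewrite -[LHS]/(m (tie1 `|` tie2)) -[LHS]fineK ?h0//.
  exact: fin_num_measure.
pose m : probability ((R * R) * (R * R))%type R :=
  product_probability (kappa u) (kappa v).
have sub (pi : R * R -> R) : measurable_fun setT pi ->
    tie pi `<=` tie1 `|` tie2 -> m (tie pi) = 0%E.
  move=> mpi pit; apply: atom_null_tie => a; apply: tie_null_atom => //.
  apply/eqP; rewrite eq_le measure_ge0 andbT -(tie0 v).
  by rewrite le_measure ?inE//; exact: measurable_tie.
have m0 : m (tie1 `|` tie2) = 0%E.
  apply/eqP; rewrite eq_le measure_ge0 andbT.
  have h1 : m tie1 = 0%E by apply: sub => //; exact: subsetUl.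
  have h2 : m tie2 = 0%E by apply: sub => //; exact: subsetUr.
  apply: le_trans (measureU2 m mt1 mt2) _.
  by rewrite [X in (X + _)%E]h1 [X in (_ + X)%E]h2 adde0.
have := concordant_discordant_tie m; rewrite m0/= addr0 => h.
have -> : fine (pair_law kappa u v C) = fine (m C) by [].
have -> : fine (pair_law kappa u v D) = fine (m D) by [].
by rewrite (_ : 1 - _ - _ = 0) ?mulr0// -h; ring.
Qed.

End ties.

(** * Consistency of the kernel estimate of Kendall's tau *)

Section estimator.
Context (R : realType) (p : nat) d (Omega : measurableType d).
Variable P : probability Omega R.
Variables (X : {RV P >-> (R * R)%type}) (Z : {RV P >-> 'rV[R]_p}).
Variables (Xs : nat -> {RV P >-> (R * R)%type}).
Variables (Zs : nat -> {RV P >-> 'rV[R]_p}).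
Hypothesis copies : iid_copies X Z Xs Zs.
Variables (f : 'rV[R]_p -> R) (f_density : is_density Z f).
Variable kappa : 'rV[R]_p -> probability (R * R)%type R.
Hypothesis kappa_law : is_conditional_law X Z kappa.
Variable g : R * R -> R * R -> R.
Hypothesis g_cases : [\/ g = @g1 R, g = @g2 R | g = @g3 R].
Hypothesis tau_g : forall z, cond_tau kappa z = cond_mean2 kappa g z z.
Local Notation leb := (@lebesgue_rV R p).
Local Notation S := ((R * R) * 'rV[R]_p)%type.

Let W i w : S := (Xs i w, Zs i w).
Let mW i : measurable_fun setT (W i).
Proof. exact: measurable_fun_pair. Qed.
Let W_indep := copies.2.

Let mf : measurable_fun setT f. Proof. by case: f_density. Qed.
Let f0 u : 0 <= f u. Proof. by case: f_density. Qed.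
Let fE B : measurable B -> (distribution P Z B = \int[leb]_(z in B) (f z)%:E)%E.
Proof. by case: f_density => _ _; exact. Qed.

Lemma density_integral1 : (\int[leb]_u (f u)%:E = 1)%E.
Proof. by rewrite -fE// probability_setT. Qed.

Lemma expect_density (phi : 'rV[R]_p -> R) : bounded_mfun phi ->
  \int[P]_w phi (Z w) = \int[leb]_u (phi u * f u).
Proof.
move=> [mphi [a phia]]; rewrite /Rintegral; congr fine.
have mphiZ : measurable_fun setT (phi \o Z) by exact: measurableT_comp.
rewrite -(integral_density mf f0 fE mphi) integral_distribution//.
  exact/measurable_EFinP.
exact: (bounded_integrable P mphiZ (fun w => phia (Z w))).
Qed.

Lemma copies_expect (phi : 'rV[R]_p -> R) i : bounded_mfun phi ->
  \int[P]_w phi (Zs i w) = \int[P]_w phi (Z w).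
Proof.
move=> [mphi [a phia]]; rewrite /Rintegral; congr fine.
have mphiZ : measurable_fun setT (phi \o Z) by exact: measurableT_comp.
have mphiZi : measurable_fun setT (phi \o Zs i) by exact: measurableT_comp.
have me : measurable_fun setT (fun u => (phi u)%:E) by exact/measurable_EFinP.
rewrite -[LHS](integral_distribution me); last first.
  exact: (bounded_integrable P mphiZi (fun w => phia (Zs i w))).
rewrite -[RHS](integral_distribution me); last first.
  exact: (bounded_integrable P mphiZ (fun w => phia (Z w))).
apply: eq_measure_integral => A mA _.
have mTA : measurable ([set: R * R] `*` A) by exact: measurableX.
have := copies.1 i _ mTA.
rewrite /distribution /pushforward.
have -> : [set w | ([set: R * R] `*` A) (Xs i w, Zs i w)] = Zs i @^-1` A.
  by apply/seteqP; split=> w //= [].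
have -> : [set w | ([set: R * R] `*` A) (X w, Z w)] = Z @^-1` A.
  by apply/seteqP; split=> w //= [].
by [].
Qed.

Let copies_law i A B : measurable A -> measurable B ->
  (P (Xs i @^-1` A `&` Zs i @^-1` B) = \int[distribution P Z]_(z in B) kappa z A)%E.
Proof.
move=> mA mB; have mAB : measurable (A `*` B) by exact: measurableX.
have := copies.1 i _ mAB.
have -> : [set w | (A `*` B) (Xs i w, Zs i w)] = Xs i @^-1` A `&` Zs i @^-1` B by [].
have -> : [set w | (A `*` B) (X w, Z w)] = X @^-1` A `&` Z @^-1` B by [].
by move=> ->; exact: (conditional_lawE kappa_law).
Qed.

Let pairs_law i j A1 A2 B1 B2 : i != j ->
  measurable A1 -> measurable A2 -> measurable B1 -> measurable B2 ->
  (P ((Xs i @^-1` A1 `&` Zs i @^-1` B1) `&` (Xs j @^-1` A2 `&` Zs j @^-1` B2)) =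
  (\int[distribution P Z]_(z in B1) kappa z A1) *
  (\int[distribution P Z]_(z in B2) kappa z A2))%E.
Proof.
move=> ij mA1 mA2 mB1 mB2; rewrite -(copies_law i)// -(copies_law j)//.
have mC A B : measurable A -> measurable B ->
    measurable ((A `*` B) `*` [set: S] : set (S * S)).
  by move=> mA mB; apply: measurableX => //; exact: measurableX.
have := iid_pairs_indep mW W_indep ij ij ij ij
  (mC _ _ mA1 mB1) (mC _ _ mA2 mB2).
have E k A B : (fun w => (W k w, W k w)) @^-1` ((A `*` B) `*` [set: S]) =
    Xs k @^-1` A `&` Zs k @^-1` B.
  by apply/seteqP; split=> w /= [].
by rewrite !E.
Qed.

Lemma measurable_cond_tau2 :
  measurable_fun setT (fun zz : 'rV[R]_p * 'rV[R]_p => cond_tau2 kappa zz.1 zz.2).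
Proof.
have mk := conditional_law_measurable kappa_law.
have mfine C : measurable C -> measurable_fun setT
    (fun zz : 'rV[R]_p * 'rV[R]_p => fine (pair_law kappa zz.1 zz.2 C)).
  move=> mC; apply: measurableT_comp => //.
  exact: measurable_product_kernel.
by apply: measurable_funB; apply: mfine;
  [exact: measurable_concordant|exact: measurable_discordant].
Qed.

Lemma fine_pair_law_itv u v C : measurable C ->
  0 <= fine (pair_law kappa u v C) <= 1.
Proof.
pose m : probability ((R * R) * (R * R))%type R :=
  product_probability (kappa u) (kappa v).
move=> mC; rewrite fine_ge0//= -lee_fin.
by rewrite -[pair_law _ _ _ C]/(m C) fineK ?fin_num_measure// probability_le1.
Qed.

Lemma cond_tau2_le1 u v : `|cond_tau2 kappa u v| <= 1.
Proof.
have := fine_pair_law_itv u v (@measurable_concordant R).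
have := fine_pair_law_itv u v (@measurable_discordant R).
by rewrite /cond_tau2 => /andP[? ?] /andP[? ?]; rewrite ler_norml; lra.
Qed.

(** The symmetrization is a combination of indicators of concordance and
discordance, to which conditioning applies; by [no_tie] the tie term vanishes. *)
Lemma symm_conditional i j (phi : 'rV[R]_p * 'rV[R]_p -> R) :
  i != j -> bounded_mfun phi ->
  \int[P]_w (phi (Zs i w, Zs j w) * symm g (Xs i w, Xs j w)) =
  \int[P]_w (phi (Zs i w, Zs j w) * cond_tau2 kappa (Zs i w) (Zs j w)).
Proof.
move=> ij bphi; have [c gE c0] := no_tie g_cases tau_g.
have mk := conditional_law_measurable kappa_law.
have mC := @measurable_concordant R; have mD := @measurable_discordant R.
have cond C : measurable C -> \int[P]_w (phi (Zs i w, Zs j w) * \1_C (Xs i w, Xs j w)) =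
    \int[P]_w (phi (Zs i w, Zs j w) * fine (pair_law kappa (Zs i w) (Zs j w) C)).
  move=> mE.
  apply: (expectation_pair_conditional (nu := distribution P Z) mk
    _ _ _ _ _ mE bphi) => //.
  by move=> *; exact: pairs_law.
have mXX : measurable_fun setT (fun w => (Xs i w, Xs j w)) by exact: measurable_fun_pair.
have mZZ : measurable_fun setT (fun w => (Zs i w, Zs j w)) by exact: measurable_fun_pair.
have bphiZ : bounded_mfun (fun w => phi (Zs i w, Zs j w)).
  exact: (bounded_mfun_comp mZZ bphi).
have b1 C : measurable C ->
    bounded_mfun (fun w => phi (Zs i w, Zs j w) * \1_C (Xs i w, Xs j w)).
  move=> mE; apply: bounded_mfunM => //.
  exact: (bounded_mfun_comp mXX (bounded_mfun_indic R mE)).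
have b2 C : measurable C -> bounded_mfun (fun w =>
    phi (Zs i w, Zs j w) * fine (pair_law kappa (Zs i w) (Zs j w) C)).
  move=> mE; apply: bounded_mfunM => //; split.
    have mq : measurable_fun setT (fun zz : 'rV[R]_p * 'rV[R]_p =>
        fine (pair_law kappa zz.1 zz.2 C)).
      by apply: measurableT_comp => //; exact: measurable_product_kernel.
    exact: (measurableT_comp mq mZZ).
  exists 1 => w; have /andP[q0 q1] := fine_pair_law_itv (Zs i w) (Zs j w) mE.
  by rewrite ger0_norm.
transitivity (\int[P]_w (
   (1 - c) * (phi (Zs i w, Zs j w) * \1_(@concordant R) (Xs i w, Xs j w)) -
   (1 + c) * (phi (Zs i w, Zs j w) * \1_(@discordant R) (Xs i w, Xs j w)) +
   c * phi (Zs i w, Zs j w))).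
  by apply: eq_Rintegral => w _; rewrite gE; ring.
transitivity (\int[P]_w ((1 - c) * (phi (Zs i w, Zs j w) *
     fine (pair_law kappa (Zs i w) (Zs j w) (@concordant R))) -
   (1 + c) * (phi (Zs i w, Zs j w) *
     fine (pair_law kappa (Zs i w) (Zs j w) (@discordant R))) +
   c * phi (Zs i w, Zs j w))).
  have lin (f1 f2 f3 : Omega -> R) (a b e : R) : bounded_mfun f1 ->
      bounded_mfun f2 -> bounded_mfun f3 ->
      \int[P]_w (a * f1 w - b * f2 w + e * f3 w) =
      a * (\int[P]_w f1 w) - b * (\int[P]_w f2 w) + e * (\int[P]_w f3 w).
    move=> bf1 bf2 bf3.
    have bZ (x : R) h : bounded_mfun h -> bounded_mfun (fun w => x * h w).
      exact: bounded_mfunZ.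
    rewrite expectD; [|by apply: bounded_mfunB; exact: bZ|exact: bZ].
    by rewrite expectB ?expectZ//; exact: bZ.
  rewrite !lin//; do ?[exact: b1|exact: b2].
  by rewrite !cond.
apply: eq_Rintegral => w _; rewrite /cond_tau2.
have := c0 (Zs i w) (Zs j w).
set pc := fine _; set pd := fine _; set F := phi _ => h.
transitivity (F * (pc - pd) + F * (c * (1 - pc - pd))); first by ring.
by rewrite h mulr0 addr0.
Qed.


Section at_a_point.
Variable K : 'rV[R]_p -> R.
Hypothesis mK : measurable_fun setT K.
Variable M : R.
Hypothesis KM : forall u, `|K u| <= M.
Hypothesis Kabs : (\int[leb]_u `|K u|%:E < +oo)%E.
Hypothesis K1 : (\int[leb]_u (K u)%:E = 1)%E.
Hypothesis Ktail : forall e : R, 0 < e ->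
  exists M : R, forall t, M < norm2 t -> `|K t| * norm2 t ^+ p < e.
Variables (h : nat -> R) (z0 : 'rV[R]_p).
Hypotheses (h_gt0 : forall n, 0 < h n) (h_cvg0 : h @ \oo --> (0 : R)).
Hypothesis nh_cvgy : (fun n => n%:R * h n ^+ p) @ \oo --> +oo.
Hypotheses (cf : {for z0, continuous f}) (fz0 : 0 < f z0).
Hypothesis ctau : cond_tau_continuous_at kappa z0.

Let kern n (u : 'rV[R]_p) := scaled_kernel (h n) K (u - z0).
Let tau := cond_tau kappa z0.
Let b n := h n ^- p * M.

Let M0 : 0 <= M. Proof. exact: le_trans (normr_ge0 _) (KM 0). Qed.

Let hp0 n : 0 <= h n ^- p. Proof. by rewrite invr_ge0 exprn_ge0// ltW. Qed.

Let b0 n : 0 <= b n. Proof. by rewrite mulr_ge0. Qed.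

Let kern_le n u : `|kern n u| <= b n.
Proof. by rewrite normrM ger0_norm// ler_wpM2l. Qed.

Let mkern n : measurable_fun setT (kern n).
Proof. exact: measurable_scaled_kernel. Qed.

Let bkern n : bounded_mfun (kern n).
Proof. by split => //; exists (b n). Qed.

Let far (r : R) : set 'rV[R]_p := [set v | r < norm2 (v - z0)].

Let bfar r : bounded_mfun (\1_(far r) : 'rV[R]_p -> R).
Proof.
apply: bounded_mfun_indic; rewrite -[X in measurable X]setTI.
by apply: measurable_fun_ltr => //; exact: measurable_norm2B.
Qed.

Let bZ i (phi : 'rV[R]_p -> R) : bounded_mfun phi ->
  bounded_mfun (fun w => phi (Zs i w)).
Proof. by move=> bphi; exact: (bounded_mfun_comp (measurable_funPT (Zs i)) bphi). Qed.

Let A n := \int[P]_w `|kern n (Z w)|.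

Let A0 n : 0 <= A n. Proof. exact: Rintegral_ge0. Qed.

Let A_bounded : exists2 B, 0 <= B & \forall n \near \oo, A n <= B.
Proof.
exists (1 + f z0 * fine (\int[leb]_u `|K u|%:E)).
  by rewrite addr_ge0// mulr_ge0// fine_ge0// integral_ge0.
have := parzen_abs_bounded mK Kabs Ktail h_gt0 h_cvg0 mf f0 density_integral1 cf.
apply: filterS => n le.
rewrite /A (expect_density (bounded_mfun_norm (bkern n))) /Rintegral -lee_fin fineK//.
rewrite ge0_fin_numE; first exact: le_lt_trans le (ltry _).
by apply: integral_ge0 => u _; rewrite lee_fin mulr_ge0.
Qed.

Let kern_cvg : \int[P]_w kern n (Z w) @[n --> \oo] --> f z0.
Proof.
under eq_fun do rewrite (expect_density (bkern _)).
exact: (parzen_cvg mK Kabs K1 Ktail h_gt0 h_cvg0 mf f0 density_integral1 cf).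
Qed.

Let Fr r n := \int[P]_w (`|kern n (Z w)| * \1_(far r) (Z w)).

Let bKF r n : bounded_mfun (fun u => `|kern n u| * \1_(far r) u).
Proof. by apply: bounded_mfunM; [exact: bounded_mfun_norm|exact: bfar]. Qed.

Let F_cvg r : 0 < r -> Fr r n @[n --> \oo] --> (0 : R).
Proof.
move=> r0; rewrite /Fr; under eq_fun do rewrite (expect_density (bKF _ _)).
exact: (parzen_far mK Ktail z0 h_gt0 h_cvg0 mf f0 density_integral1 r0).
Qed.

Let eps n := b n / n%:R.
Let eps0 n : 0 <= eps n. Proof. by rewrite mulr_ge0. Qed.

(** The variances are governed by b n / n = M / (n h^p). *)
Let eps_cvg : eps n @[n --> \oo] --> (0 : R).
Proof.
apply/cvgrPdist_le => e e0; have /cvgryPgt/(_ (M / e)) := nh_cvgy.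
apply: filterS => n nh; rewrite sub0r normrN ger0_norm//.
rewrite ltr_pdivrMr// in nh.
have nh0 : 0 < n%:R * h n ^+ p.
  by rewrite -(pmulr_lgt0 _ e0) (le_lt_trans M0).
have n0 : (n%:R : R) != 0.
  by apply/eqP => n0; move: nh0; rewrite n0 mul0r ltxx.
have hn0 : h n ^+ p != 0 by rewrite expf_neq0// gt_eqF.
have -> : eps n = M / (n%:R * h n ^+ p) by rewrite /eps /b; field; rewrite n0 hn0.
by rewrite ler_pdivrMr// mulrC ltW.
Qed.

Let invn_cvg : (n%:R)^-1 @[n --> \oo] --> (0 : R).
Proof.
apply/cvgrPdist_le => e e0.
have [k ke] : exists k : nat, e^-1 <= k%:R.
  exists (Num.truncn e^-1).+1; exact/ltW/truncnS_gt.
exists k.+1 => // n /= kn; rewrite sub0r normrN ger0_norm// invf_ple ?posrE//.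
  by rewrite (le_trans ke)// ler_nat ltnW.
by rewrite ltr0n (leq_trans _ kn).
Qed.

(** Chebyshev's inequality. The variance of a kernel term is at most
2 b A + 2 (f z0)^2, where b bounds the kernel and A is its first absolute
moment. *)
Lemma density_estimate (t e : R) : 0 < t -> 0 < e -> \forall n \near \oo,
  (P [set w | (n%:R * t < `|\sum_(i < n) (kern n (Zs i w) - f z0)|)%R] <= e%:E)%E.
Proof.
move=> t0 e0; have [B B0 AB] := A_bounded.
pose r n : R := t ^- 2 * ((\int[P]_w kern n (Z w) - f z0) ^+ 2 +
  (2 * B * eps n + 2 * f z0 ^+ 2 * (n%:R)^-1)).
have rc : r n @[n --> \oo] --> (0 : R).
  rewrite (_ : 0 = t ^- 2 * ((f z0 - f z0) ^+ 2 +
     (2 * B * 0 + 2 * f z0 ^+ 2 * 0))); last by ring.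
  apply: cvgMl_tmp; apply: cvgD.
    have c1 : (\int[P]_w kern n (Z w) - f z0) @[n --> \oo] --> f z0 - f z0.
      by apply: cvgB => //; exact: cvg_cst.
    by under eq_fun do rewrite expr2; rewrite expr2; exact: cvgM.
  by apply: cvgD; exact: cvgMl_tmp.
have /cvgrPdist_le/(_ _ e0) rle := rc.
have n1 : \forall n \near \oo, (0 < n)%N by exists 1%N.
near=> n.
have An : A n <= B by near: n.
have rn : r n <= e.
  near: n; apply: filterS rle => n; rewrite sub0r normrN.
  by apply: le_trans; exact: ler_norm.
have n0 : (0 < n)%N by near: n.
have nR : 0 < n%:R :> R by rewrite ltr0n.
pose u (s : S) := kern n s.2 - f z0.
have bu : bounded_mfun u.
  apply: bounded_mfunB; last exact: bounded_mfun_cst.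
  exact: (bounded_mfun_comp measurable_snd (bkern n)).
have bk i : bounded_mfun (fun w => kern n (Zs i w)) by exact: bZ.
have bkn := bounded_mfun_norm (bkern n).
have bSum : bounded_mfun (fun w => \sum_(i < n) (kern n (Zs i w) - f z0)).
  apply: bounded_mfun_sum => i; apply: bounded_mfunB => //; exact: bounded_mfun_cst.
apply: le_trans (chebyshev_bound P bSum (mulr_gt0 nR t0)) _.
rewrite lee_fin.
have s0 : 0 <= 2 * b n * A n + 2 * f z0 ^+ 2.
  by rewrite addr_ge0// mulr_ge0 ?sqr_ge0// mulr_ge0.
have := sum_second_moment mW W_indep (u := u)
  (e := \int[P]_w kern n (Z w) - f z0) n bu s0.
have Eu i : \int[P]_w u (W i w) = \int[P]_w kern n (Z w) - f z0.
  rewrite /u /W /= expectB//; last exact: bounded_mfun_cst.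
  by rewrite expect_cst (copies_expect i (bkern n)).
have Eu2 i : \int[P]_w (u (W i w) ^+ 2) <= 2 * b n * A n + 2 * f z0 ^+ 2.
  have bki := bounded_mfun_norm (bk i).
  have bc := bounded_mfun_cst Omega (2 * f z0 ^+ 2).
  have bZki := bounded_mfunZ (2 * b n) bki.
  have -> : 2 * b n * A n + 2 * f z0 ^+ 2 =
      \int[P]_w (2 * b n * `|kern n (Zs i w)| + 2 * f z0 ^+ 2).
    by rewrite (expectD P bZki bc) (expectZ P _ bki) expect_cst (copies_expect i bkn).
  apply: expect_le.
  - apply: bounded_mfunX; exact: (bounded_mfun_comp (mW i) bu).
  - exact: bounded_mfunD.
  - move=> w; rewrite /u /W /=; set x := kern n _.
    have x2 : x ^+ 2 <= b n * `|x|.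
      by rewrite -real_normK ?num_real// expr2 ler_wpM2r// kern_le.
    have := sqr_ge0 (x + f z0).
    by rewrite -mulrA; nra.
move=> /(_ Eu Eu2) le.
apply: le_trans (ler_wpM2l _ le) _; first by rewrite invr_ge0 sqr_ge0.
apply: le_trans rn; rewrite /r.
have -> (x y : R) : (n%:R * t) ^- 2 * (n%:R ^+ 2 * x + n%:R * y) =
    t ^- 2 * (x + y / n%:R).
  by field; rewrite !gt_eqF.
rewrite ler_wpM2l ?invr_ge0 ?sqr_ge0// lerD2l mulrDl lerD2r.
have -> : 2 * B * eps n = 2 * b n * B / n%:R by rewrite /eps; ring.
by rewrite ler_wpM2r ?invr_ge0// ler_wpM2l// mulr_ge0.
Unshelve. all: by end_near. Qed.


Let c_tau_norm : `|tau| <= 1. Proof. exact: cond_tau2_le1. Qed.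

Let psi n (ss : S * S) :=
  kern n ss.1.2 * kern n ss.2.2 * (symm g (ss.1.1, ss.2.1) - tau).

Let bkern2 n : bounded_mfun (fun zz : 'rV[R]_p * 'rV[R]_p => kern n zz.1 * kern n zz.2).
Proof.
apply: bounded_mfunM.
  exact: (bounded_mfun_comp measurable_fst (bkern n)).
exact: (bounded_mfun_comp measurable_snd (bkern n)).
Qed.

Let bpsi n : bounded_mfun (psi n).
Proof.
have mZZ : measurable_fun setT (fun ss : S * S => (ss.1.2, ss.2.2)).
  apply: measurable_fun_pair.
    exact: (measurableT_comp measurable_snd measurable_fst).
  exact: (measurableT_comp measurable_snd measurable_snd).
have mXX : measurable_fun setT (fun ss : S * S => (ss.1.1, ss.2.1)).
  apply: measurable_fun_pair.
    exact: (measurableT_comp measurable_fst measurable_fst).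
  exact: (measurableT_comp measurable_fst measurable_snd).
apply: bounded_mfunM; first exact: (bounded_mfun_comp mZZ (bkern2 n)).
apply: bounded_mfunB; last exact: bounded_mfun_cst.
exact: (bounded_mfun_comp mXX (symm_bounded_mfun g_cases)).
Qed.

Let psi_mean n i j : i != j -> \int[P]_w psi n (W i w, W j w) =
  \int[P]_w (kern n (Zs i w) * kern n (Zs j w) *
    (cond_tau2 kappa (Zs i w) (Zs j w) - tau)).
Proof.
move=> ij; have := symm_conditional ij (bkern2 n) => /= condE.
have mXX : measurable_fun setT (fun w => (Xs i w, Xs j w)) by exact: measurable_fun_pair.
have mZZ : measurable_fun setT (fun w => (Zs i w, Zs j w)) by exact: measurable_fun_pair.
have bk : bounded_mfun (fun w => kern n (Zs i w) * kern n (Zs j w)).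
  exact: (bounded_mfun_comp mZZ (bkern2 n)).
have bs : bounded_mfun (fun w => symm g (Xs i w, Xs j w)).
  exact: (bounded_mfun_comp mXX (symm_bounded_mfun g_cases)).
have bt : bounded_mfun (fun w => cond_tau2 kappa (Zs i w) (Zs j w)).
  split; first exact: (measurableT_comp measurable_cond_tau2 mZZ).
  by exists 1 => w; exact: cond_tau2_le1.
have lin q : bounded_mfun q ->
    \int[P]_w (kern n (Zs i w) * kern n (Zs j w) * (q w - tau)) =
    \int[P]_w (kern n (Zs i w) * kern n (Zs j w) * q w) -
    tau * \int[P]_w (kern n (Zs i w) * kern n (Zs j w)).
  move=> bq; rewrite -(expectZ P tau bk) -expectB.
  - by apply: eq_Rintegral => w _; ring.
  - exact: bounded_mfunM.
  - exact: bounded_mfunZ.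
by rewrite (lin _ bt) -condE -(lin _ bs).
Qed.

(** If both conditioning values are close to z0 then the conditional Kendall's tau
is within q of its limit; otherwise one of the two kernels is evaluated far from
z0, where its first absolute moment Fr vanishes in the limit. *)
Let psi_mean_small (m : R) : 0 < m -> \forall n \near \oo,
  forall i j, i != j -> `|\int[P]_w psi n (W i w, W j w)| <= m.
Proof.
move=> m0; have [B B0 AB] := A_bounded.
(* The neighbourhood contributes q A^2 <= m / 2, and each of the two far terms
   2 A Fr <= m / 4. *)
pose q := m / 2 / (B ^+ 2 + 1).
have B21 : 0 < B ^+ 2 + 1 by rewrite ltr_wpDl// sqr_ge0.
have q0 : 0 < q by rewrite !divr_gt0.
have [r r0 rP] : exists2 r, 0 < r & forall u v, norm2 (u - z0) <= r ->
    norm2 (v - z0) <= r -> `|cond_tau2 kappa u v - tau| <= q.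
  have /cvgrPdist_le/(_ _ q0) := ctau.
  move=> /nbhs_ballP[r /= r0 rP]; exists (r / 2); first by rewrite divr_gt0.
  move=> u v ur vr; rewrite distrC; apply: (rP (u, v)).
  have ball1 x : norm2 (x - z0) <= r / 2 -> ball z0 r x.
    move=> xr; apply/norm2_ball/(le_lt_trans xr).
    by rewrite ltr_pdivrMr// ltr_pMr// ltr1n.
  by split; exact: ball1.
have c0 : 0 < m / (8 * (B + 1)) by rewrite divr_gt0// mulr_gt0// ltr_wpDl.
have /cvgrPdist_le/(_ _ c0) := F_cvg r0.
move: AB; apply: filterS2 => n AnB; rewrite sub0r normrN => Fn i j ij.
have {}Fn := le_trans (ler_norm _) Fn.
have F0 : 0 <= Fr r n by apply: Rintegral_ge0 => w _; rewrite mulr_ge0.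
rewrite psi_mean//.
have bk k := bounded_mfun_norm (bZ k (bkern n)).
have bkf k : bounded_mfun (fun w => `|kern n (Zs k w)| * \1_(far r) (Zs k w)).
  exact: (bZ k (bKF r n)).
have mZZ : measurable_fun setT (fun w => (Zs i w, Zs j w)) by exact: measurable_fun_pair.
have bt : bounded_mfun (fun w => kern n (Zs i w) * kern n (Zs j w) *
    (cond_tau2 kappa (Zs i w) (Zs j w) - tau)).
  apply: bounded_mfunM; first exact: (bounded_mfun_comp mZZ (bkern2 n)).
  apply: bounded_mfunB; last exact: bounded_mfun_cst.
  split; first exact: (measurableT_comp measurable_cond_tau2 mZZ).
  by exists 1 => w; exact: cond_tau2_le1.
pose k1 w := `|kern n (Zs i w)| * `|kern n (Zs j w)|.
pose k2 w := (`|kern n (Zs i w)| * \1_(far r) (Zs i w)) * `|kern n (Zs j w)|.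
pose k3 w := `|kern n (Zs i w)| * (`|kern n (Zs j w)| * \1_(far r) (Zs j w)).
have bk1 : bounded_mfun k1 by exact: bounded_mfunM.
have bk2 : bounded_mfun k2 by exact: bounded_mfunM.
have bk3 : bounded_mfun k3 by exact: bounded_mfunM.
have prodE (x y : 'rV[R]_p -> R) : bounded_mfun x -> bounded_mfun y ->
    \int[P]_w (x (Zs i w) * y (Zs j w)) =
    \int[P]_w x (Z w) * \int[P]_w y (Z w).
  move=> bx bey; have [mx [xa xP]] := bx; have [my [ya yP]] := bey.
  rewrite -(copies_expect i bx) -(copies_expect j bey).
  have mS (f' : 'rV[R]_p -> R) : measurable_fun setT f' ->
      measurable_fun setT (fun ss : S * S => f' ss.1.2).
    move=> mf'; apply: (measurableT_comp mf').
    exact: (measurableT_comp measurable_snd measurable_fst).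
  exact: (@expectationM_pairs _ _ _ P _ _ W mW W_indep i i j j
    (fun ss => x ss.1.2) (fun ss => y ss.1.2) xa ya ij ij ij ij
    (mS _ mx) (mS _ my) (fun ss => xP ss.1.2) (fun ss => yP ss.1.2)).
have bkn := bounded_mfun_norm (bkern n).
have E1 : \int[P]_w k1 w = A n * A n by exact: (prodE _ _ bkn bkn).
have E2 : \int[P]_w k2 w = Fr r n * A n by exact: (prodE _ _ (bKF r n) bkn).
have E3 : \int[P]_w k3 w = A n * Fr r n by exact: (prodE _ _ bkn (bKF r n)).
apply: (@le_trans _ _ (q * (A n * A n) + 2 * (Fr r n * A n) + 2 * (A n * Fr r n))).
  rewrite -E1 -E2 -E3 -!expectZ// -expectD; [|exact: bounded_mfunZ..].
  rewrite -expectD; [|by apply: bounded_mfunD; exact: bounded_mfunZ|exact: bounded_mfunZ].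
  apply: le_trans (expect_norm_le P bt) _; apply: expect_le.
  - exact: bounded_mfun_norm.
  - apply: bounded_mfunD; last exact: bounded_mfunZ.
    by apply: bounded_mfunD; exact: bounded_mfunZ.
  - move=> w; rewrite normrM (normrM (kern n (Zs i w))) /k1 /k2 /k3 !indicE.
    set ki := `|kern n (Zs i w)|; set kj := `|kern n (Zs j w)|.
    set dd := `|cond_tau2 kappa _ _ - tau|.
    have dd2 : dd <= 2.
      rewrite /dd (le_trans (ler_normB _ _))//.
      have := cond_tau2_le1 (Zs i w) (Zs j w); have := c_tau_norm; lra.
    have ki0 : 0 <= ki by exact: normr_ge0.
    have kj0 : 0 <= kj by exact: normr_ge0.
    have kk0 : 0 <= ki * kj by rewrite mulr_ge0.
    have two0 (x : bool) : 0 <= 2 * x%:R :> R by rewrite mulr_ge0.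
    have step : dd <= q + 2 * (Zs i w \in far r)%:R + 2 * (Zs j w \in far r)%:R.
      have [ri|ri] := ltP r (norm2 (Zs i w - z0)).
        have -> : Zs i w \in far r by rewrite inE.
        rewrite mulr1; apply: (le_trans dd2).
        by rewrite -addrA addrCA lerDl addr_ge0// ltW.
      have [rj|rj] := ltP r (norm2 (Zs j w - z0)).
        have -> : Zs j w \in far r by rewrite inE.
        rewrite mulr1; apply: (le_trans dd2).
        by rewrite lerDr (addr_ge0 (ltW q0) (two0 _)).
      apply: le_trans (rP _ _ ri rj) _.
      by rewrite -addrA lerDl (addr_ge0 (two0 _) (two0 _)).
    apply: le_trans (ler_wpM2l kk0 step) _.
    by rewrite le_eqVlt; apply/orP; left; apply/eqP; ring.
have h1 : q * (A n * A n) <= m / 2.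
  apply: (@le_trans _ _ (q * (B ^+ 2 + 1))); last by rewrite /q divfK// gt_eqF.
  rewrite ler_wpM2l ?(ltW q0)// (@le_trans _ _ (B ^+ 2)) ?lerDl//.
  by rewrite expr2 ler_pM.
have h2 : Fr r n * A n <= m / 8.
  apply: (@le_trans _ _ (m / (8 * (B + 1)) * (B + 1))).
    by rewrite ler_pM// (le_trans AnB)// lerDl.
  have B1 : B + 1 != 0 by rewrite gt_eqF// ltr_wpDl.
  by rewrite le_eqVlt; apply/orP; left; apply/eqP; field; rewrite B1.
by rewrite (mulrC (A n) (Fr r n)); lra.
Qed.

(** Chebyshev's inequality; the square of the mean of a term is made smaller than
t^2 e / 2, and the rest of the second moment tends to 0 with eps. *)
Lemma numerator_estimate (t e : R) : 0 < t -> 0 < e -> \forall n \near \oo,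
  (P [set w | (n%:R ^+ 2 * t <
    `|\sum_(i < n) \sum_(j < n) psi n (W i w, W j w)|)%R] <= e%:E)%E.
Proof.
move=> t0 e0; have [B B0 AB] := A_bounded.
(* A term with mean at most t c contributes c^2 <= e / 2 to the bound. *)
pose c := Num.min 1 (e / 2).
have c0 : 0 < c by rewrite lt_min ltr01 divr_gt0.
have c2 : c ^+ 2 <= e / 2.
  rewrite expr2 -[leRHS]mul1r ler_pM ?(ltW c0)//.
    by rewrite ge_min lexx.
  by rewrite ge_min lexx orbT.
have msmall := psi_mean_small (mulr_gt0 t0 c0).
pose r n : R := t ^- 2 * (24 * eps n * ((B + 2 * eps n) * (B * (B + eps n)))).
have rc : r n @[n --> \oo] --> (0 : R).
  rewrite (_ : 0 = t ^- 2 * (24 * 0 * ((B + 2 * 0) * (B * (B + 0))))); last by ring.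
  apply: cvgMl_tmp; apply: cvgM; first exact: cvgMl_tmp.
  apply: cvgM; first by apply: cvgD; [exact: cvg_cst|exact: cvgMl_tmp].
  by apply: cvgMl_tmp; apply: cvgD => //; exact: cvg_cst.
have e2 : 0 < e / 2 by rewrite divr_gt0.
have /cvgrPdist_le/(_ _ e2) rle := rc.
have n1 : \forall n \near \oo, (0 < n)%N by exists 1%N.
near=> n.
have An : A n <= B by near: n.
have rn : r n <= e / 2.
  near: n; apply: filterS rle => n; rewrite sub0r normrN.
  by apply: le_trans; exact: ler_norm.
have mn : forall i j, i != j -> `|\int[P]_w psi n (W i w, W j w)| <= t * c.
  by near: n.
have n0 : (0 < n)%N by near: n.
have nR : 0 < n%:R :> R by rewrite ltr0n.
have n2t : 0 < n%:R ^+ 2 * t by rewrite mulr_gt0// exprn_gt0.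
have bSum : bounded_mfun (fun w => \sum_(i < n) \sum_(j < n) psi n (W i w, W j w)).
  apply: bounded_mfun_sum => i; apply: bounded_mfun_sum => j.
  apply: (bounded_mfun_comp (U := fun w => (W i w, W j w)) _ (bpsi n)).
  exact: measurable_fun_pair.
apply: le_trans (chebyshev_bound P bSum n2t) _; rewrite lee_fin.
pose phi (s : S) := `|kern n s.2|.
have mphi : measurable_fun setT phi.
  exact: (measurableT_comp (bounded_mfun_norm (bkern n)).1 measurable_snd).
have phi0 s : 0 <= phi s by exact: normr_ge0.
have phib s : phi s <= b n by exact: kern_le.
have phiA i : \int[P]_w phi (W i w) = A n.
  exact: (copies_expect i (bounded_mfun_norm (bkern n))).
have psi_le x y : `|psi n (x, y)| <= 2 * (phi x * phi y).
  rewrite /psi normrM (normrM (kern n _)) mulrC ler_wpM2r ?mulr_ge0//.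
  rewrite (le_trans (ler_normB _ _))//.
  have := symm_norm_le1 (x.1, y.1) g_cases; have := c_tau_norm.
  by rewrite /=; lra.
have := pair_sum_second_moment mW W_indep mphi (bpsi n).1 phi0 phib phiA (ler0n _ 2)
  psi_le mn n => le.
apply: le_trans (ler_wpM2l _ le) _; first by rewrite invr_ge0 sqr_ge0.
have -> (x y : R) : (n%:R ^+ 2 * t) ^- 2 * (n%:R ^+ 4 * (t * c) ^+ 2 +
    6 * 2 ^+ 2 * b n * ((n%:R * x + 2 * b n) * (n%:R * x * (n%:R * x + b n)))) =
    c ^+ 2 + t ^- 2 * (24 * eps n * ((x + 2 * eps n) * (x * (x + eps n)))).
  by rewrite /eps; field; rewrite !gt_eqF.
apply: (@le_trans _ _ (c ^+ 2 + r n)); last by lra.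
have t2 : 0 <= t ^- 2 by rewrite invr_ge0 sqr_ge0.
have e24 : 0 <= 24 * eps n by exact: (mulr_ge0 (ler0n _ 24) (eps0 n)).
have e20 : 0 <= 2 * eps n by exact: (mulr_ge0 (ler0n _ 2) (eps0 n)).
rewrite lerD2l /r ler_wpM2l// ler_wpM2l// ler_pM ?lerD2r//.
- exact: (addr_ge0 (A0 n) e20).
- exact: (mulr_ge0 (A0 n) (addr_ge0 (A0 n) (eps0 n))).
- by apply: ler_pM => //; [exact: (addr_ge0 (A0 n) (eps0 n))|rewrite lerD2r].
Unshelve. all: by end_near. Qed.

(** The weights sum to 1, so tau can be moved inside the double sum, which is
invariant under exchanging the two observations. *)
Lemma tau_hat_error n (x : nat -> R * R) (z : nat -> 'rV[R]_p) :
  kernel_mass K (h n) n z z0 != 0 ->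
  tau_hat K (h n) g n x z z0 - tau = (kernel_mass K (h n) n z z0) ^- 2 *
    \sum_(i < n) \sum_(j < n) psi n ((x i, z i), (x j, z j)).
Proof.
set m := kernel_mass _ _ _ _ _ => m0.
pose T (G : R * R -> R * R -> R) := \sum_(i < n) \sum_(j < n)
  kern n (z i) * kern n (z j) * G (x i) (x j).
have T1 c : T (fun _ _ => c) = c * m ^+ 2.
  rewrite /T expr2 /m /kernel_mass mulr_suml mulr_sumr; apply: eq_bigr => i _.
  by rewrite !mulr_sumr; apply: eq_bigr => j _; rewrite /kern; ring.
have Tsym : T g = T (fun u v => symm g (u, v)).
  have Tsw : T g = T (fun u v => g v u).
    rewrite /T exchange_big; apply: eq_bigr => i _; apply: eq_bigr => j _ /=.
    by rewrite (mulrC (kern n (z j))).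
  rewrite (_ : T g = 2^-1 * T g + 2^-1 * T g); last by field.
  rewrite {2}Tsw /T !mulr_sumr -big_split; apply: eq_bigr => i _.
  rewrite !mulr_sumr -big_split; apply: eq_bigr => j _ /=.
  by rewrite /symm /=; field.
have -> : tau_hat K (h n) g n x z z0 = m ^- 2 * T g.
  rewrite /tau_hat /T mulr_sumr; apply: eq_bigr => i _; rewrite mulr_sumr.
  apply: eq_bigr => j _; rewrite /kernel_weight -/m /kern.
  by field.
have -> : \sum_(i < n) \sum_(j < n) psi n ((x i, z i), (x j, z j)) =
    T (fun u v => symm g (u, v)) - T (fun _ _ => tau).
  rewrite /T -sumrB; apply: eq_bigr => i _; rewrite -sumrB; apply: eq_bigr => j _.
  by rewrite /psi /= mulrBr.
by rewrite Tsym T1; field.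
Qed.

(** Off the two exceptional events the kernel mass is at least n (f z0) / 2 and
the double sum is at most n^2 t (f z0 / 2)^2. *)
Lemma tau_hat_consistent (t e : R) : 0 < t -> 0 < e -> \forall n \near \oo,
  exists Bad : set Omega, [/\ measurable Bad, (P Bad <= e%:E)%E &
    forall w, ~ Bad w -> kernel_mass K (h n) n (Zs ^~ w) z0 != 0 /\
      `|tau_hat K (h n) g n (Xs ^~ w) (Zs ^~ w) z0 - tau| <= t].
Proof.
move=> t0 e0; have e2 : 0 < e / 2 by rewrite divr_gt0.
have f2 : 0 < f z0 / 2 by rewrite divr_gt0.
have s0 : 0 < t * (f z0 / 2) ^+ 2 by rewrite mulr_gt0// exprn_gt0.
have := numerator_estimate s0 e2; have := density_estimate f2 e2.
have n1 : \forall n \near \oo, (0 < n)%N by exists 1%N.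
move: n1; apply: filterS3 => n n0 Pd Pn.
have nR : 0 < n%:R :> R by rewrite ltr0n.
pose D w := \sum_(i < n) (kern n (Zs i w) - f z0).
pose N w := \sum_(i < n) \sum_(j < n) psi n (W i w, W j w).
have mset (q : Omega -> R) a : bounded_mfun q -> measurable [set w | a < `|q w|].
  move=> bq; rewrite -[X in measurable X]setTI.
  by apply: measurable_fun_ltr => //; exact: (bounded_mfun_norm bq).1.
have mD : measurable [set w | n%:R * (f z0 / 2) < `|D w|].
  apply: mset; apply: bounded_mfun_sum => i.
  by apply: bounded_mfunB; [exact: (bZ i (bkern n))|exact: bounded_mfun_cst].
have mN : measurable [set w | n%:R ^+ 2 * (t * (f z0 / 2) ^+ 2) < `|N w|].
  apply: mset; apply: bounded_mfun_sum => i; apply: bounded_mfun_sum => j.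
  apply: (bounded_mfun_comp (U := fun w => (W i w, W j w)) _ (bpsi n)).
  exact: measurable_fun_pair.
exists ([set w | n%:R * (f z0 / 2) < `|D w|] `|`
        [set w | n%:R ^+ 2 * (t * (f z0 / 2) ^+ 2) < `|N w|]); split.
- exact: measurableU.
- apply: le_trans (measureU2 P mD mN) _.
  have -> : e%:E = ((e / 2)%:E + (e / 2)%:E)%E by rewrite -EFinD -splitr.
  exact: leeD.
- move=> w /not_orP[/negP + /negP]; rewrite -!leNgt => Dw Nw.
  have massE : kernel_mass K (h n) n (Zs ^~ w) z0 = D w + n%:R * f z0.
    rewrite /D sumrB sumr_const card_ord /kernel_mass /kern.
    by rewrite -(mulr_natl (f z0)) subrK.
  have mass_ge : n%:R * (f z0 / 2) <= kernel_mass K (h n) n (Zs ^~ w) z0.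
    rewrite massE; move: Dw; rewrite ler_norml => /andP[Dw _].
    have : n%:R * f z0 = n%:R * (f z0 / 2) + n%:R * (f z0 / 2) by field.
    by move: Dw; set y := _ * (_ / 2); lra.
  have nf0 : 0 < n%:R * (f z0 / 2) by rewrite mulr_gt0.
  have mass0 : 0 < kernel_mass K (h n) n (Zs ^~ w) z0 by exact: lt_le_trans mass_ge.
  split; first by rewrite gt_eqF.
  rewrite tau_hat_error ?gt_eqF// normrM normfV normrX (gtr0_norm mass0).
  rewrite mulrC ler_pdivrMr ?exprn_gt0//; apply: le_trans Nw _.
  rewrite mulrCA ler_wpM2l ?(ltW t0)// -exprMn.
  by apply: lerXn2r; rewrite ?nnegrE ?(ltW nf0) ?(ltW mass0).
Qed.

End at_a_point.

End estimator.

(** * Convergence of the minimizers *)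

Lemma measure_bigsetU_le d (T : measurableType d) (R : realType)
    (P : probability T R) (I : Type) (s : seq I) (B : I -> set T) :
  (forall i, measurable (B i)) ->
  (P (\big[setU/set0]_(i <- s) B i) <= \sum_(i <- s) P (B i))%E.
Proof.
move=> mB; elim: s => [|i s IHs]; first by rewrite !big_nil measure0.
rewrite !big_cons (le_trans (measureU2 P _ _))//; last exact: leeD.
by apply: bigsetU_measurable.
Qed.

Lemma limit_criterionE (R : realType) (q m : nat) (a : 'I_m -> 'rV[R]_q)
    (bstar : 'rV[R]_q) (l : R) :
  limit_criterion a bstar l = lasso_criterion (fun i => dotv (a i) bstar) a l.
Proof.
apply/funext => b; rewrite /limit_criterion /lasso_criterion.
by congr (_ * _ + _); apply: eq_bigr => i _; rewrite dotvBr.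
Qed.

(** A minimizer makes every residual dotv (a i) (bstar - u) vanish, and a left
inverse of the matrix of the a i then recovers bstar - u = 0. *)
Lemma limit_criterion_full_rank (R : realType) (q m : nat)
    (a : 'I_m -> 'rV[R]_q) (bstar : 'rV[R]_q) :
  (0 < m)%N -> row_full (\matrix_(i < m) a i) ->
  is_unique_argmin (limit_criterion a bstar 0) bstar.
Proof.
move=> m0 /row_fullP[B BA].
have mR : 0 < (m%:R)^-1 :> R by rewrite invr_gt0 ltr0n.
have dot0 u : dotv u 0 = 0 :> R.
  by rewrite /dotv big1// => i _; rewrite mxE mulr0.
have G0 : limit_criterion a bstar 0 bstar = 0.
  rewrite /limit_criterion mul0r addr0 big1 ?mulr0// => i _.
  by rewrite subrr dot0 expr0n.
have sum0 b : 0 <= \sum_(i < m) dotv (a i) (bstar - b) ^+ 2.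
  by apply: sumr_ge0 => i _; exact: sqr_ge0.
split=> [u|u umin].
  by rewrite G0 /limit_criterion mul0r addr0 mulr_ge0// ltW.
have := umin bstar; rewrite G0 /limit_criterion mul0r addr0 pmulr_rle0//.
move=> le0.
have dot_eq0 i : dotv (a i) (bstar - u) = 0.
  apply/eqP; rewrite -sqrf_eq0 eq_le sqr_ge0 andbT; apply: le_trans le0.
  by rewrite (bigD1 i)//= lerDl; apply: sumr_ge0 => j _; exact: sqr_ge0.
have Av : (\matrix_(i < m) a i) *m (bstar - u)^T = 0.
  apply/matrixP => i j; rewrite !mxE ord1 -[RHS](dot_eq0 i) /dotv.
  by apply: eq_bigr => k _; rewrite !mxE.
have : (bstar - u)^T = 0 by rewrite -[LHS]mul1mx -BA -mulmxA Av mulmx0.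
by move=> /(congr1 trmx); rewrite trmxK trmx0 => /eqP; rewrite subr_eq0 => /eqP ->.
Qed.

Theorem theorem8 (R : realType) (p q n' : nat) (p_gt0 : (0 < p)%N)
    (n'_gt0 : (0 < n')%N)
    (d : measure_display) (Omega : measurableType d) (P : probability Omega R)
    (X : {RV P >-> (R * R)%type}) (Z : {RV P >-> 'rV[R]_p})
    (Xs : nat -> {RV P >-> (R * R)%type}) (Zs : nat -> {RV P >-> 'rV[R]_p})
    (copies : iid_copies X Z Xs Zs)
    (fZ : 'rV[R]_p -> R) (fZ_density : is_density Z fZ)
    (kappa : 'rV[R]_p -> probability (R * R)%type R)
    (kappa_law : is_conditional_law X Z kappa)
    (g : R * R -> R * R -> R) (g_cases : [\/ g = @g1 R, g = @g2 R | g = @g3 R])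
    (tau_g : forall z, cond_tau kappa z = cond_mean2 kappa g z z)
    (ZZ : set 'rV[R]_p) (ZZ_compact : compact ZZ)
    (fZ_bounded_below : exists2 c : R, 0 < c & forall z, ZZ z -> c <= fZ z)
    (fZ_continuous : forall z, ZZ z -> {for z, continuous fZ})
    (tau_continuous : forall z, ZZ z -> cond_tau_continuous_at kappa z)
    (Lam : R -> R) (Lam_link : is_link_function Lam)
    (psi : 'rV[R]_p -> 'rV[R]_q) (bstar : 'rV[R]_q)
    (model : forall z, ZZ z -> Lam (cond_tau kappa z) = dotv (psi z) bstar)
    (K : 'rV[R]_p -> R)
    (K_order : exists2 alpha : nat, (1 < alpha)%N & kernel_of_order alpha K)
    (K_tail : forall e : R, 0 < e ->
       exists M : R, forall t, M < norm2 t -> `|K t| * norm2 t ^+ p < e)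
    (h : nat -> R) (h_gt0 : forall n, 0 < h n)
    (h_cvg0 : h @ \oo --> (0 : R))
    (nh_cvgy : (fun n => n%:R * h n ^+ p) @ \oo --> +oo)
    (z' : 'I_n' -> 'rV[R]_p) (z'_in : forall i, ZZ (z' i))
    (lambda : nat -> R) (lambda_ge0 : forall n, 0 <= lambda n)
    (lambda0 : R) (lambda_cvg : lambda @ \oo --> lambda0)
    (bhat : nat -> {RV P >-> 'rV[R]_q})
    (bhat_argmin : forall n w,
       (forall i, kernel_mass K (h n) n (Zs ^~ w) (z' i) != 0) ->
       is_argmin
         (lasso_criterion
            (fun i => Lam (tau_hat K (h n) g n (Xs ^~ w) (Zs ^~ w) (z' i)))
            (fun i => psi (z' i)) (lambda n))
         (bhat n w)) :
  (forall bss : 'rV[R]_q,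
     is_unique_argmin (limit_criterion (fun i => psi (z' i)) bstar lambda0) bss ->
     cvg_in_probability bhat bss) /\
  (lambda0 = 0 -> row_full (\matrix_(i < n') psi (z' i)) ->
     cvg_in_probability bhat bstar).
Proof.
have [alpha _ [mK [M KM] _ Kabs K1 _]] := K_order.
have consistent bss :
    is_unique_argmin (limit_criterion (fun i => psi (z' i)) bstar lambda0) bss ->
    cvg_in_probability bhat bss.
  rewrite limit_criterionE => bss_min e e0.
  have q1 : 0 < q%:R + 1 :> R by rewrite ltr_wpDl.
  have [dl dl0 stable] := lasso_argmin_stable bss_min (divr_gt0 e0 q1).
  have [c c0 cf] := fZ_bounded_below.
  have taudl i : exists2 t, 0 < t & forall x, `|x - cond_tau kappa (z' i)| <= t ->
      `|Lam x - dotv (psi (z' i)) bstar| <= dl.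
    have ti : cond_tau kappa (z' i) \in `[-1, 1].
      by rewrite in_itv/= -ler_norml; exact: cond_tau2_le1.
    have /cvgrPdist_le/(_ _ dl0) := link_extension Lam_link ti.
    move=> /nbhs_ballP[t /= t0 tP]; exists (t / 2); first by rewrite divr_gt0.
    move=> x xt; rewrite -model// distrC; apply: tP; rewrite /ball /= distrC.
    by rewrite (le_lt_trans xt)// ltr_pdivrMr// ltr_pMr// ltr1n.
  have mbad n : measurable [set w | e < norm2 (bhat n w - bss)].
    rewrite -[X in measurable X]setTI; apply: measurable_fun_ltr => //.
    exact: (measurableT_comp (measurable_norm2B bss) (measurable_funPT (bhat n))).
  apply/fine_cvgP; split.
    by apply: nearW => n; exact: fin_num_measure.
  apply/cvgrPdist_le => eta eta0.
  have n'R : 0 < n'%:R :> R by rewrite ltr0n.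
  have eta'0 : 0 < eta / n'%:R by rewrite divr_gt0.
  have all_good : \forall n \near \oo, forall i : 'I_n',
      exists Bad : set Omega, [/\ measurable Bad, (P Bad <= (eta / n'%:R)%:E)%E &
      forall w, ~ Bad w -> kernel_mass K (h n) n (Zs ^~ w) (z' i) != 0 /\
        `|Lam (tau_hat K (h n) g n (Xs ^~ w) (Zs ^~ w) (z' i)) -
          dotv (psi (z' i)) bstar| <= dl].
    apply: filter_forall => i; have [t t0 tP] := taudl i.
    have := tau_hat_consistent copies fZ_density kappa_law g_cases tau_g mK KM Kabs
      K1 K_tail h_gt0 h_cvg0 nh_cvgy (fZ_continuous _ (z'_in i))
      (lt_le_trans c0 (cf _ (z'_in i))) (tau_continuous _ (z'_in i)) t0 eta'0.
    apply: filterS => n [Bad [mBad PBad BadP]]; exists Bad; split=> // w /BadP[? ?].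
    by split=> //; exact: tP.
  have /cvgrPdist_le/(_ _ dl0) lam_near := lambda_cvg.
  move: all_good lam_near; apply: filterS2 => n /choice[Bad BadP] lamn.
  rewrite sub0r normrN ger0_norm ?fine_ge0//.
  rewrite -lee_fin fineK ?fin_num_measure//.
  have mBad i : measurable (Bad i) by case: (BadP i).
  apply: (@le_trans _ _ (P (\big[setU/set0]_(i < n') Bad i))).
    apply: le_measure; rewrite ?inE//; first exact: bigsetU_measurable.
    move=> w /= ew; apply: contrapT => wBad.
    have good i : ~ Bad i w.
      by move=> Biw; apply: wBad; rewrite (bigD1 i)//; left.
    have bmin := bhat_argmin n w (fun i => let: And3 _ _ G := BadP i in (G w (good i)).1).
    have := stable _ _ _ (lambda_ge0 n)
      (fun i => let: And3 _ _ G := BadP i in (G w (good i)).2) _ bmin.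
    rewrite distrC => /(_ lamn) le.
    move: ew; apply/negP; rewrite -leNgt.
    apply: le_trans (norm2_le_mx_norm _) _.
    apply: (@le_trans _ _ (q%:R * (e / (q%:R + 1)))); first by rewrite ler_wpM2l.
    by rewrite mulrCA ler_piMr ?(ltW e0)// ler_pdivrMr// mul1r lerDl.
  apply: le_trans (measure_bigsetU_le P _ mBad) _.
  apply: (@le_trans _ _ (\sum_(i < n') (eta / n'%:R)%:E)%E).
    by apply: lee_sum => i _; case: (BadP i).
  rewrite sumEFin sumr_const card_ord lee_fin -(mulr_natr (eta / _)) divfK//.
  by rewrite gt_eqF.
split=> // lambda00 full; apply: consistent; rewrite lambda00.
exact: limit_criterion_full_rank.
Qed.
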